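(* The problem $\textsc{AchievementPos}(2,2)$ is in {\sf P}. More precisely, there is an algorithm which, given an achievement positional game $\mathcal{G}=(V,E_L,E_R)$ in which every element of $E_L\cup E_R$ has size at most 2, decides whether Left has a winning strategy on $\mathcal{G}$ as first player (respectively, as second player) in time $O(|V|^2|E_L|+|V||E_R|)$.
   Context: A hypergraph is a pair $(V,E)$ with $V$ finite and $E\subseteq 2^V\setminus\{\varnothing\}$. An achievement positional game is a triple $\mathcal{G}=(V,E_L,E_R)$ where $(V,E_L)$ and $(V,E_R)$ are hypergraphs; elements of $E_L$ are blue edges, elements of $E_R$ are red edges. Two players, Left and Right, alternately pick a previously unpicked vertex of $V$ (either player may be designated to start). A player fills an edge when they have picked all its vertices. If Left fills a blue edge before Right fills a red edge, Left wins; if Right fills a red edge before Left fills a blue edge, Right wins; if neither happens before all vertices are picked, the game is a draw. For integers $p,q\ge 0$, $\textsc{AchievementPos}(p,q)$ is the decision problem: given an achievement positional game $\mathcal{G}=(V,E_L,E_R)$ in which every element of $E_L$ has size at most $p$ and every element of $E_R$ has size at most $q$, decide whether Left has a winning strategy on $\mathcal{G}$ as first player. *)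

(* Defs.v *)
From mathcomp Require Import all_boot.
Set Implicit Arguments. Unset Strict Implicit. Unset Printing Implicit Defensive.

(* The hypergraph whose edges are the sets {a,b} for (a,b) in s
   (a = b gives a singleton edge).  Every edge is nonempty, of size <= 2. *)
Definition edgeset n (s : seq ('I_n * 'I_n)) : {set {set 'I_n}} :=
  [set [set p.1; p.2] | p in s].

Definition fills n (S : {set 'I_n}) (E : {set {set 'I_n}}) : bool :=
  [exists e in E, e \subset S].

(* left_wins_from k EL ER L R lt : Left (owning L) has a winning strategy from
   the position where Left has picked L, Right has picked R, no edge has been
   filled yet, k vertices remain unpicked, and it is Left's turn iff lt.
   If no vertex remains the game is a draw (Left does not win). *)
Fixpoint left_wins_from n (k : nat) (EL ER : {set {set 'I_n}})
    (L R : {set 'I_n}) (lt : bool) : bool :=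
  match k with
  | 0 => false
  | k'.+1 =>
    if lt then
      [exists v, (v \notin L :|: R) &&
         (fills (v |: L) EL || left_wins_from k' EL ER (v |: L) R false)]
    else
      [forall v, (v \notin L :|: R) ==>
         (~~ fills (v |: R) ER && left_wins_from k' EL ER L (v |: R) true)]
  end.

Definition left_wins n (EL ER : {set {set 'I_n}}) (lfirst : bool) : bool :=
  left_wins_from n EL ER set0 set0 lfirst.

(* Registers are indexed by nat and hold nat.  Only +1/-1 arithmetic, so unit
   cost is honest; indirect addressing gives O(1) random access. *)
Inductive instr : Type :=
  | Inc of nat
  | Dec of nat
  | Clr of nat
  | Mov of nat & nat
  | LoadI of nat & nat
  | StoreI of nat & nat
  | Jz of nat & nat
  | Jmp of nat.

Definition program := seq instr.
Definition regs := nat -> nat.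

Definition upd (m : regs) (r v : nat) : regs := fun i => if i == r then v else m i.

Definition step (P : program) (pc : nat) (m : regs) : nat * regs :=
  match nth (Jmp pc) P pc with
  | Inc r => (pc.+1, upd m r (m r).+1)
  | Dec r => (pc.+1, upd m r (m r).-1)
  | Clr r => (pc.+1, upd m r 0)
  | Mov r s => (pc.+1, upd m r (m s))
  | LoadI r s => (pc.+1, upd m r (m (m s)))
  | StoreI r s => (pc.+1, upd m (m r) (m s))
  | Jz r l => (if m r == 0 then l else pc.+1, m)
  | Jmp l => (l, m)
  end.

Fixpoint exec (P : program) (t : nat) (pc : nat) (m : regs) : option regs :=
  if size P <= pc then Some m else
  match t with
  | 0 => None
  | t'.+1 => let: (pc', m') := step P pc m in exec P t' pc' m'
  end.

Definition encode_edges n (s : seq ('I_n * 'I_n)) : seq nat :=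
  flatten [seq [:: nat_of_ord p.1; nat_of_ord p.2] | p <- s].

Definition input n (eL eR : seq ('I_n * 'I_n)) (lfirst : bool) : regs :=
  fun i => nth 0 ([:: n; size eL; size eR; nat_of_bool lfirst]
                   ++ encode_edges eL ++ encode_edges eR) i.

(* Main.v *)
Require Import Defs.
From mathcomp Require Import all_boot.
From mathcomp Require Import zify.
From Stdlib Require Import FunctionalExtensionality.
Set Implicit Arguments. Unset Strict Implicit. Unset Printing Implicit Defensive.

(* Singleton edges either decide the game at once or force one opening move;
   what remains are positions without pending threats.  If it is Left's turn, Left wins iff
   some vertex has two blue neighbours left; otherwise the blue graph is a matching
   and Right answers along it.  If it is Right's turn and some vertex has two red
   neighbours left, Right wins.  Otherwise the red graph is a matching and any pick
   of Right starts a forced chain: Left must take the red mate, Right must take the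
   unique blue neighbour of that mate, and so on, until Left makes a double threat,
   Left gets a free move, or Right gets a free move again.  In the last case Right
   may commit to the chain (right_holds_released), so that a greedy search is
   correct: try all starting vertices and commit to every chain that gives the free
   move back, until none does.  There are at most n + 1 passes over n vertices, and
   a chain costs O(|E_L|), because the blue neighbourhoods that it scans belong to
   distinct vertices.

   The register machine has no room to work in at the start, the input filling the
   memory from address 4 on, so the input is first moved upwards.  Having no
   addition, it stores vertices as addresses of records. *)

(** Two costs shape the algorithm. In the free search the red graph is a matching, a property that
    survives deletions, so the red mates are computed once and only their liveness is tested
    afterwards. This keeps |E_R| out of the passes. In the chain forced by the opening, red degrees
    are arbitrary, and the mates are rebuilt before every exchange. This costs about |E_L| (n +
    |E_R|), which the bound absorbs because distinct red edges number at most n^2. Every exchange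
    that prolongs a chain uses up a blue neighbour, so the number of exchanges is O(|E_L|) whatever
    n is. A failed chain is undone along a trail of that length, so that trying a vertex costs
    O(|E_L|) even when it fails. Without blue edges the bound can be as small as a constant, which
    leaves no time for any initialization; that case is answered outright. *)

Section Neighbours.

Variable T : finType.
Implicit Types (E : {set {set T}}) (U : {set T}) (v x : T).

(** The condition [x != v] keeps singleton edges out: for [x = v] the set [[set v; x]] is
    [[set v]]. *)
Definition nbr E U v : {set T} := [set x in U | (x != v) && ([set v; x] \in E)].

Definition degree_le1 E U : bool := [forall v in U, #|nbr E U v| <= 1].

Lemma in_nbr E U v x : (x \in nbr E U v) = [&& x \in U, x != v & [set v; x] \in E].
Proof. by rewrite inE. Qed.

Lemma nbr_sym E U v x : v \in U -> x \in nbr E U v -> v \in nbr E U x.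
Proof. by move=> vU; rewrite !in_nbr vU eq_sym setUC => /and3P[_ -> ->]. Qed.

Lemma nbr_sub E U v : nbr E U v \subset U.
Proof. by apply/subsetP=> x; rewrite in_nbr => /and3P[]. Qed.

Lemma nbrS E U U' v : U' \subset U -> nbr E U' v = nbr E U v :&: U'.
Proof.
move/subsetP=> sU; apply/setP=> x; rewrite in_setI !in_nbr.
by case U'x: (x \in U'); rewrite ?andbF // (sU _ U'x) andbT.
Qed.

Lemma nbr_setD1 E U v : nbr E U v :\ v = nbr E U v.
Proof. by apply/setP=> z; rewrite in_setD1 in_nbr; case: eqP; rewrite ?andbF. Qed.

Lemma nbrSS E U U' v : U' \subset U -> nbr E U' v \subset nbr E U v.
Proof. by move/nbrS=> ->; apply: subsetIl. Qed.

Lemma degree_le1S E U U' : U' \subset U -> degree_le1 E U -> degree_le1 E U'.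
Proof.
move=> sU /forall_inP dU; apply/forall_inP=> v vU'.
by rewrite (leq_trans (subset_leq_card (nbrSS _ _ sU))) ?dU // (subsetP sU).
Qed.

Lemma cards_le1_cases (A : {set T}) : #|A| <= 1 -> A = set0 \/ exists x, A = [set x].
Proof.
rewrite leq_eqVlt ltnS leqn0 cards_eq0 => /orP[/cards1P[x ->]|/eqP->]; first by right; exists x.
by left.
Qed.

End Neighbours.

(** * Reduction of the game to its pending threats *)

Section Game.

Variables (n : nat) (EL ER : {set {set 'I_n}}).
Implicit Types (U TB TR L R : {set 'I_n}) (v w x y : 'I_n).

(* The position as seen by the remaining play: U is the set of unpicked
   vertices, TB (TR) the set of vertices that would complete a blue (red) edge
   if picked now by Left (Right). *)
Fixpoint threat_game k U TB TR (lt : bool) : bool :=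
  match k with
  | 0 => false
  | k'.+1 =>
    if lt then
      [exists v in U, (v \in TB) ||
         threat_game k' (U :\ v) ((TB :|: nbr EL U v) :\ v) (TR :\ v) false]
    else
      [forall v in U, (v \notin TR) &&
         threat_game k' (U :\ v) (TB :\ v) ((TR :|: nbr ER U v) :\ v) true]
  end.

Definition small_edges (E : {set {set 'I_n}}) := forall e, e \in E -> exists a b, e = [set a; b].

Definition threats (E : {set {set 'I_n}}) U L : {set 'I_n} :=
  [set v in U | fills (v |: L) E].

(** An edge that [x] completes after the pick of [v] contains [x], since otherwise it would be
    filled already. If it also contains [v], then, having at most two elements, it is [[set v; x]];
    if not, [x] was a threat before. *)
Lemma threats_pick (E : {set {set 'I_n}}) U L v :
  small_edges E -> v \in U -> [disjoint U & L] -> ~~ fills (v |: L) E ->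
  threats E (U :\ v) (v |: L) = (threats E U L :|: nbr E U v) :\ v.
Proof.
move=> smE vU dUL nfv; apply/setP=> x; rewrite !inE.
case: (eqVneq x v) => //= xv; case xU: (x \in U) => //=.
apply/idP/orP.
  case/exists_inP=> e eE es.
  have [xe|xe] := boolP (x \in e); last first.
    case/negP: nfv; apply/exists_inP; exists e => //.
    apply/subsetP=> z ze; have := subsetP es _ ze.
    by rewrite !inE => /orP[/eqP zx|//]; rewrite -zx ze in xe.
  have [ve|ve] := boolP (v \in e); last first.
    left; apply/exists_inP; exists e => //; apply/subsetP=> z ze.
    have := subsetP es _ ze; rewrite !inE => /or3P[->//|/eqP zv|->]; last by rewrite orbT.
    by rewrite -zv ze in ve.
  right; have [a [b eab]] := smE _ eE.
  suff -> : [set v; x] = e by [].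
  move: xe ve xv; rewrite eab !inE => /orP[]/eqP-> /orP[]/eqP->; rewrite ?eqxx //.
  by rewrite setUC.
case.
  case/exists_inP=> e eE es; apply/exists_inP; exists e => //.
  by apply: (subset_trans es); apply/setUS/subsetUr.
move=> eE; apply/exists_inP; exists [set v; x] => //.
by apply/subsetP=> z; rewrite !inE => /orP[]->; rewrite ?orbT.
Qed.

Lemma threats_other (E : {set {set 'I_n}}) U L v :
  threats E (U :\ v) L = threats E U L :\ v.
Proof. by apply/setP=> x; rewrite !inE andbA. Qed.

(** A pick updates the threats of the picker by [threats_pick] and merely deletes the vertex from
    those of the opponent. Edges spoiled by the opponent need no bookkeeping, because [nbr] only
    looks at unpicked vertices. *)
Lemma left_wins_from_threat_game k L R lt :
  small_edges EL -> small_edges ER -> ~~ fills L EL -> ~~ fills R ER ->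
  left_wins_from k EL ER L R lt =
  threat_game k (~: (L :|: R)) (threats EL (~: (L :|: R)) L) (threats ER (~: (L :|: R)) R) lt.
Proof.
move=> smL smR; elim: k L R lt => [//|k IH] L R lt nL nR /=.
have dj1 : [disjoint ~: (L :|: R) & L].
  by rewrite disjoint_sym -setI_eq0 setCU setIA setICr set0I.
have dj2 : [disjoint ~: (L :|: R) & R].
  by rewrite disjoint_sym -setI_eq0 setCU setICA setICr setI0.
have UL v : ~: ((v |: L) :|: R) = ~: (L :|: R) :\ v.
  by apply/setP=> z; rewrite !inE !negb_or andbA.
have UR v : ~: (L :|: (v |: R)) = ~: (L :|: R) :\ v.
  by apply/setP=> z; rewrite !inE !negb_or; case: (z == v); rewrite ?andbF.
case: lt.
  apply: eq_existsb => v; rewrite [v \in ~: _]inE.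
  case vU: (v \notin L :|: R) => //=; rewrite [v \in threats _ _ _]inE [v \in ~: _]inE vU /=.
  case fv: (fills (v |: L) EL) => //=.
  by rewrite IH ?fv // UL threats_pick ?fv // ?threats_other // inE.
apply: eq_forallb => v; rewrite [v \in ~: _]inE.
case vU: (v \notin L :|: R) => //=; rewrite [v \in threats _ _ _]inE [v \in ~: _]inE vU /=.
case fv: (fills (v |: R) ER) => //=.
by rewrite IH ?fv // UR threats_pick ?fv // ?threats_other // inE.
Qed.

(** * Outcomes of positions with none, one or several threats *)

Local Notation play U TB TR lt := (threat_game #|U%SET| U TB TR lt).

Lemma play_left U TB TR :
  play U TB TR true =
  [exists v in U, (v \in TB) || play (U :\ v) ((TB :|: nbr EL U v) :\ v) (TR :\ v) false].
Proof.
case k: #|U| => [|k'] /=.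
  apply/esym/negbTE/existsPn=> v; move/eqP: k; rewrite cards_eq0 => /eqP->.
  by rewrite inE.
apply: eq_existsb => v; case vU: (v \in U) => //=.
by have := cardsD1 v U; rewrite vU k add1n => -[->].
Qed.

(** Nonemptiness matters: on an empty board the quantifier is vacuously true, whereas an exhausted
    game is a draw and no win of Left. *)
Lemma play_right U TB TR : U != set0 ->
  play U TB TR false =
  [forall v in U, (v \notin TR) && play (U :\ v) (TB :\ v) ((TR :|: nbr ER U v) :\ v) true].
Proof.
case k: #|U| => [|k'] /=; first by move/eqP: k; rewrite cards_eq0 => ->.
move=> _; apply: eq_forallb => v; case vU: (v \in U) => //=.
by have := cardsD1 v U; rewrite vU k add1n => -[->].
Qed.

Lemma play_right0 TB TR : play (set0 : {set 'I_n}) TB TR false = false.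
Proof. by rewrite cards0. Qed.

Lemma play_left_threat U TB TR v : v \in U -> v \in TB -> play U TB TR true.
Proof. by move=> vU vT; rewrite play_left; apply/exists_inP; exists v; rewrite ?vT. Qed.

Lemma play_right_threat U TB TR v : v \in U -> v \in TR -> play U TB TR false = false.
Proof.
move=> vU vT; have U0 : U != set0 by apply/set0Pn; exists v.
by rewrite play_right //; apply/negbTE/forall_inPn; exists v; rewrite ?vT.
Qed.

(** Right has nothing to complete and can block only one of two blue threats. Red threats created by
    that pick come too late. *)
Lemma play_right_two_threats U TB TR :
  TB \subset U -> 1 < #|TB| -> TR = set0 -> play U TB TR false.
Proof.
move=> sU /card_gt1P[x [y [xT yT xy]]] ->.
have xU := subsetP sU x xT; have yU := subsetP sU y yT.
rewrite play_right; last by apply/set0Pn; exists x.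
apply/forall_inP=> v vU; rewrite inE /=.
have [->|vx] := eqVneq v x.
  by apply: (@play_left_threat _ _ _ y); rewrite !inE eq_sym xy.
by apply: (@play_left_threat _ _ _ x); rewrite !inE eq_sym vx.
Qed.

(** Any pick other than [x] lets Left win at [x], so only one branch of the quantifier over Right's
    picks matters. *)
Lemma play_right_forced U TR x :
  x \in U -> TR = set0 ->
  play U [set x] TR false = play (U :\ x) set0 (nbr ER U x) true.
Proof.
move=> xU ->; rewrite play_right; last by apply/set0Pn; exists x.
have sx v := nbr_setD1 ER U v.
apply/forall_inP/idP => [/(_ _ xU)|H v vU].
  by rewrite inE set0U sx setDv.
rewrite inE set0U sx /=; have [->|vx] := eqVneq v x; first by rewrite setDv.
by apply: (@play_left_threat _ _ _ x); rewrite !inE eq_sym vx ?eqxx.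
Qed.

Lemma play_left_two_threats U TR :
  TR \subset U -> 1 < #|TR| -> play U set0 TR true = false.
Proof.
move=> sU /card_gt1P[x [y [xT yT xy]]]; apply/negbTE.
rewrite play_left; apply/exists_inPn=> v vU; rewrite inE /=.
have xU := subsetP sU x xT; have yU := subsetP sU y yT.
have [->|vx] := eqVneq v x.
  by rewrite (@play_right_threat _ _ _ y) // !inE eq_sym xy.
by rewrite (@play_right_threat _ _ _ x) // !inE eq_sym vx.
Qed.

Lemma play_left_forced U x :
  x \in U -> play U set0 [set x] true = play (U :\ x) (nbr EL U x) set0 false.
Proof.
move=> xU; rewrite play_left.
have sx v := nbr_setD1 EL U v.
apply/exists_inP/idP => [[v vU]|H].
  rewrite inE set0U sx /=; have [->|vx] := eqVneq v x; first by rewrite setDv.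
  by rewrite (@play_right_threat _ _ _ x) // !inE eq_sym ?vx ?eqxx.
by exists x; rewrite // inE set0U sx setDv.
Qed.

(* Right answers each move of Left by the unique blue neighbour of that move. *)
Lemma play_matching U TR : degree_le1 EL U -> play U set0 TR true = false.
Proof.
move: {2}(#|U|) (leqnn #|U|) => k; elim: k U TR => [|k IH] U TR.
  by rewrite leqn0 => /eqP->.
move=> Uk dU; apply/negbTE; rewrite play_left; apply/exists_inPn=> v vU.
rewrite inE set0U /=; have := cardsD1 v U; rewrite vU add1n => cU.
have sx := nbr_setD1 EL U v.
have step x TR' : x \in U :\ v -> play (U :\ v :\ x) set0 TR' true = false.
  move=> xU; apply: IH; first by apply: leq_trans (subset_leq_card (subD1set _ _)) _; move: Uk;
    rewrite cU.
  by apply: degree_le1S dU; rewrite subDset subsetU // subD1set orbT.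
rewrite sx; have [U0|[x xU]] := set_0Vmem (U :\ v); first by rewrite U0 cards0.
have nU : U :\ v != set0 by apply/set0Pn; exists x.
(* Without a blue neighbour of [v] to answer with, Right takes any vertex [x]: deletions keep the
   blue graph a matching. *)
have [N0|[y Ny]] := cards_le1_cases (forall_inP dU v vU).
  by rewrite N0 play_right //; apply/forall_inPn; exists x; rewrite // set0D step // andbF.
have yU : y \in U :\ v.
  have: y \in nbr EL U v by rewrite Ny inE.
  by rewrite in_nbr !inE => /and3P[-> ->].
by rewrite Ny play_right //; apply/forall_inPn; exists y; rewrite // setDv step // andbF.
Qed.

Lemma nbr_D1 E U v : nbr E (U :\ v) v = nbr E U v.
Proof. by apply/setP=> z; rewrite !in_nbr !inE; case: eqP; rewrite ?andbF. Qed.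

Lemma play_left_quiet U : play U set0 set0 true = ~~ degree_le1 EL U.
Proof.
have [dU|/forall_inPn[v vU]] := boolP (degree_le1 EL U); first by rewrite play_matching.
rewrite -ltnNge => dv; rewrite play_left; apply/exists_inP; exists v => //.
have sx := nbr_setD1 EL U v.
rewrite set0U set0D sx play_right_two_threats ?orbT //.
by rewrite -nbr_D1 nbr_sub.
Qed.

(* The two positions with the vertex set of the game still unpicked: singleton
   edges are the only threats. *)
Definition singletons (E : {set {set 'I_n}}) : {set 'I_n} := [set v | [set v] \in E].

Lemma fills_set0 (E : {set {set 'I_n}}) : small_edges E -> fills set0 E = false.
Proof.
move=> smE; apply/negbTE/exists_inPn=> e eE; have [a [b ->]] := smE e eE.
by rewrite subset0; apply/set0Pn; exists a; rewrite set21.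
Qed.

Lemma threats_set0 (E : {set {set 'I_n}}) :
  small_edges E -> threats E setT set0 = singletons E.
Proof.
move=> smE; apply/setP=> v; rewrite !inE setU0 /=.
apply/exists_inP/idP => [[e eE]|vE]; last by exists [set v].
have [a [b eab]] := smE e eE; rewrite subset1 => /orP[/eqP<-//|/eqP e0].
by have := set21 a b; rewrite -eab e0 inE.
Qed.

Lemma left_wins_play lt : small_edges EL -> small_edges ER ->
  left_wins EL ER lt =
  play ([set: 'I_n]) (singletons EL) (singletons ER) lt.
Proof.
move=> smL smR; rewrite /left_wins left_wins_from_threat_game ?fills_set0 //.
by rewrite setU0 setC0 !threats_set0 // cardsT card_ord.
Qed.

(* From a position without pending threats, with unpicked vertices U and Right
   to move: right_holds U means that Left cannot win, and right_holds_by U w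
   that Left cannot win once Right has picked w. *)
Definition right_holds U := ~~ play U set0 set0 false.
Definition right_holds_by U w := ~~ play (U :\ w) set0 (nbr ER U w) true.

Lemma right_holdsE U : right_holds U = (U == set0) || [exists w in U, right_holds_by U w].
Proof.
rewrite /right_holds; have [->|U0] := eqVneq U set0; first by rewrite play_right0.
rewrite play_right // negb_forall; apply: eq_existsb => w.
rewrite negb_imply; case wU: (w \in U) => //=.
rewrite inE /= set0D set0U /right_holds_by; congr (~~ threat_game _ _ _ _ _).
exact: nbr_setD1.
Qed.

Lemma right_holds_by_two U w : 1 < #|nbr ER U w| -> right_holds_by U w.
Proof. by move=> d; rewrite /right_holds_by play_left_two_threats // -nbr_D1 nbr_sub. Qed.

Lemma right_holds_by_none U w :
  nbr ER U w = set0 -> right_holds_by U w = degree_le1 EL (U :\ w).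
Proof. by move=> d; rewrite /right_holds_by d play_left_quiet negbK. Qed.

(** * Forced exchanges, and why Right may commit to a chain *)

Section ForcedReply.

Variables (U : {set 'I_n}) (w x : 'I_n).
Hypothesis wx : nbr ER U w = [set x].
(** The board after Right's pick [w] and Left's forced reply [x]. The blue neighbours that [x] has
    on it become Left's threats, and their number decides how play goes on. *)
Let V := U :\ w :\ x.

Lemma forced_reply_in : x \in U :\ w.
Proof.
have: x \in nbr ER U w by rewrite wx inE.
by rewrite in_nbr !inE => /and3P[-> ->].
Qed.

Lemma right_holds_by_forced :
  right_holds_by U w = ~~ play V (nbr EL V x) set0 false.
Proof. by rewrite /right_holds_by wx play_left_forced ?forced_reply_in // /V nbr_D1. Qed.

Lemma right_holds_by_double : 1 < #|nbr EL V x| -> right_holds_by U w = false.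
Proof.
by move=> d; rewrite right_holds_by_forced play_right_two_threats // nbr_sub.
Qed.

Lemma right_holds_by_continue y :
  nbr EL V x = [set y] -> right_holds_by U w = right_holds_by V y.
Proof.
move=> d; have yV : y \in V.
  by apply: (subsetP (nbr_sub EL V x)); rewrite d inE.
by rewrite right_holds_by_forced d play_right_forced.
Qed.

Lemma right_holds_by_release :
  nbr EL V x = set0 -> right_holds_by U w = right_holds V.
Proof. by move=> d; rewrite right_holds_by_forced d. Qed.

End ForcedReply.

(* The trace of a sequence of forced exchanges after which nothing is pending:
   Right picks R, each pick forcing Left to take its red mate in L, and no
   vertex of L has a blue neighbour left outside R.  No order is recorded. *)
Record released U R L : Prop := Released {
  released_subR : R \subset U;
  released_subL : L \subset U;
  released_disj : [disjoint R & L];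
  released_R : forall r, r \in R -> exists2 l, l \in L & nbr ER U r = [set l];
  released_L : forall l, l \in L -> exists2 r, r \in R & nbr ER U l = [set r];
  released_blue : forall l, l \in L -> nbr EL U l \subset R }.

Lemma setD2S U a b : U :\ a :\ b \subset U.
Proof. exact: subset_trans (subD1set _ _) (subD1set _ _). Qed.

(** The trace is closed under red mates, so by symmetry of the red graph a vertex outside it has its
    mate outside too. *)
Lemma released_outside U R L w x :
  released U R L -> w \in U -> w \notin R :|: L -> nbr ER U w = [set x] ->
  x \notin R :|: L.
Proof.
move=> rel wU wC wx; apply/negP=> xC.
have wNx : w \in nbr ER U x by apply: nbr_sym => //; rewrite wx inE.
case/negP: wC; move: xC; rewrite !inE => /orP[xR|xL].
  by have [l lL xl] := released_R rel xR; move: wNx; rewrite xl inE => /eqP->; rewrite lL orbT.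
by have [r rR xr] := released_L rel xL; move: wNx; rewrite xr inE => /eqP->; rewrite rR.
Qed.

(** The mates of the trace lie in the trace, hence survive an exchange played outside it, and blue
    neighbourhoods only shrink. *)
Lemma released_drop_outside U R L w x :
  released U R L -> w \notin R :|: L -> x \notin R :|: L ->
  released (U :\ w :\ x) R L.
Proof.
move=> [sR sL dj hR hL hB]; rewrite !inE !negb_or => /andP[wR wL] /andP[xR xL].
have del (A : {set 'I_n}) : A \subset U -> w \notin A -> x \notin A -> A \subset U :\ w :\ x.
  move=> sA wA xA; apply/subsetP=> z zA; rewrite !inE (subsetP sA) // andbT.
  by apply/andP; split; apply: contraTneq zA => ->.
have nb z y : y \in U -> y != w -> y != x -> nbr ER U z = [set y] ->
    nbr ER (U :\ w :\ x) z = [set y].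
  move=> yU yw yx e; rewrite (nbrS _ _ (setD2S U w x)) e; apply/setIidPl.
  by rewrite sub1set !inE yU yw yx.
split => //; try by apply: del.
- move=> r rR; have [l lL e] := hR r rR; exists l => //.
  apply: nb => //; first exact: (subsetP sL).
    by apply: contraTneq lL => ->.
  by apply: contraTneq lL => ->.
- move=> l lL; have [r rR e] := hL l lL; exists r => //.
  apply: nb => //; first exact: (subsetP sR).
    by apply: contraTneq rR => ->.
  by apply: contraTneq rR => ->.
- by move=> l lL; apply: subset_trans (hB l lL); apply/nbrSS/setD2S.
Qed.

(** Red neighbourhoods on the trace are singletons, so [r] and [l] are mates of nobody else and the
    other pairs stay intact. *)
Lemma released_drop_pair U R L r l :
  released U R L -> r \in R -> nbr ER U r = [set l] -> nbr ER U l = [set r] -> l \in L ->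
  released (U :\ r :\ l) (R :\ r) (L :\ l).
Proof.
move=> [sR sL dj hR hL hB] rR rl lr lL.
have rNL : r \notin L by apply/negP=> rL; rewrite (disjointFl dj rL) in rR.
have lNR : l \notin R by apply/negP=> lR; rewrite (disjointFr dj lR) in lL.
have nb z y : y \in U -> y != r -> y != l -> nbr ER U z = [set y] ->
    nbr ER (U :\ r :\ l) z = [set y].
  move=> yU yw yx e; rewrite (nbrS _ _ (setD2S U r l)) e; apply/setIidPl.
  by rewrite sub1set !inE yU yw yx.
split.
- apply/subsetP=> z; rewrite !inE => /andP[-> zR]; rewrite (subsetP sR) //= andbT.
  by apply: contraTneq zR => ->.
- apply/subsetP=> z; rewrite !inE => /andP[-> zL]; rewrite (subsetP sL) //= andbT.
  by apply: contraTneq zL => ->.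
- by apply: disjointWl (subD1set _ _) _; apply: disjointWr (subD1set _ _) _.
- move=> r'; rewrite !inE => /andP[r'r r'R]; have [l' l'L e] := hR r' r'R.
  have r'U := subsetP sR r' r'R.
  have l'l : l' != l.
    apply: contraNneq r'r => l'l; have : r' \in nbr ER U l.
      by apply: nbr_sym => //; rewrite e l'l inE.
    by rewrite lr inE.
  exists l'; first by rewrite !inE l'l.
  apply: nb => //; first exact: (subsetP sL).
  by apply: contraTneq l'L => ->.
- move=> l'; rewrite !inE => /andP[l'l l'L]; have [r' r'R e] := hL l' l'L.
  have l'U := subsetP sL l' l'L.
  have r'r : r' != r.
    apply: contraNneq l'l => r'r; have : l' \in nbr ER U r.
      by apply: nbr_sym => //; rewrite e r'r inE.
    by rewrite rl inE.
  exists r'; first by rewrite !inE r'r.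
  apply: nb => //; first exact: (subsetP sR).
  by apply: contraTneq r'R => ->.
- move=> l'; rewrite !inE => /andP[l'l l'L].
  apply/subsetP=> z zN; have zR := subsetP (hB l' l'L) z (subsetP (nbrSS _ _ (setD2S U r l)) z zN).
  by move: zN; rewrite in_nbr !inE zR => /and3P[/and3P[_ -> _] _ _].
Qed.

Lemma released_swap_pair U R L r l :
  released U R L -> r \in R -> nbr ER U r = [set l] -> nbr ER U l = [set r].
Proof.
move=> rel rR rl; have [l' l'L] := released_R rel rR; rewrite rl => /set1_inj ll'.
rewrite -ll' in l'L; have [r' r'R lr] := released_L rel l'L.
have : r \in nbr ER U l.
  by apply: nbr_sym; rewrite ?rl ?inE // (subsetP (released_subR rel)).
by rewrite lr inE => /eqP->.
Qed.

(* Red degrees being at most 1, released vertices never help Right: a winning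
   line for Right that enters them either dies out inside them or comes out at a
   vertex that Right may pick anyway. *)
Lemma right_holds_released U R L :
  degree_le1 ER U -> released U R L ->
  let D := U :\: (R :|: L) in
  [/\ right_holds U -> right_holds D,
      forall w, w \in D -> right_holds_by U w -> right_holds_by D w
    & forall w, w \in R :|: L -> right_holds_by U w -> right_holds D].
Proof.
(* The three claims need one common induction: a line that starts outside the trace may continue
   inside it, and one that starts inside may come out. *)
move: {2}(#|U|) (leqnn #|U|) => k; elim: k U R L => [|k IH] U R L.
  rewrite leqn0 cards_eq0 => /eqP-> _ rel D.
  have -> : D = set0 by rewrite /D set0D.
  split=> // w; rewrite !inE // => /orP[wR|wL].
    by have := subsetP (released_subR rel) _ wR; rewrite inE.
  by have := subsetP (released_subL rel) _ wL; rewrite inE.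
move=> Uk dU rel D.
have sDU : D \subset U by apply: subsetDl.
have holdsD w : w \in D -> right_holds_by D w -> right_holds D.
  by move=> wD hw; rewrite right_holdsE; apply/orP; right; apply/exists_inP; exists w.
have cV w x : w \in U -> #|U :\ w :\ x| <= k.
  move=> wU; apply: leq_trans (subset_leq_card (subD1set _ _)) _.
  by move: Uk; rewrite (cardsD1 w U) wU.
have dV w x : degree_le1 ER (U :\ w :\ x) by apply: degree_le1S dU; apply: setD2S.
(* Right picks the same [w] on [D]. The red mate of [w], if any, is the same there, and Left has no
   more blue neighbours than on [U]. *)
have part1 w : w \in D -> right_holds_by U w -> right_holds_by D w.
  move=> wD hw; have /setDP[wU wC] := wD.
  have [N0|[x Nx]] := cards_le1_cases (forall_inP dU w wU).
    rewrite right_holds_by_none // in hw; rewrite right_holds_by_none.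
      by apply: degree_le1S hw; apply: setSD.
    by apply/eqP; rewrite -subset0 -N0; apply: nbrSS.
  have xC := released_outside rel wU wC Nx.
  have xUw := forced_reply_in Nx.
  have xU : x \in U by move: xUw; rewrite !inE => /andP[].
  have NDx : nbr ER D w = [set x].
    by rewrite (nbrS _ _ sDU) Nx; apply/setIidPl; rewrite sub1set inE xC xU.
  have relV := released_drop_outside rel wC xC.
  set V := U :\ w :\ x in relV.
  have DV : V :\: (R :|: L) = D :\ w :\ x.
    by apply/setP=> z; rewrite !inE andbCA; congr (_ && _); rewrite andbCA.
  have [H1 H2 H3] := IH V R L (cV _ _ wU) (dV _ _) relV.
  rewrite DV in H1 H2 H3.
  have sDV : D :\ w :\ x \subset V by rewrite -DV subsetDl.
  case: (leqP #|nbr EL V x| 1) => [d|d]; last by rewrite (right_holds_by_double Nx) in hw.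
  have [B0|[y By]] := cards_le1_cases d.
    rewrite (right_holds_by_release NDx); first by apply: H1; rewrite -(right_holds_by_release Nx).
    by apply/eqP; rewrite -subset0 -B0; apply: nbrSS.
  rewrite (right_holds_by_continue Nx By) in hw.
  have yV : y \in V by apply: (subsetP (nbr_sub EL V x)); rewrite By inE.
  (* If Left's single threat [y] lies in the trace, then on [D] the reply [x] threatens nothing and
     Right regains the move. The third claim, applied to the line on [V] that goes on with [y],
     shows that Right holds there. *)
  have [yC|yC] := boolP (y \in R :|: L).
    rewrite (right_holds_by_release NDx); first exact: H3 hw.
    rewrite (nbrS _ _ sDV) By -DV; apply/setP=> z; move: yC; rewrite !inE.
    by case: eqP => //= -> ->.
  have yD : y \in D :\ w :\ x by rewrite -DV inE yC.
  rewrite (right_holds_by_continue NDx (y := y)); first exact: H2.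
  by rewrite (nbrS _ _ sDV) By; apply/setIidPl; rewrite sub1set.
(* Whichever of two mates Right picks, Left must take the other, so the pair leaves the trace and
   [D] is unchanged. Left's next threat, if any, lies in the rest of the trace or in [D]; in the
   latter case Right can pick it on [D] straight away. *)
have part2 w : w \in R :|: L -> right_holds_by U w -> right_holds D.
  move=> wC hw.
  have [r [l [rR lL rl lr wx]]] : exists r l, [/\ r \in R, l \in L,
      nbr ER U r = [set l], nbr ER U l = [set r]
    & (w = r \/ w = l)].
    move: wC; rewrite inE => /orP[wR|wL].
      have [l lL wl] := released_R rel wR.
      exists w, l; split; [| | | |by left] => //.
      exact: released_swap_pair rel wR wl.
    have [r rR wr] := released_L rel wL.
    have [l lL rl] := released_R rel rR.
    have lr := released_swap_pair rel rR rl.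
    suff e : l = w by rewrite -e; exists r, l; split; [| | | |right].
    have : w \in nbr ER U r.
      by apply: nbr_sym; rewrite ?wr ?inE // (subsetP (released_subL rel)).
    by rewrite rl inE => /eqP.
  have relV := released_drop_pair rel rR rl lr lL.
  set V := U :\ r :\ l in relV.
  have rU := subsetP (released_subR rel) r rR.
  have [H1 H2 H3] := IH V (R :\ r) (L :\ l) (cV _ _ rU) (dV _ _) relV.
  have rNL : r \notin L by apply/negP=> rL; rewrite (disjointFl (released_disj rel) rL) in rR.
  have lNR : l \notin R by apply/negP=> lR; rewrite (disjointFr (released_disj rel) lR) in lL.
  have DV : V :\: (R :\ r :|: L :\ l) = D.
    apply/setP=> z; rewrite !inE.
    have [->|zl] := eqVneq z l; first by rewrite lL orbT /= andbF.
    by have [->|zr] := eqVneq z r; rewrite /= ?rR /= ?andbF.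
  rewrite DV in H1 H2 H3.
  have fin x : nbr ER U w = [set x] -> V = U :\ w :\ x ->  right_holds D.
    move=> Nx eV; rewrite eV in H1 H2 H3.
    case: (leqP #|nbr EL (U :\ w :\ x) x| 1) => [d|d]; last by rewrite (right_holds_by_double
      Nx) in hw.
    have [B0|[y By]] := cards_le1_cases d.
      by apply: H1; rewrite -(right_holds_by_release Nx).
    rewrite (right_holds_by_continue Nx By) in hw.
    have [yC|yC] := boolP (y \in R :\ r :|: L :\ l); first exact: H3 yC hw.
    have yD : y \in D.
      rewrite -DV eV !inE -!in_setD1.
      have : y \in nbr EL (U :\ w :\ x) x by rewrite By inE.
      by rewrite in_nbr => /and3P[]; rewrite !inE => -> _ _; move: yC; rewrite !inE => ->.
    exact: holdsD yD (H2 _ yD hw).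
  case: wx => wE; rewrite wE in fin.
    exact: fin rl erefl.
  by apply: (fin r lr); apply/setP=> z; rewrite !inE andbCA.
split=> //; rewrite right_holdsE => /orP[/eqP U0|/exists_inP[w wU hw]].
  by rewrite right_holdsE -subset0 -U0 sDU.
have [wC|wC] := boolP (w \in R :|: L); first exact: part2 wC hw.
have wD : w \in D by rewrite inE wC.
exact: holdsD (part1 _ wD hw).
Qed.

Lemma right_holds_by_sub U w : w \in U -> right_holds_by U w -> right_holds U.
Proof. by move=> wU hw; rewrite right_holdsE; apply/orP; right; apply/exists_inP; exists w. Qed.

(* The same trace while Right is still forced to pick w. *)
Record pending U R L w : Prop := Pending {
  pending_subR : R \subset U;
  pending_subL : L \subset U;
  pending_disj : [disjoint R & L];
  pending_R : forall r, r \in R -> exists2 l, l \in L & nbr ER U r = [set l];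
  pending_L : forall l, l \in L -> exists2 r, r \in R & nbr ER U l = [set r];
  pending_blue : forall l, l \in L -> nbr EL U l \subset w |: R;
  pending_in : w \in U :\: (R :|: L) }.

Lemma pending_start U w : w \in U -> pending U set0 set0 w.
Proof.
move=> wU; split; rewrite ?sub0set ?setU0 ?setD0 //; try by move=> z; rewrite inE.
by rewrite -setI_eq0 setI0.
Qed.

(** * Extending the trace of a chain by one exchange *)

Section Exchange.

Variables (U R L : {set 'I_n}) (w x : 'I_n).
Hypotheses (dU : degree_le1 ER U) (pd : pending U R L w).
Let V := U :\: (R :|: L).
Hypothesis wx : nbr ER V w = [set x].
Let N := nbr EL (V :\ w :\ x) x.

Let xV : x \in V :\ w. Proof. exact: forced_reply_in wx. Qed.

Let nbr_unique v z : v \in U -> z \in nbr ER U v -> nbr ER U v = [set z].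
Proof.
move=> vU zN; have [N0|[y Ny]] := cards_le1_cases (forall_inP dU v vU).
  by rewrite N0 inE in zN.
by move: zN; rewrite Ny inE => /eqP->.
Qed.

Lemma exchange_rest : U :\: ((w |: R) :|: (x |: L)) = V :\ w :\ x.
Proof.
apply/setP=> z; rewrite !inE; case: (z == w); rewrite ?andbF //=.
by case: (z == x); rewrite ?orbT.
Qed.

(** A blue neighbour of [x] cannot lie in [L]: by [pending_blue] the blue neighbours of a vertex of
    [L] lie in [w |: R], which avoids [x]. So outside [w |: R] only [N] is left. *)
Lemma exchange_blue : nbr EL U x \subset (w |: R) :|: N.
Proof.
have /setD1P[xw /setDP[xU]] := xV; rewrite inE negb_or => /andP[xR xL].
apply/subsetP=> z zN; have zU := subsetP (nbr_sub _ _ _) _ zN.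
have zx : z != x by move: zN; rewrite in_nbr => /and3P[].
have xNz : x \in nbr EL U z by apply: nbr_sym.
have zL : z \notin L.
  apply/negP=> zL; have := subsetP (pending_blue pd zL) _ xNz.
  by rewrite !inE (negbTE xw) (negbTE xR).
rewrite in_setU in_setU1; case: (eqVneq z w) => //= zw.
case zR: (z \in R) => //=; rewrite in_nbr zx !inE zx zw zR (negbTE zL) zU /=.
by move: zN; rewrite in_nbr => /and3P[].
Qed.

(** Red degrees on [U] are at most 1, so [w] and [x], found to be mates on the smaller board [V],
    are each other's only red neighbours on all of [U]. *)
Lemma exchange_trace :
  [/\ w |: R \subset U, x |: L \subset U, [disjoint w |: R & x |: L],
      forall r, r \in w |: R -> exists2 l, l \in x |: L & nbr ER U r = [set l]
    & forall l, l \in x |: L -> exists2 r, r \in w |: R & nbr ER U l = [set r]].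
Proof.
have [sR sL dj hR hL hB] := pd; rewrite !inE negb_or => /andP[/andP[wR wL] wU].
have /setD1P[xw /setDP[xU]] := xV; rewrite inE negb_or => /andP[xR xL].
have xNw : x \in nbr ER U w.
  by apply: (subsetP (nbrSS ER w (subsetDl U (R :|: L)))); rewrite wx inE.
have wNx : w \in nbr ER U x by apply: nbr_sym.
split.
- by rewrite subUset sub1set wU.
- by rewrite subUset sub1set xU.
- apply/pred0P=> z; rewrite !inE; case: (eqVneq z w) => [->|zw] /=.
    by rewrite eq_sym (negbTE xw) (negbTE wL).
  case: (eqVneq z x) => [->|zx] /=; first by rewrite (negbTE xR).
  by apply/andP=> -[zR zL]; rewrite (disjointFr dj zR) in zL.
- move=> r /setU1P[->|rR]; first by exists x; [rewrite setU11 | apply: nbr_unique].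
  by have [l lL e] := hR r rR; exists l; rewrite // inE lL orbT.
- move=> l /setU1P[->|lL]; first by exists w; [rewrite setU11 | apply: nbr_unique].
  by have [r rR e] := hL l lL; exists r; rewrite // inE rR orbT.
Qed.

Lemma pending_step y : N = [set y] -> pending U (w |: R) (x |: L) y.
Proof.
move=> Ny; have [sR sL dj hR hL] := exchange_trace; split=> //.
- move=> l /setU1P[->|lL].
    by apply: subset_trans exchange_blue _; rewrite Ny setUC.
  exact: subset_trans (pending_blue pd lL) (subsetUr _ _).
- by rewrite exchange_rest; apply: (subsetP (nbr_sub EL _ x)); rewrite -/N Ny inE.
Qed.

Lemma pending_released : N = set0 -> released U (w |: R) (x |: L).
Proof.
move=> N0; have [sR sL dj hR hL] := exchange_trace; split=> //.
move=> l /setU1P[->|lL]; last exact: (pending_blue pd).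
by apply: subset_trans exchange_blue _; rewrite N0 setU0.
Qed.

End Exchange.

End Game.

(** * A structured language and its compilation to the machine *)

Inductive cmd : Type :=
  | Blk of seq instr
  | Seq of cmd & cmd
  | If of nat & cmd & cmd
  | While of nat & cmd
  | Halt.

Notation "c1 ;; c2" := (Seq c1 c2) (at level 60, right associativity).

Definition straight (i : instr) : bool :=
  match i with Jz _ _ | Jmp _ => false | _ => true end.

Definition effect (i : instr) (m : regs) : regs := (step [:: i] 0 m).2.

Definition run_block (l : seq instr) (m : regs) : regs := foldl (fun m i => effect i m) m l.

(* big_step c m t halted m': the time t is an upper bound on the number of
   machine steps. *)
Inductive big_step : cmd -> regs -> nat -> bool -> regs -> Prop :=
  | BsBlk l m : all straight l -> big_step (Blk l) m (size l) false (run_block l m)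
  | BsSeq c1 c2 m t1 m1 t2 h m2 :
      big_step c1 m t1 false m1 -> big_step c2 m1 t2 h m2 ->
      big_step (c1 ;; c2) m (t1 + t2) h m2
  | BsSeqHalt c1 c2 m t1 m1 :
      big_step c1 m t1 true m1 -> big_step (c1 ;; c2) m t1 true m1
  | BsIfTrue r c1 c2 m t h m' :
      m r != 0 -> big_step c1 m t h m' -> big_step (If r c1 c2) m (t + 2) h m'
  | BsIfFalse r c1 c2 m t h m' :
      m r = 0 -> big_step c2 m t h m' -> big_step (If r c1 c2) m (t + 2) h m'
  | BsWhileEnd r c m : m r = 0 -> big_step (While r c) m 1 false m
  | BsWhile r c m t1 m1 t2 h m2 :
      m r != 0 -> big_step c m t1 false m1 -> big_step (While r c) m1 t2 h m2 ->
      big_step (While r c) m (t1 + t2 + 2) h m2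
  | BsWhileHalt r c m t1 m1 :
      m r != 0 -> big_step c m t1 true m1 -> big_step (While r c) m (t1 + 2) true m1
  | BsHalt m : big_step Halt m 1 true m.

Fixpoint code_size (c : cmd) : nat :=
  match c with
  | Blk l => size l
  | Seq c1 c2 => code_size c1 + code_size c2
  | If _ c1 c2 => (code_size c1 + code_size c2).+2
  | While _ c => (code_size c).+2
  | Halt => 1
  end.

(** Machine jumps are absolute, hence the argument [pc]. Every [Halt] jumps to [stop], which is
    taken past the end of the program, so one jump leaves all enclosing loops. *)
Fixpoint compile (stop : nat) (c : cmd) (pc : nat) : program :=
  match c with
  | Blk l => l
  | Seq c1 c2 => compile stop c1 pc ++ compile stop c2 (pc + code_size c1)
  | If r c1 c2 =>
      let other := pc + (code_size c1).+2 in
      Jz r other :: compile stop c1 pc.+1 ++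
      Jmp (other + code_size c2) :: compile stop c2 other
  | While r c =>
      Jz r (pc + (code_size c).+2) :: compile stop c pc.+1 ++ [:: Jmp pc]
  | Halt => [:: Jmp stop]
  end.

Arguments exec : simpl never.

Lemma size_compile stop c pc : size (compile stop c pc) = code_size c.
Proof.
elim: c pc => //= [c1 IH1 c2 IH2|r c1 IH1 c2 IH2|r c IH] pc.
- by rewrite size_cat IH1 IH2.
- by rewrite size_cat /= IH1 IH2 addnS.
- by rewrite size_cat /= IH addn1.
Qed.

Lemma exec_slack P t1 t2 pc m m' :
  t1 <= t2 -> exec P t1 pc m = Some m' -> exec P t2 pc m = Some m'.
Proof.
elim: t1 t2 pc m => [|t1 IH] [|t2] pc m; rewrite /exec -/exec //; case: ifP => // _ t12.
by case: (step P pc m) => pc1 m1; apply: IH.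
Qed.

Lemma exec_step P t pc m :
  pc < size P -> exec P t.+1 pc m = exec P t (step P pc m).1 (step P pc m).2.
Proof. by move=> lt_pc; rewrite {1}/exec -/exec leqNgt lt_pc /=; case: (step P pc m). Qed.

Lemma exec_at P l1 i l2 pc : P = l1 ++ i :: l2 -> pc = size l1 ->
  forall t m, exec P t.+1 pc m =
    match i with
    | Jz r l => exec P t (if m r == 0 then l else pc.+1) m
    | Jmp l => exec P t l m
    | _ => exec P t pc.+1 (effect i m)
    end.
Proof.
move=> eP epc t m; rewrite exec_step; last first.
  by rewrite eP epc size_cat /= addnS ltnS leq_addr.
by rewrite /step eP epc nth_cat ltnn subnn /=; case: i eP.
Qed.

(** Continuation form: the code is prefixed to any run that starts where it hands over control. In
    this form the induction passes through sequences and loops, and the slack in [t] is absorbed by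
    [exec_slack]. *)
Lemma exec_compile P stop c m t h m' :
  big_step c m t h m' -> size P <= stop ->
  forall l1 l2 pc, P = l1 ++ compile stop c pc ++ l2 -> pc = size l1 ->
  forall t2 m2, exec P t2 (if h then stop else pc + code_size c) m' = Some m2 ->
  exec P (t + t2) pc m = Some m2.
Proof.
move=> bs stopP; elim: {c m t h m'} bs => /=.
- move=> l m + l1 l2 pc; elim: l l1 pc m => [|i l IH] l1 pc m /=.
    by move=> _ _ _ t2 m2; rewrite addn0.
  move=> /andP[si sl] eP epc t2 m2 ex.
  have : exec P (size l + t2) pc.+1 (effect i m) = Some m2.
    apply: (IH (rcons l1 i)) => //.
    - by rewrite eP cat_rcons.
    - by rewrite size_rcons epc.
    - by rewrite addSnnS.
  by rewrite addSn (exec_at eP epc); case: i si {eP ex}.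
- move=> c1 c2 m t1 m1 t2 h m2 _ IH1 _ IH2 l1 l2 pc eP epc t3 m3 ex.
  rewrite -addnA; apply: (IH1 l1 (compile stop c2 (pc + code_size c1) ++ l2)) => //.
    by rewrite eP -!catA.
  apply: (IH2 (l1 ++ compile stop c1 pc) l2) => //.
  - by rewrite eP !catA.
  - by rewrite size_cat size_compile epc.
  - by rewrite -addnA.
- move=> c1 c2 m t1 m1 _ IH1 l1 l2 pc eP epc t3 m3 ex.
  apply: (IH1 l1 (compile stop c2 (pc + code_size c1) ++ l2)) => //.
  by rewrite eP -!catA.
- move=> r c1 c2 m t h m' mr _ IH l1 l2 pc eP epc t2 m2 ex.
  rewrite (_ : t + 2 + t2 = (t + t2.+1).+1); last by lia.
  rewrite (exec_at eP epc) (negbTE mr).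
  set other := pc + (code_size c1).+2 in eP.
  apply: (IH (rcons l1 (Jz r other))
    (Jmp (other + code_size c2) :: compile stop c2 other ++ l2)).
  - by rewrite eP cat_rcons /= -catA.
  - by rewrite size_rcons epc.
  - case: h ex {IH} => ex; first by apply: exec_slack ex.
    have eP' : P = (l1 ++ Jz r other :: compile stop c1 pc.+1) ++
        Jmp (other + code_size c2) :: compile stop c2 other ++ l2.
      by rewrite eP /= -!catA /= -?catA.
    rewrite (exec_at eP'); last by rewrite size_cat /= size_compile epc; lia.
    by rewrite /other -addnA addSn addSn.
- move=> r c1 c2 m t h m' mr _ IH l1 l2 pc eP epc t2 m2 ex.
  rewrite (_ : t + 2 + t2 = (t + t2.+1).+1); last by lia.
  rewrite (exec_at eP epc) mr eqxx.
  set other := pc + (code_size c1).+2 in eP *.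
  apply: (@exec_slack _ (t + t2)); first by lia.
  apply: (IH (l1 ++ Jz r other :: compile stop c1 pc.+1 ++
    [:: Jmp (other + code_size c2)]) l2) => //.
  - by rewrite eP /= -!catA /= -?catA.
  - by rewrite size_cat /= size_cat /= size_compile /other epc; lia.
  - by move: ex; rewrite /other -addnA addSn addSn.
- move=> r c m mr l1 l2 pc eP epc t2 m2 ex.
  by rewrite add1n (exec_at eP epc) mr.
- move=> r c m t1 m1 t2 h m2 mr _ IH1 _ IH2 l1 l2 pc eP epc t3 m3 ex.
  rewrite (_ : t1 + t2 + 2 + t3 = (t1 + (t2 + t3).+1).+1); last by lia.
  rewrite (exec_at eP epc) (negbTE mr).
  set out := pc + (code_size c).+2 in eP.
  apply: (IH1 (rcons l1 (Jz r out)) (Jmp pc :: l2)).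
  - by rewrite eP cat_rcons /= -catA.
  - by rewrite size_rcons epc.
  - have eP' : P = (l1 ++ Jz r out :: compile stop c pc.+1) ++ Jmp pc :: l2.
      by rewrite eP /= -!catA /= -?catA.
    rewrite (exec_at eP'); last by rewrite size_cat /= size_compile epc; lia.
    exact: (IH2 l1 l2).
- move=> r c m t1 m1 mr _ IH l1 l2 pc eP epc t3 m3 ex.
  rewrite (_ : t1 + 2 + t3 = (t1 + t3.+1).+1); last by lia.
  rewrite (exec_at eP epc) (negbTE mr).
  apply: (IH (rcons l1 (Jz r (pc + (code_size c).+2))) (Jmp pc :: l2)).
  - by rewrite eP cat_rcons /= -catA.
  - by rewrite size_rcons epc.
  - exact: exec_slack ex.
- by move=> m l1 l2 pc eP epc t2 m2 ex; rewrite add1n (exec_at eP epc).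
Qed.

Lemma exec_program c m t h m' :
  big_step c m t h m' -> exec (compile (code_size c) c 0) t 0 m = Some m'.
Proof.
move=> bs; set P := compile _ _ _.
have sP : size P = code_size c by apply: size_compile.
(* The continuation takes no step: falling through and halting both lead to the address just past
   the code. *)
rewrite -[t]addn0; apply: (exec_compile bs (stop := code_size c) (P := P) _ (l1 := [::]) (l2 :=
  [::])) => //.
- exact: eq_leq sP.
- by rewrite /= cats0.
- by rewrite add0n if_same /exec sP leqnn.
Qed.

(** * Rules for correctness within a time bound *)

Section Outcome.

Variable F : regs -> Prop.

(* F is the postcondition of the runs that end in Halt. *)
Definition ok c m T (Q : regs -> Prop) : Prop :=
  exists t h m', [/\ big_step c m t h m', t <= T & if h then F m' else Q m'].

Lemma ok_weaken c m T T' (Q Q' : regs -> Prop) :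
  ok c m T Q -> T <= T' -> (forall m', Q m' -> Q' m') -> ok c m T' Q'.
Proof.
move=> [t [h [m' [bs tT q]]]] TT QQ; exists t, h, m'; split=> //.
  exact: leq_trans TT.
by case: h q {bs} => //; apply: QQ.
Qed.

Lemma ok_blk k l m T Q : all straight l -> size l = k -> k <= T -> Q (run_block l m) -> ok (Blk
  l) m T Q.
Proof. by move=> sl <- lT q; exists (size l), false, (run_block l m); split=> //; apply: BsBlk. Qed.

Lemma ok_seq c1 c2 m T T1 T2 Q :
  ok c1 m T1 (fun m1 => ok c2 m1 T2 Q) -> T1 + T2 <= T -> ok (c1 ;; c2) m T Q.
Proof.
move=> [t1 [[] [m1 [bs1 le1 q1]]]] le12.
  exists t1, true, m1; split=> //; first exact: BsSeqHalt.
  by apply: leq_trans le12; apply: leq_trans le1 (leq_addr _ _).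
have [t2 [h [m2 [bs2 le2 q2]]]] := q1.
exists (t1 + t2), h, m2; split=> //; first exact: BsSeq bs1 bs2.
by apply: leq_trans le12; apply: leq_add.
Qed.

Lemma ok_blk_seq k l c m T Q :
  all straight l -> size l = k -> k <= T -> ok c (run_block l m) (T - k) Q -> ok (Blk l ;; c) m T Q.
Proof.
move=> sl <- lT q; apply: (@ok_seq _ _ _ _ (size l) (T - size l)); last by rewrite subnKC.
exact: ok_blk.
Qed.

Lemma ok_if r c1 c2 m T Q :
  (m r != 0 -> ok c1 m (T - 2) Q) -> (m r = 0 -> ok c2 m (T - 2) Q) -> 2 <= T ->
  ok (If r c1 c2) m T Q.
Proof.
move=> H1 H2 T2; case: (eqVneq (m r) 0) => mr.
  have [t [h [m2 [bs le2 q2]]]] := H2 mr.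
  by exists (t + 2), h, m2; split; [apply: BsIfFalse | lia |].
have [t [h [m2 [bs le2 q2]]]] := H1 mr.
by exists (t + 2), h, m2; split; [apply: BsIfTrue | lia |].
Qed.

Lemma ok_halt m T Q : 0 < T -> F m -> ok Halt m T Q.
Proof. by move=> T0 Fm; exists 1, true, m; split=> //; apply: BsHalt. Qed.

Lemma ok_while (I : nat -> regs -> Prop) r c m T (Q : regs -> Prop) :
  (forall B m1, I B m1 -> m1 r != 0 ->
     exists T1 T2, T1 + T2 + 2 <= B /\ ok c m1 T1 (I T2)) ->
  (forall B m1, I B m1 -> m1 r = 0 -> 0 < B /\ Q m1) ->
  I T m -> ok (While r c) m T Q.
Proof.
move=> step stop; elim/ltn_ind: T m => T IH m Im.
case: (eqVneq (m r) 0) => mr.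
  by have [T0 q] := stop _ _ Im mr; exists 1, false, m; split=> //; apply: BsWhileEnd.
have [T1 [T2 [le12 [t1 [h1 [m1 [bs1 le1 q1]]]]]]] := step _ _ Im mr.
case: h1 bs1 q1 => bs1 q1.
  by exists (t1 + 2), true, m1; split=> //; [apply: BsWhileHalt | lia].
have [|t2 [h2 [m2 [bs2 le2 q2]]]] := IH T2 _ m1 q1; first by lia.
exists (t1 + t2 + 2), h2, m2; split=> //; first exact: BsWhile bs1 bs2.
by lia.
Qed.

(** Uniform cost: every turn pays [Tb], plus 2 for the test and the jump back; the final 1 is the
    failing test. *)
Lemma ok_count (I : nat -> regs -> Prop) N Tb r c m T (Q : regs -> Prop) :
  (forall i m1, i <= N -> I i m1 -> (m1 r == 0) = (i == N)) ->
  (forall i m1, i < N -> I i m1 -> ok c m1 Tb (I i.+1)) ->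
  I 0 m -> (forall m1, I N m1 -> Q m1) ->
  N * (Tb + 2) + 1 <= T -> ok (While r c) m T Q.
Proof.
move=> count step I0 stop le_T.
apply: (@ok_weaken _ _ (N * (Tb + 2) + 1) _ Q) => //.
apply: (@ok_while (fun B m1 => exists2 i, i <= N &
   B = (N - i) * (Tb + 2) + 1 /\ I i m1)).
- move=> B m1 [i iN [-> Ii]]; rewrite (count _ _ iN Ii) => iN'.
  have ltiN : i < N by lia.
  exists Tb, ((N - i.+1) * (Tb + 2) + 1); split.
    by rewrite (_ : N - i = (N - i.+1).+1) ?mulSn; lia.
  by apply: ok_weaken (step _ _ ltiN Ii) _ _ => // m2 Im2; exists i.+1.
- move=> B m1 [i iN [-> Ii]] /eqP; rewrite (count _ _ iN Ii) => /eqP iE; split; first by lia.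
  by apply: stop; rewrite -iE.
- by exists 0; rewrite ?subn0.
Qed.

Lemma ok_for (I : nat -> regs -> Prop) N Tb r c m T (Q : regs -> Prop) :
  (forall i m1, i < N -> I i m1 -> m1 r = N - i ->
     ok c m1 Tb (fun m2 => I i.+1 m2 /\ m2 r = N - i.+1)) ->
  I 0 m -> m r = N -> (forall m1, I N m1 -> m1 r = 0 -> Q m1) ->
  N * (Tb + 2) + 1 <= T -> ok (While r c) m T Q.
Proof.
move=> step I0 mr stop le_T.
apply: (@ok_count (fun i m1 => I i m1 /\ m1 r = N - i) N Tb) => //.
- by move=> i m1 iN [_ ->]; lia.
- by move=> i m1 iN [Ii m1r]; apply: step.
- by rewrite subn0.
- by move=> m1 []; rewrite subnn; apply: stop.
Qed.

End Outcome.

(** * Edge lists, neighbour lists and their sizes *)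

Section EdgeLists.

Variable n : nat.
Implicit Types (s : seq ('I_n * 'I_n)) (e : 'I_n * 'I_n) (v z : 'I_n) (U : {set 'I_n}).

Definition edge_sets s := [seq [set p.1; p.2] | p <- s].

Lemma edgesetE s A : (A \in edgeset s) = (A \in edge_sets s).
Proof. by apply/imsetP/mapP => [[e es ->]|[e es ->]]; exists e. Qed.

Lemma edgeset_small s : small_edges (edgeset s).
Proof. by move=> A; rewrite edgesetE => /mapP[e _ ->]; exists e.1, e.2. Qed.

Lemma setU1_eq v z a b : [set a; b] = [set v; z] -> (a = v /\ b = z) \/ (a = z /\ b = v).
Proof.
move=> E; have : b \in [set v; z] by rewrite -E set22.
have : a \in [set v; z] by rewrite -E set21.
have : v \in [set a; b] by rewrite E set21.
have : z \in [set a; b] by rewrite E set22.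
rewrite !inE => /orP[]/eqP e1 /orP[]/eqP e2 /orP[]/eqP e3 /orP[]/eqP e4;
  by [left; split; congruence | right; split; congruence].
Qed.

(** A singleton edge at [v] contributes [v] twice, so list lengths equal neighbour counts only at
    vertices without such an edge. The order of the two parts is the one in which the machine pushes
    them. *)
Definition incident e v : seq 'I_n :=
  (if e.2 == v then [:: e.1] else [::]) ++ (if e.1 == v then [:: e.2] else [::]).

(* The list built by scanning s from left to right and pushing new neighbours
   at the front. *)
Definition adjacents s v := flatten [seq incident e v | e <- rev s].

Lemma adjacents_rcons s e v : adjacents (rcons s e) v = incident e v ++ adjacents s v.
Proof. by rewrite /adjacents rev_rcons. Qed.

Lemma mem_incident e v z : (z \in incident e v) = ([set e.1; e.2] == [set v; z]).
Proof.
rewrite /incident mem_cat; apply/idP/eqP => [|/setU1_eq[[-> ->]|[-> ->]]].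
- case/orP; case: ifP => // /eqP<-; rewrite inE => /eqP-> //.
  by rewrite setUC.
- by rewrite eqxx inE eqxx orbT.
- by rewrite eqxx inE eqxx.
Qed.

Lemma mem_adjacents s v z : (z \in adjacents s v) = ([set v; z] \in edgeset s).
Proof.
rewrite edgesetE; elim/last_ind: s => [|s e IH] //.
rewrite adjacents_rcons mem_cat IH mem_incident /edge_sets map_rcons mem_rcons inE.
by rewrite eq_sym.
Qed.

Lemma uniq_adjacents s v : uniq (edge_sets s) -> [set v] \notin edgeset s -> uniq (adjacents s v).
Proof.
elim/last_ind: s => [|s e IH] //.
rewrite edgesetE {1 2}/edge_sets map_rcons rcons_uniq mem_rcons inE negb_or.
move=> /andP[eNs us] /andP[vNe vNs]; rewrite adjacents_rcons cat_uniq.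
rewrite IH ?edgesetE // andbT; apply/andP; split.
  rewrite /incident; do 2 case: eqP => //=.
  by move=> e1 e2; case/eqP: vNe; rewrite e1 e2 setUid.
apply/hasPn=> z; rewrite mem_adjacents edgesetE /= mem_incident => zs.
by apply: contraNneq eNs => ->.
Qed.

Definition alive_adjacents s U v := [seq z <- adjacents s v | z \in U].

Lemma mem_alive_adjacents s U v : [set v] \notin edgeset s ->
  alive_adjacents s U v =i nbr (edgeset s) U v.
Proof.
move=> sv z; rewrite mem_filter mem_adjacents in_nbr; case: (eqVneq z v) => // ->.
by rewrite setUid (negbTE sv) !andbF.
Qed.

Lemma uniq_alive_adjacents s U v : uniq (edge_sets s) -> [set v] \notin edgeset s ->
  uniq (alive_adjacents s U v).
Proof. by move=> us sv; rewrite filter_uniq ?uniq_adjacents. Qed.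

Lemma size_alive_adjacents s U v : uniq (edge_sets s) -> [set v] \notin edgeset s ->
  size (alive_adjacents s U v) = #|nbr (edgeset s) U v|.
Proof.
move=> us sv; rewrite -(card_uniqP (uniq_alive_adjacents U us sv)).
by apply: eq_card; apply: mem_alive_adjacents.
Qed.

(** Walking through this list and looking for a vertex seen before is how the machine tests for a
    matching; see [uniq_alive_ends]. *)
Definition alive_ends U s : seq 'I_n :=
  flatten [seq if (e.1 \in U) && (e.2 \in U) then [:: e.1; e.2] else [::] | e <- s].

Lemma alive_ends_rcons U s e :
  alive_ends U (rcons s e) =
  alive_ends U s ++ (if (e.1 \in U) && (e.2 \in U) then [:: e.1; e.2] else [::]).
Proof. by rewrite /alive_ends map_rcons flatten_rcons. Qed.

Lemma count_alive_ends U s v :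
  count_mem v (alive_ends U s) = if v \in U then size (alive_adjacents s U v) else 0.
Proof.
elim/last_ind: s => [|s e IH]; first by rewrite if_same.
rewrite alive_ends_rcons count_cat {}IH /alive_adjacents adjacents_rcons filter_cat size_cat.
rewrite addnC /incident.
case: (boolP (v \in U)) => vU.
  congr addn; case: (eqVneq e.1 v) => [->|e1]; case: (eqVneq e.2 v) => [->|e2] //=;
  rewrite ?vU ?eqxx //=; repeat case: ifP => //=; rewrite ?(negbTE e1) ?(negbTE e2) ?eqxx //;
  by rewrite ?andbF ?andbT => ->.
case: ifP => // /andP[e1 e2] /=.
by rewrite (negbTE (memPn vU _ e1)) (negbTE (memPn vU _ e2)).
Qed.

Definition no_loop s U := forall v, v \in U -> [set v] \notin edgeset s.

Lemma no_loopS s U U' : U' \subset U -> no_loop s U -> no_loop s U'.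
Proof. by move/subsetP=> sU nl v /sU; apply: nl. Qed.

Lemma uniq_alive_ends U s : uniq (edge_sets s) -> no_loop s U ->
  uniq (alive_ends U s) = degree_le1 (edgeset s) U.
Proof.
move=> us nl; have cnt v : v \in U ->
    count_mem v (alive_ends U s) = #|nbr (edgeset s) U v|.
  by move=> vU; rewrite count_alive_ends vU size_alive_adjacents //; apply: nl.
apply/idP/forall_inP => [ul v vU|dU].
  by rewrite -cnt // count_uniq_mem // leq_b1.
apply: count_mem_uniq => v; case: (boolP (v \in alive_ends U s)) => [vl|/count_memPn-> //].
have vU : v \in U.
  apply: contraLR vl => vU; rewrite -has_pred1 has_count count_alive_ends.
  by rewrite (negbTE vU).
apply/eqP; rewrite eqn_leq cnt // dU //= -cnt //.
by rewrite -has_count has_pred1.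
Qed.

Lemma size_adjacents s v : size (adjacents s v) <= 2 * size s.
Proof.
elim/last_ind: s => [|s e IH] //; rewrite adjacents_rcons size_cat size_rcons.
rewrite mulnS leq_add //; rewrite /incident; do 2 case: ifP => //.
Qed.

(** Handshake count. It bounds the total cost of scanning the blue lists of distinct vertices by
    O(|E_L|). *)
Lemma sum_size_adjacents s : \sum_v size (adjacents s v) = 2 * size s.
Proof.
elim/last_ind: s => [|s e IH]; first by rewrite big1.
under eq_bigr do rewrite adjacents_rcons size_cat.
rewrite big_split /= IH size_rcons mulnS; congr addn.
under eq_bigr do rewrite /incident size_cat.
rewrite big_split /=.
have one a (f : 'I_n -> 'I_n) : \sum_i size (if a == i then [:: f i] else [::]) = 1.
  by rewrite (bigD1 a) //= eqxx big1 // => i; rewrite eq_sym => /negbTE->.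
by rewrite (one _ (fun=> e.1)) (one _ (fun=> e.2)).
Qed.

(** Distinct edges come from distinct ordered pairs. Needed for the red edges, to absorb the product
    |E_L| |E_R| into n^2 |E_L|. *)
Lemma size_edges_le s : uniq (edge_sets s) -> size s <= n ^ 2.
Proof.
move=> us; have /card_uniqP <- : uniq s by apply: map_uniq us.
by rewrite (leq_trans (max_card _)) // card_prod card_ord -mulnn.
Qed.

End EdgeLists.

(** * Addresses, field access and symbolic execution *)

Arguments upd : simpl never.
Arguments fills : simpl never.

(* Memory layout.  Addresses below 30 serve as plain registers; then come the
   vertex records, the two edge lists, and the cells of the blue adjacency lists.
   Field f < 6 of the record of vertex v, a vertex being represented everywhere by
   the address of its field 0:
     0 alive (unpicked), 1 stamp, 2 and 3 two red neighbours (0 if absent),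
     4 list of blue neighbours, 5 next vertex on the undo trail.
   Registers that survive procedure calls:
     0 null (always 0, so that the null pointer reads as a dead vertex) and, at
     the end, the answer; 12 loop flag of a chain; 13 vertex Right picks;
     15 outcome of a chain (1 if Right regains a free move); 16 undo trail;
     18 and 19 flags of a pass (something committed, some vertex alive);
     22 allocation pointer; 24 and 25 numbers of edges; 26 and 27 start of the
     edge lists; 28 the number of vertices; 29 the constant 30. *)
Definition field (v f : nat) : nat := f + (30 + 6 * v).
Arguments field : simpl never.
Notation vptr v := (field v 0).

Lemma upd_eq m i r v : i = r -> upd m r v i = v.
Proof. by move=> ->; rewrite /upd eqxx. Qed.

Lemma upd_ne m r v i : (i == r) = false -> upd m r v i = m i.
Proof. by rewrite /upd => ->. Qed.

Lemma field_ne_reg v f r : r < 30 -> (field v f == r) = false.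
Proof. by rewrite /field; lia. Qed.

Lemma reg_ne_field v f r : r < 30 -> (r == field v f) = false.
Proof. by rewrite /field; lia. Qed.

Lemma field_eq v f u g : f < 6 -> g < 6 -> (field v f == field u g) = (v == u) && (f == g).
Proof. by rewrite /field; lia. Qed.

Lemma field_ne_f v f u g : f < 6 -> g < 6 -> (f == g) = false -> (field v f == field u g) = false.
Proof. by move=> f6 g6 fg; rewrite field_eq // fg andbF. Qed.

Lemma field_ne_ord k (u v : 'I_k) f g : f < 6 -> g < 6 -> (u == v) = false ->
  (field u f == field v g) = false.
Proof. by move=> f6 g6 uv; rewrite field_eq // val_eqE uv. Qed.

Lemma field_ne_ord' k (u v : 'I_k) f g : f < 6 -> g < 6 -> (v == u) = false ->
  (field u f == field v g) = false.
Proof. by move=> f6 g6 uv; apply: field_ne_ord => //; rewrite eq_sym. Qed.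

Lemma upd_upd m r x y : upd (upd m r x) r y = upd m r y.
Proof. by apply: functional_extensionality => i; rewrite /upd; case: eqP. Qed.

Definition incs r k := nseq k (Inc r).

Lemma run_block_cat l1 l2 m : run_block (l1 ++ l2) m = run_block l2 (run_block l1 m).
Proof. exact: foldl_cat. Qed.

Lemma run_block_cons i l m : run_block (i :: l) m = run_block l (effect i m).
Proof. by []. Qed.

Lemma run_incs r k m : run_block (incs r k) m = upd m r (m r + k).
Proof.
elim: k m => [|k IH] m.
  by rewrite addn0; apply: functional_extensionality => i; rewrite /upd; case: eqP => // ->.
by rewrite [incs r _]/= run_block_cons IH /effect /= upd_upd upd_eq // addSnnS.
Qed.

(** Register 1 is the scratch pointer of every field access, which is why it occurs in nearly all
    frames. *)
Definition get d x f := Mov 1 x :: incs 1 f ++ [:: LoadI d 1].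
Definition put x f s := Mov 1 x :: incs 1 f ++ [:: StoreI 1 s].

Arguments get : simpl never.
Arguments put : simpl never.

Lemma run_get d x f m v : m x = vptr v ->
  run_block (get d x f) m = upd (upd m 1 (field v f)) d (m (field v f)).
Proof.
move=> mx; rewrite /get run_block_cons run_block_cat run_incs /effect /= upd_upd upd_eq // mx.
rewrite (_ : vptr v + f = field v f); last by rewrite /field; lia.
by rewrite /effect /= [upd m _ _ 1]upd_eq // [upd m 1 _ (field v f)]upd_ne // field_ne_reg.
Qed.

Lemma run_put x f s m v : s != 1 -> m x = vptr v ->
  run_block (put x f s) m = upd (upd m 1 (field v f)) (field v f) (m s).
Proof.
move=> s1 mx; rewrite /put run_block_cons run_block_cat run_incs /effect /= upd_upd upd_eq // mx.
rewrite (_ : vptr v + f = field v f); last by rewrite /field; lia.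
by rewrite /effect /= [upd m _ _ 1]upd_eq // [upd m 1 _ s]upd_ne // (negbTE s1).
Qed.

Arguments run_block : simpl never.
Arguments effect : simpl never.

Lemma effectE m :
  ((forall r, effect (Inc r) m = upd m r (m r).+1) *
   (forall r, effect (Dec r) m = upd m r (m r).-1) *
   (forall r, effect (Clr r) m = upd m r 0) *
   (forall r s, effect (Mov r s) m = upd m r (m s)) *
   (forall r s, effect (LoadI r s) m = upd m r (m (m s))) *
   (forall r s, effect (StoreI r s) m = upd m (m r) (m s)))%type.
Proof. by []. Qed.

Lemma run_block_nil m : run_block [::] m = m. Proof. by []. Qed.

Lemma run_get_cat d x f l m v : m x = vptr v ->
  run_block (get d x f ++ l) m = run_block l (upd (upd m 1 (field v f)) d (m (field v f))).
Proof. by move=> mx; rewrite run_block_cat (run_get _ _ mx). Qed.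

Lemma run_put_cat x f s l m v : (s == 1) = false -> m x = vptr v ->
  run_block (put x f s ++ l) m = run_block l (upd (upd m 1 (field v f)) (field v f) (m s)).
Proof. by move=> /negbT s1 mx; rewrite run_block_cat (run_put _ s1 mx). Qed.

Ltac addr_ne :=
  first [ reflexivity
        | assumption
        | apply: field_ne_reg; first [reflexivity | assumption]
        | apply: reg_ne_field; first [reflexivity | assumption]
        | apply: field_ne_f; reflexivity
        | apply: field_ne_ord; [reflexivity | reflexivity | assumption]
        | apply: field_ne_ord'; [reflexivity | reflexivity | assumption]
        | (unfold field in *; lia) ].

(** A read through a stack of updates is resolved one update at a time: either the addresses agree
    by computation or [addr_ne] shows that they differ. *)
Ltac mem_read :=
  match goal with
  | |- context [upd ?m ?r ?v ?i] =>
     first [ rewrite (@upd_eq m i r v); [|reflexivity]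
           | rewrite (@upd_ne m r v i); [|addr_ne] ]
  end.

Ltac mem_reads := repeat mem_read.

Ltac run_tac :=
  repeat (match goal with
          | |- context [run_block (?i :: ?l) ?m] => rewrite (run_block_cons i l m) effectE
          | |- context [run_block [::] ?m] => rewrite (run_block_nil m)
          end; mem_reads).

Ltac run_get v := rewrite (@run_get_cat _ _ _ _ _ v); [|by mem_reads]; mem_reads.

Ltac run_put v := rewrite (@run_put_cat _ _ _ _ _ v); [|reflexivity|by mem_reads]; mem_reads.

(** * What a procedure may change *)

Section Frames.

Variable n : nat.

(** Fields are tracked by kind, uniformly over all vertices. Beyond the records lie the edge and
    adjacency lists, which never change after initialization. *)
Definition frame (l fs : seq nat) (m m' : regs) : Prop :=
  [/\ forall r, r < 30 -> r \notin l -> m' r = m r,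
      forall v f, v < n -> f < 6 -> f \notin fs -> m' (field v f) = m (field v f)
    & forall i, 30 + 6 * n <= i -> m' i = m i].

Lemma frame_refl l fs m : frame l fs m m. Proof. by []. Qed.

Lemma frame_trans l fs m1 m2 m3 : frame l fs m1 m2 -> frame l fs m2 m3 -> frame l fs m1 m3.
Proof.
move=> [A1 B1 C1] [A2 B2 C2]; split=> *; first by rewrite A2 ?A1.
  by rewrite B2 ?B1.
by rewrite C2 ?C1.
Qed.

Lemma frame_sub l1 l2 fs1 fs2 m m' :
  all (mem l2) l1 -> all (mem fs2) fs1 -> frame l1 fs1 m m' -> frame l2 fs2 m m'.
Proof.
move=> /allP s1 /allP s2 [A B C]; split=> //.
  by move=> r r30 rl; apply: A => //; apply: contra rl; apply: s1.
by move=> v f vn f6 fl; apply: B => //; apply: contra fl; apply: s2.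
Qed.

Lemma frame_upd_reg l fs m m' r x : r < 30 -> r \in l ->
  frame l fs m m' -> frame l fs m (upd m' r x).
Proof.
move=> r30 rl [A B C]; split.
- move=> i i30 il; rewrite upd_ne ?A //.
  by apply/negbTE; apply: contraNneq il => ->.
- by move=> v f vn f6 fl; rewrite upd_ne ?B // field_ne_reg.
- by move=> i hi; rewrite upd_ne ?C //; lia.
Qed.

Lemma frame_upd_field l fs m m' v f x : v < n -> f < 6 -> f \in fs ->
  frame l fs m m' -> frame l fs m (upd m' (field v f) x).
Proof.
move=> vn f6 fl [A B C]; split.
- by move=> i i30 il; rewrite upd_ne ?A // reg_ne_field.
- move=> u g un g6 gl; rewrite upd_ne ?B // field_eq //.
  by apply/negbTE; apply: contraNN gl => /andP[_ /eqP->].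
- by move=> i hi; rewrite upd_ne ?C // /field; lia.
Qed.

End Frames.

Ltac frame_tac :=
  repeat first [ apply: frame_refl
               | apply: frame_upd_reg; [reflexivity | reflexivity |]
               | apply: frame_upd_field; [by rewrite ?ltn_ord | reflexivity | reflexivity |] ].

(** * Lists in memory and the scan of a blue neighbourhood *)

Section Scanning.

Variables (n : nat) (eL eR : seq ('I_n * 'I_n)).
Implicit Types (s : seq ('I_n * 'I_n)) (U : {set 'I_n}) (v w x y : 'I_n) (m : regs).

Local Notation top := (30 + 6 * n).
Local Notation eL0 := (top + 4).
Local Notation eR0 := (top + 4 + 2 * size eL).

Definition edges_at m p s := forall i e, i < size s ->
  m (p + 2 * i) = vptr (nth e s i).1 /\ m (p + 2 * i).+1 = vptr (nth e s i).2.

(** The bound [top <= p] tells a cell from the null pointer and keeps the list in the region that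
    every [frame] preserves. *)
Fixpoint list_at m p (l : seq 'I_n) : Prop :=
  match l with
  | [::] => p = 0
  | x :: l' => [/\ top <= p, m p = vptr x & list_at m (m p.+1) l']
  end.

Definition statics m : Prop :=
  [/\ m 24 = size eL, m 25 = size eR, m 26 = eL0, m 27 = eR0 & m 28 = n] /\ m 29 = 30 /\
  [/\ edges_at m eL0 eL, edges_at m eR0 eR
    & forall v, list_at m (m (field v 4)) (adjacents eL v)].

Lemma list_at_frame l fs m m' p k : frame n l fs m m' -> list_at m p k -> list_at m' p k.
Proof.
move=> [_ _ C]; elim: k p => //= x k IH p [hp mp lk].
by rewrite !C //; [split=> //; apply: IH | lia].
Qed.

Lemma edges_at_frame l fs m m' p s : top <= p -> frame n l fs m m' -> edges_at m p s -> edges_at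
  m' p s.
Proof. by move=> hp [_ _ C] es i e si; rewrite !C; try lia; apply: es. Qed.

(** Registers from 24 on and field 4 hold the data described by [statics]. *)
Definition dynamic (l fs : seq nat) := all (gtn 24) l && (4 \notin fs).

Lemma statics_frame l fs m m' : dynamic l fs -> frame n l fs m m' -> statics m -> statics m'.
Proof.
move=> /andP[/allP dl dfs] fr [[s1 s2 s3 s4 s5] [s6 [s7 s8 s9]]].
have [A B C] := fr.
have nl r : 24 <= r -> r \notin l by move=> hr; apply/negP=> /dl /=; lia.
split; first by split; rewrite A // nl.
split; first by rewrite A // nl.
split; [apply: edges_at_frame fr _ => //; lia|apply: edges_at_frame fr _ => //; lia|].
by move=> v; rewrite B // ?ltn_ord //; apply: list_at_frame fr _.
Qed.

Definition alive m U := forall v, m (field v 0) = (v \in U).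

Lemma alive_frame l fs m m' U : 0 \notin fs -> frame n l fs m m' -> alive m U -> alive m' U.
Proof. by move=> fs0 [_ B _] al v; rewrite B ?al. Qed.

Lemma regs_frame l fs m m' r : frame n l fs m m' -> r < 30 -> r \notin l -> m' r = m r.
Proof. by move=> [A _ _] r30 rl; apply: A. Qed.

Lemma field_frame l fs m m' v f : frame n l fs m m' -> f < 6 -> f \notin fs ->
  m' (field v f) = m (field v f).
Proof. by move=> [_ B _] f6 fl; apply: B. Qed.

(** Registers 10 and 11 keep the last two alive neighbours met, enough to distinguish none, one and
    several. *)
Definition scan r : cmd :=
  Blk (get 9 r 4 ++ [:: Clr 10; Clr 11]);;
  While 9 (Blk [:: LoadI 6 9; Inc 9; LoadI 9 9; LoadI 7 6];;
           If 7 (Blk [:: Mov 11 10; Mov 10 6]) (Blk [::])).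

Lemma scan_ok F r m U v :
  statics m -> alive m U -> m r = vptr v ->
  ok F (scan r) m (10 * size (adjacents eL v) + 10) (fun m' =>
    frame n [:: 1; 6; 7; 9; 10; 11] [::] m m' /\
    let l := rev (alive_adjacents eL U v) in
    m' 10 = nth 0 [seq vptr z | z : 'I_n <- l] 0 /\
    m' 11 = nth 0 [seq vptr z | z : 'I_n <- l] 1).
Proof.
move=> st al mr; apply: (@ok_blk_seq _ 8) => //; first by lia.
run_get v; run_tac.
set m0 := upd _ 11 0.
have fr0 : frame n [:: 1; 6; 7; 9; 10; 11] [::] m m0 by rewrite /m0; frame_tac.
apply: (@ok_weaken _ _ _ (10 * size (adjacents eL v) + 1)); [|lia|by move=> m' H; exact: H].
(* Ten steps per cell: 4 to load it, at most 4 for the test with the shift, and 2 for the loop. *)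
apply: (@ok_while _ (fun B m1 => exists k1 k2 : seq 'I_n, [/\ B = 10 * size k2 + 1,
   adjacents eL v = k1 ++ k2, frame n [:: 1; 6; 7; 9; 10; 11] [::] m m1,
   list_at m1 (m1 9) k2 &
    let l := rev [seq z <- k1 | z \in U] in
    m1 10 = nth 0 [seq vptr z | z : 'I_n <- l] 0 /\
    m1 11 = nth 0 [seq vptr z | z : 'I_n <- l] 1])).
- move=> B m1 [k1 [[|z k2] [-> adj fr la [m10 m11]]]] m9; first by rewrite /= in la; rewrite la
    in m9.
  have [hp mp la'] := la.
  exists 8, (10 * size k2 + 1); split; first by rewrite /=; lia.
  apply: (@ok_blk_seq _ 4) => //; run_tac.
  have al1 : alive m1 U by apply: alive_frame fr al.
  rewrite mp al1.
  set m2 := upd _ 7 _.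
  have fr2 : frame n [:: 1; 6; 7; 9; 10; 11] [::] m m2 by rewrite /m2; frame_tac.
  have lk2 : list_at m2 (m2 9) k2.
    apply: (@list_at_frame [:: 6; 7; 9] [::] m1); first by rewrite /m2; frame_tac.
    by rewrite /m2; mem_reads.
  have zU : (m2 7 != 0) = (z \in U) by rewrite /m2; mem_reads; case: (z \in U).
  apply: ok_if => // m27; [apply: (@ok_blk _ 2) | apply: (@ok_blk _ 0)] => //.
  - exists (rcons k1 z), k2; rewrite cat_rcons; split=> //.
    + by run_tac; frame_tac.
    + apply: (@list_at_frame [:: 10; 11] [::] m2); first by run_tac; frame_tac.
      by run_tac; mem_reads.
    + rewrite filter_rcons -zU m27 rev_rcons; run_tac; mem_reads.
      by rewrite /m2; mem_reads.
  - exists (rcons k1 z), k2; rewrite cat_rcons; split=> //.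
    rewrite filter_rcons -zU m27 /=.
    by rewrite /m2; run_tac; mem_reads.
- move=> B m1 [k1 [k2 [-> adj fr la [m10 m11]]]] m9; rewrite addn1; split=> //; split=> //.
  case: k2 adj la => [|z k2] adj /=; last by case=> hp; rewrite m9 in hp.
  by rewrite /alive_adjacents adj cats0.
- exists [::], (adjacents eL v); split=> //.
  + apply: (@list_at_frame [:: 1; 9; 10; 11] [::] m); first by rewrite /m0; frame_tac.
    rewrite /m0; mem_reads; by case: st => _ [_ [_ _ h]].
Qed.
End Scanning.

(** * Loops over edges and vertices, and the matching test *)

Section Loops.

Variables (n : nat) (eL eR : seq ('I_n * 'I_n)).
Implicit Types (s : seq ('I_n * 'I_n)) (U : {set 'I_n}) (v w x y : 'I_n) (m : regs).

Local Notation top := (30 + 6 * n).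
Local Notation eL0 := (top + 4).
Local Notation eR0 := (top + 4 + 2 * size eL).
Local Notation statics := (statics eL eR).

(** Makes the stamps of field 1 usable as scratch space: once they are wiped, callers need not know
    that they were touched. *)
Lemma frame_restore l f fs m m' : frame n l (f :: fs) m m' ->
  (forall v : 'I_n, m' (field v f) = m (field v f)) -> frame n l fs m m'.
Proof.
move=> [A B C] R; split=> // v g vn g6 gfs.
have [->|gf] := eqVneq g f; first exact: (R (Ordinal vn)).
by apply: B; rewrite // inE negb_or gf.
Qed.

Fixpoint trail m p (l : seq 'I_n) : Prop :=
  match l with
  | [::] => p = 0
  | v :: l' => p = vptr v /\ trail m (m (field v 5)) l'
  end.

Lemma trail_ext m m' p l : (forall v, v \in l -> m' (field v 5) = m (field v 5)) ->
  trail m p l -> trail m' p l.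
Proof.
elim: l p => //= v l IH p ext [-> tl]; split=> //; rewrite ext ?mem_head //.
by apply: IH tl => u ul; rewrite ext // inE ul orbT.
Qed.

Definition kill r := [:: Clr 7, StoreI r 7 & put r 5 16 ++ [:: Mov 16 r]].

(** The link of the trail is stored in the record of [v], so [v] must not be on the trail yet, or
    its old link would be lost. *)
Lemma run_kill r m v : r < 30 -> r \notin [:: 1; 7; 16] -> m r = vptr v ->
  let m' := run_block (kill r) m in
  [/\ frame n [:: 1; 7; 16] [:: 0; 5] m m',
      forall U, alive m U -> alive m' (U :\ v)
    & forall l, v \notin l -> trail m (m 16) l -> trail m' (m' 16) (v :: l)].
Proof.
rewrite !inE !negb_or => r30 /and3P[/negbTE r1 /negbTE r7 /negbTE r16] mr.
rewrite /kill; run_tac; rewrite mr; run_put v; run_tac; rewrite mr.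
split; first by frame_tac.
- move=> U al u; have [->|/negbTE uv] := eqVneq u v; first by mem_reads; rewrite !inE eqxx.
  by mem_reads; rewrite !inE uv -al.
- move=> l vl tl; split; mem_reads => //.
  apply: trail_ext tl => u ul.
  have uv : (u == v) = false by apply: contraNF vl => /eqP <-.
  by mem_reads.
Qed.


(** Register 3 counts down, 4 is the cursor, and the body finds the two ends in 5 and 6. The pair
    [cr], [pr] is 24, 26 for the blue list and 25, 27 for the red one. *)
Definition edge_loop cr pr body : cmd :=
  Blk [:: Mov 3 cr; Mov 4 pr] ;;
  While 3 (Blk [:: Dec 3; LoadI 5 4; Inc 4; LoadI 6 4; Inc 4] ;; body).

Lemma edge_loop_ok F (I : seq ('I_n * 'I_n) -> regs -> Prop) s p Tb cr pr body m T Q :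
  (forall s1 m1, I s1 m1 -> edges_at m1 p s) ->
  (forall s1 m1 m2, frame n [:: 3; 4; 5; 6] [::] m1 m2 -> I s1 m1 -> I s1 m2) ->
  (forall s1 (e : 'I_n * 'I_n) m1, I s1 m1 -> m1 5 = vptr e.1 -> m1 6 = vptr e.2 ->
     ok F body m1 Tb (fun m2 => [/\ I (rcons s1 e) m2, m2 3 = m1 3 & m2 4 = m1 4])) ->
  m cr = size s -> m pr = p -> (pr == 3) = false -> 30 <= p -> I [::] m ->
  (forall m1, I s m1 -> Q m1) -> size s * (Tb + 7) + 3 <= T ->
  ok F (edge_loop cr pr body) m T Q.
Proof.
move=> edges closed step mcr mpr pr3 p30 I0 stop le_T.
apply: (@ok_blk_seq _ 2) => //; first by lia.
run_tac; rewrite mcr mpr; set m0 := upd _ 4 p.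
have fr0 : frame n [:: 3; 4; 5; 6] [::] m m0 by rewrite /m0; frame_tac.
apply: (@ok_for _ (fun i m1 => I (take i s) m1 /\ m1 4 = p + 2 * i) (size s) (Tb + 5)).
- move=> i m1 lt_i [Ii m4] m3.
  case es: s lt_i => [//|d s'] lt_i; rewrite -{}es in lt_i *.
  have [e1 e2] := edges _ _ Ii i d lt_i.
  apply: (@ok_blk_seq _ 5) => //; first by lia.
  run_tac; rewrite m4; mem_reads; rewrite e1 e2 m3; set m2 := upd _ 4 _.
  have I2 : I (take i s) m2 by apply: closed Ii; rewrite /m2; frame_tac.
  have T5 : Tb <= Tb + 5 - 5 by rewrite addnK.
  apply: ok_weaken T5 _; first apply: (step _ (nth d s i) m2 I2); rewrite /m2; mem_reads => //.
  move=> m4' [I4 -> ->]; mem_reads; split; last by lia.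
  by split; [rewrite (take_nth d) | lia].
- by split; [rewrite take0; apply: closed fr0 I0 | rewrite /m0; mem_reads; lia].
- by rewrite /m0; mem_reads.
- by move=> m1 [I1 _] _; apply: stop; rewrite -[s]take_size.
- by rewrite -addnA; lia.
Qed.

Definition vertex_loop cr pr body : cmd :=
  Blk [:: Mov cr 28; Mov pr 29] ;;
  While cr (Blk [:: Dec cr] ;; body ;; Blk (incs pr 6)).

Lemma vertex_loop_ok F (I : nat -> regs -> Prop) Tb cr pr body m T Q :
  cr < 30 -> pr < 28 -> (pr == cr) = false -> (cr == 29) = false ->
  (forall i m1 m2, frame n [:: cr; pr] [::] m1 m2 -> I i m1 -> I i m2) ->
  (forall (v : 'I_n) m1, I v m1 -> m1 pr = vptr v ->
     ok F body m1 Tb (fun m2 => [/\ I v.+1 m2, m2 cr = m1 cr & m2 pr = m1 pr])) ->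
  m 28 = n -> m 29 = 30 -> I 0 m -> (forall m1, I n m1 -> Q m1) ->
  n * (Tb + 9) + 3 <= T ->
  ok F (vertex_loop cr pr body) m T Q.
Proof.
move=> cr30 pr28 pc c29 closed step m28 m29 I0 stop le_T.
have pr30 : pr < 30 by lia.
have cp : (cr == pr) = false by rewrite eq_sym.
have c29' : (29 == cr) = false by rewrite eq_sym.
apply: (@ok_blk_seq _ 2) => //; first by lia.
run_tac; rewrite m28 m29; set m0 := upd _ pr 30.
have fr0 : frame n [:: cr; pr] [::] m m0.
  by rewrite /m0; do 2 (apply: frame_upd_reg => //; first by rewrite !inE eqxx ?orbT).
apply: (@ok_for _ (fun i m1 => I i m1 /\ m1 pr = vptr i) n (Tb + 7)).
- move=> i m1 lt_i [Ii mp] mc.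
  apply: (@ok_blk_seq _ 1) => //; first by lia.
  run_tac; rewrite mc; set m2 := upd _ cr _.
  have fr2 : frame n [:: cr; pr] [::] m1 m2.
    by rewrite /m2; apply: frame_upd_reg => //; rewrite !inE eqxx.
  apply: (@ok_seq _ _ _ _ _ Tb 6); last by lia.
  apply: ok_weaken (step (Ordinal lt_i) m2 _ _) (leqnn _) _.
  + exact: closed fr2 Ii.
  + by rewrite /m2; mem_reads.
  + move=> m3 [I3 mc3 mp3]; apply: (@ok_blk _ 6) => //.
    rewrite run_incs mp3; set m4 := upd _ pr _.
    have fr4 : frame n [:: cr; pr] [::] m3 m4.
      by rewrite /m4; apply: frame_upd_reg => //; rewrite !inE eqxx orbT.
    split; first split.
    * exact: closed fr4 I3.
    * by rewrite /m4 /m2; mem_reads; rewrite mp /field; lia.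
    * by rewrite /m4; mem_reads; rewrite mc3 /m2; mem_reads; lia.
- by split; [apply: closed fr0 I0 | rewrite /m0; mem_reads].
- by rewrite /m0; mem_reads.
- by move=> m1 [I1 _] _; apply: stop.
- by rewrite (_ : Tb + 7 + 2 = Tb + 9); lia.
Qed.

Definition stamped m (k : seq 'I_n) := forall v, m (field v 1) = (v \in k).

Definition mark r : cmd :=
  Blk (get 7 r 1) ;; If 7 (Blk [:: Clr 17; Inc 17]) (Blk [::]) ;;
  Blk [:: Clr 7, Inc 7 & put r 1 7].

Lemma mark_ok F r m v k : r < 30 -> r \notin [:: 1; 7; 17] -> m r = vptr v ->
  stamped m k -> (m 17 != 0) = ~~ uniq k ->
  ok F (mark r) m 12 (fun m' => [/\ frame n [:: 1; 7; 17] [:: 1] m m',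
    stamped m' (rcons k v) & (m' 17 != 0) = ~~ uniq (rcons k v)]).
Proof.
rewrite !inE !negb_or => r30 /and3P[/negbTE r1 /negbTE r7 /negbTE r17] mr st bad.
apply: (@ok_blk_seq _ 3) => //; rewrite (run_get _ _ mr) st.
set m1 := upd _ 7 _.
have fr1 : frame n [:: 1; 7; 17] [:: 1] m m1 by rewrite /m1; frame_tac.
apply: (@ok_seq _ _ _ _ _ 4 5) => //.
have fin m2 : frame n [:: 1; 7; 17] [::] m m2 -> (m2 17 != 0) = ~~ uniq (rcons k v) ->
    ok F (Blk [:: Clr 7, Inc 7 & put r 1 7]) m2 5 (fun m' => [/\ frame n [:: 1; 7; 17] [:: 1] m m',
    stamped m' (rcons k v) & (m' 17 != 0) = ~~ uniq (rcons k v)]).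
  move=> fr2 bad2; apply: (@ok_blk _ 5) => //; run_tac.
  have mr2 : m2 r = vptr v.
    by have [A _ _] := fr2; rewrite A // !inE r1 r7 r17.
  rewrite (@run_put _ _ _ _ v) //; last by mem_reads.
  mem_reads; split; last by mem_reads.
  - apply: (@frame_trans _ _ _ _ m2); last by frame_tac.
    by apply: frame_sub fr2.
  - move=> u; rewrite mem_rcons inE; have [->|/negbTE uv] := eqVneq u v; mem_reads => //.
    by rewrite (field_frame _ fr2).
have m17 : m1 17 = m 17 by rewrite /m1; mem_reads.
have m17' : m1 7 = (v \in k) by rewrite /m1; mem_reads.
apply: ok_if => // m7; [apply: (@ok_blk _ 2) | apply: (@ok_blk _ 0)] => //; apply: fin.
- by run_tac; rewrite /m1; frame_tac.
- run_tac; rewrite rcons_uniq; rewrite m17' in m7.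
  by case: (v \in k) m7.
- by run_tac; rewrite /m1; frame_tac.
- run_tac; rewrite m17 bad rcons_uniq; rewrite m17' in m7.
  by case: (v \in k) m7.
Qed.

(** The stamps are wiped along the edges, not over all vertices, so that the whole test costs
    O(|E_L|) even if n is larger. *)
Definition matching_test : cmd :=
  Blk [:: Clr 17] ;;
  edge_loop 24 26
    (Blk [:: LoadI 7 5] ;;
     If 7 (Blk [:: LoadI 7 6] ;; If 7 (mark 5 ;; mark 6) (Blk [::])) (Blk [::])) ;;
  edge_loop 24 26 (Blk (Clr 7 :: put 5 1 7 ++ put 6 1 7)).

Lemma matching_test_ok F m U T : statics m -> alive m U -> stamped m [::] ->
  100 * (size eL + 1) <= T ->
  ok F matching_test m T (fun m' =>
    frame n [:: 1; 3; 4; 5; 6; 7; 17] [::] m m' /\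
    (m' 17 != 0) = ~~ uniq (alive_ends U eL)).
Proof.
move=> st al sm le_T; have [[m24 m25 m26 m27 m28] [m29 [eoL eoR ad]]] := st.
apply: (@ok_blk_seq _ 1) => //; first by lia.
run_tac; set m0 := upd m 17 0; pose L := [:: 1; 3; 4; 5; 6; 7; 17].
have fr0 : frame n L [:: 1] m m0 by rewrite /m0; frame_tac.
apply: (@ok_seq _ _ _ _ _ (size eL * 37 + 3) (size eL * 20 + 3)); last by lia.
apply: (@edge_loop_ok _ (fun s1 m1 => [/\ frame n L [:: 1] m m1,
   stamped m1 (alive_ends U s1) & (m1 17 != 0) = ~~ uniq (alive_ends U s1)]) eL eL0 30) => //.
- move=> s1 m1 [fr1 _ _]; apply: edges_at_frame fr1 _ => //; lia.
- move=> s1 m1 m2 fr12 [fr1 st1 bad1]; split.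
  + by apply: frame_trans fr1 _; apply: frame_sub fr12.
  + by move=> v; rewrite (field_frame _ fr12) // st1.
  + by rewrite (regs_frame fr12).
- move=> s1 e m1 [fr1 st1 bad1] m5 m6.
  have al1 : alive m1 U by apply: alive_frame fr1 al.
  rewrite alive_ends_rcons.
  apply: (@ok_blk_seq _ 1) => //; run_tac; rewrite m5 al1; set m2 := upd _ 7 _.
  have nop m3 : frame n [:: 7] [::] m1 m3 -> (e.1 \in U) && (e.2 \in U) = false ->
      [/\ [/\ frame n L [:: 1] m m3, stamped m3 (alive_ends U s1 ++
            (if (e.1 \in U) && (e.2 \in U) then [:: e.1; e.2] else [::]))
          & (m3 17 != 0) = ~~ uniq (alive_ends U s1 ++
            (if (e.1 \in U) && (e.2 \in U) then [:: e.1; e.2] else [::]))],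
          m3 3 = m1 3 & m3 4 = m1 4].
    move=> fr3 ->; rewrite cats0 !(regs_frame fr3) //; split=> //; split=> //.
      by apply: frame_trans fr1 _; apply: frame_sub fr3.
    by move=> v; rewrite (field_frame _ fr3) // st1.
  apply: ok_if => //; rewrite {1}/m2; mem_reads => ae1; last first.
    apply: (@ok_blk _ 0) => //; apply: nop; first by run_tac; rewrite /m2; frame_tac.
    by case: (e.1 \in U) ae1.
  have m2_6 : m2 6 = vptr e.2 by rewrite /m2; mem_reads.
  have al2 : alive m2 U by apply: (alive_frame (fs := [::]) (l := [:: 7])) al1; rewrite // /m2;
    frame_tac.
  apply: (@ok_blk_seq _ 1) => //; run_tac; rewrite m2_6 al2; set m3 := upd m2 7 _.
  have fr3 : frame n [:: 7] [::] m1 m3 by rewrite /m3 /m2; frame_tac.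
  apply: ok_if => //; rewrite {1}/m3; mem_reads => ae2; last first.
    apply: (@ok_blk _ 0) => //; apply: nop; first by run_tac.
    by rewrite andbC; case: (e.2 \in U) ae2.
  have -> : (e.1 \in U) && (e.2 \in U) by case: (e.1 \in U) (e.2 \in U) ae1 ae2 => [] [].
  apply: (@ok_seq _ _ _ _ _ 12 12) => //.
  have fr3' : frame n L [:: 1] m m3 by apply: frame_trans fr1 _; apply: frame_sub fr3.
  have m3_5 : m3 5 = vptr e.1 by rewrite (regs_frame fr3).
  have st3 : stamped m3 (alive_ends U s1) by move=> v; rewrite (field_frame _ fr3) // st1.
  have bad3 : (m3 17 != 0) = ~~ uniq (alive_ends U s1) by rewrite (regs_frame fr3).
  apply: ok_weaken (@mark_ok F 5 m3 _ _ isT isT m3_5 st3 bad3) (leqnn _) _.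
  move=> m4 [fr4 st4 bad4].
  have m4_6 : m4 6 = vptr e.2 by rewrite (regs_frame fr4) // (regs_frame fr3).
  apply: ok_weaken (@mark_ok F 6 m4 _ _ isT isT m4_6 st4 bad4) (leqnn _) _.
  move=> m6' [fr6 st6 bad6]; rewrite -cat_rcons cats1; split; first split=> //.
  + apply: frame_trans fr3' _; apply: frame_trans (frame_sub _ _ fr4) (frame_sub _ _ fr6) => //.
  + by rewrite (regs_frame fr6) // (regs_frame fr4) // (regs_frame fr3).
  + by rewrite (regs_frame fr6) // (regs_frame fr4) // (regs_frame fr3).
- move=> m1 [fr1 st1 bad1].
  apply: (@edge_loop_ok _ (fun s1 m2 => [/\ frame n L [:: 1] m m2,
    forall v, m2 (field v 1) = (v \in alive_ends U eL) && all (fun e => (e.1 != v) && (e.2 != v)) s1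
    & (m2 17 != 0) = ~~ uniq (alive_ends U eL)]) eL eL0 13) => //.
  + by move=> s1 m2 [fr2 _ _]; apply: edges_at_frame fr2 _ => //; lia.
  + move=> s1 m2 m3 fr12 [fr2 st2 bad2]; split.
    * by apply: frame_trans fr2 _; apply: frame_sub fr12.
    * by move=> v; rewrite (field_frame _ fr12) // st2.
    * by rewrite (regs_frame fr12).
  + move=> s1 e m2 [fr2 st2 bad2] m5 m6; apply: (@ok_blk _ 7) => //.
    run_tac; run_put e.1; rewrite (@run_put _ _ _ _ e.2) //; mem_reads; split=> //; split.
    * by apply: frame_trans fr2 _; frame_tac.
    * move=> v; rewrite all_rcons; have [->|/negbTE e2v] := eqVneq e.2 v.
        by mem_reads; rewrite andbF andbF.
      have [->|/negbTE e1v] := eqVneq e.1 v; first by mem_reads; rewrite andbF.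
      by mem_reads; rewrite st2.
    * by mem_reads.
  + by rewrite (regs_frame fr1).
  + by rewrite (regs_frame fr1).
  + by split=> // v; rewrite andbT st1.
  (* Every stamped vertex is an end of some edge of [eL], hence wiped by the second loop. *)
  + move=> m2 [fr2 st2 bad2]; split=> //; apply: frame_restore fr2 _ => v.
    rewrite st2 sm; case: (boolP (v \in _)) => //= /flattenP[k /mapP[e eeL ->]].
    case: ifP => // _; rewrite !inE => ve; rewrite (_ : all _ _ = false) //.
    by apply/allPn; exists e; rewrite // !(eq_sym _ v) negb_and !negbK.
Qed.
End Loops.

(** * Recording up to two red neighbours of each vertex *)

Section Mates.

Variables (n : nat) (eL eR : seq ('I_n * 'I_n)).
Implicit Types (s : seq ('I_n * 'I_n)) (U : {set 'I_n}) (v w x y : 'I_n) (m : regs).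

Local Notation top := (30 + 6 * n).
Local Notation eL0 := (top + 4).
Local Notation eR0 := (top + 4 + 2 * size eL).
Local Notation statics := (statics eL eR).

Definition mates m (k : 'I_n -> seq 'I_n) := forall v,
  m (field v 2) = nth 0 [seq vptr z | z : 'I_n <- k v] 0 /\
  m (field v 3) = nth 0 [seq vptr z | z : 'I_n <- k v] 1.

Definition add_mate (x y : nat) := get 7 x 2 ++ put x 3 7 ++ put x 2 y.

Lemma run_add_mate (x y : nat) m (a b : 'I_n) k :
  x < 30 -> y < 30 -> x \notin [:: 1; 7] -> y \notin [:: 1; 7] ->
  m x = vptr a -> m y = vptr b -> mates m k ->
  let m' := run_block (add_mate x y) m in
  frame n [:: 1; 7] [:: 2; 3] m m' /\ mates m' (fun v => if v == a then b :: k v else k v).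
Proof.
rewrite !inE !negb_or => x30 y30 /andP[/negbTE x1 /negbTE x7] /andP[/negbTE y1 /negbTE y7] mx my mk.
rewrite /add_mate; run_get a; run_put a; rewrite (@run_put _ _ _ _ a) ?y1 //; last by mem_reads.
mem_reads; split; first by frame_tac.
move=> v; have [->|/negbTE va] := eqVneq v a; mem_reads; last exact: mk.
by have [-> _] := mk a.
Qed.

Definition build_mates : cmd :=
  Blk [:: Clr 7] ;; vertex_loop 3 4 (Blk (put 4 2 7 ++ put 4 3 7)) ;;
  edge_loop 25 27
    (Blk [:: LoadI 7 5] ;;
     If 7 (Blk [:: LoadI 7 6] ;; If 7 (Blk (add_mate 5 6 ++ add_mate 6 5)) (Blk [::]))
       (Blk [::])).

Lemma build_mates_ok F m U T : statics m -> alive m U ->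
  100 * (n + size eR + 1) <= T ->
  ok F build_mates m T (fun m' =>
    frame n [:: 1; 3; 4; 5; 6; 7] [:: 2; 3] m m' /\
    mates m' (fun v => if v \in U then alive_adjacents eR U v else [::])).
Proof.
move=> st al le_T; have [[m24 m25 m26 m27 m28] [m29 [eoL eoR ad]]] := st.
pose L := [:: 1; 3; 4; 5; 6; 7].
apply: (@ok_blk_seq _ 1) => //; first by lia.
run_tac; set m0 := upd m 7 0.
have fr0 : frame n L [:: 2; 3] m m0 by rewrite /m0; frame_tac.
apply: (@ok_seq _ _ _ _ _ (n * 18 + 3) (size eR * 45 + 3)); last by lia.
apply: (@vertex_loop_ok n _ (fun i m1 => [/\ frame n L [:: 2; 3] m m1, m1 7 = 0
  & forall v, v < i -> m1 (field v 2) = 0 /\ m1 (field v 3) = 0]) 9) => //.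
- move=> i m1 m2 fr12 [fr1 m17 z1]; split.
  + by apply: frame_trans fr1 _; apply: frame_sub fr12.
  + by rewrite (regs_frame fr12).
  + by move=> v vi; rewrite !(field_frame _ fr12) //; apply: z1.
- move=> v m1 [fr1 m17 z1] m4; apply: (@ok_blk _ 9) => //.
  run_put v; rewrite (@run_put _ _ _ _ v) //; mem_reads; split=> //; split.
  + by apply: frame_trans fr1 _; frame_tac.
  + by mem_reads.
  + move=> u; rewrite ltnS leq_eqVlt => /orP[/eqP/val_inj->|uv]; first by mem_reads.
    have nuv : (u == v) = false by rewrite -val_eqE ltn_eqF.
    by mem_reads; apply: z1.
move=> m1 [fr1 m17 z1].
apply: (@edge_loop_ok n _ (fun s1 m2 => frame n L [:: 2; 3] m m2 /\
   mates m2 (fun v => if v \in U then alive_adjacents s1 U v else [::])) eR eR0 38) => //.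
- by move=> s1 m2 [fr2 _]; apply: edges_at_frame fr2 _ => //; lia.
- move=> s1 m2 m3 fr23 [fr2 mk2]; split.
  + by apply: frame_trans fr2 _; apply: frame_sub fr23.
  + by move=> v; rewrite !(field_frame _ fr23) //; apply: mk2.
- move=> s1 e m2 [fr2 mk2] m5 m6.
  have al2 : alive m2 U by apply: alive_frame fr2 al.
  apply: (@ok_blk_seq _ 1) => //; run_tac; rewrite m5 al2; set m3 := upd _ 7 _.
  have fr3 : frame n [:: 7] [::] m2 m3 by rewrite /m3; frame_tac.
  have nop m4 : frame n [:: 7] [::] m2 m4 -> (e.1 \in U) && (e.2 \in U) = false ->
      [/\ frame n L [:: 2; 3] m m4 /\
        mates m4 (fun v => if v \in U then alive_adjacents (rcons s1 e) U v else [::]),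
        m4 3 = m2 3 & m4 4 = m2 4].
    move=> fr4 nU; rewrite !(regs_frame fr4) //; split=> //; split.
      by apply: frame_trans fr2 _; apply: frame_sub fr4.
    move=> v; rewrite !(field_frame _ fr4) //; have := mk2 v.
    case: ifP => // vU; rewrite /alive_adjacents adjacents_rcons filter_cat /incident.
    suff -> : [seq z <- (if e.2 == v then [:: e.1] else [::]) ++
        (if e.1 == v then [:: e.2] else [::]) | z \in U] = [::] by [].
    have [e2|_] := eqVneq e.2 v; have [e1|_] := eqVneq e.1 v => //=.
    + by move: nU; rewrite e1 e2 vU.
    + by move: nU; rewrite e2 vU andbT => ->.
    + by move: nU; rewrite e1 vU /= => ->.
  have m3_7 : m3 7 = (e.1 \in U) by rewrite /m3; mem_reads.
  apply: ok_if => //; rewrite m3_7 => ae1; last first.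
    by apply: (@ok_blk _ 0) => //; apply: nop => //; case: (e.1 \in U) ae1.
  have m3_6 : m3 6 = vptr e.2 by rewrite /m3; mem_reads.
  have al3 : alive m3 U by apply: alive_frame fr3 al2.
  apply: (@ok_blk_seq _ 1) => //; run_tac; rewrite m3_6 al3; set m4 := upd _ 7 _.
  have fr4 : frame n [:: 7] [::] m2 m4 by rewrite /m4 /m3; frame_tac.
  have m4_7 : m4 7 = (e.2 \in U) by rewrite /m4; mem_reads.
  apply: ok_if => //; rewrite m4_7 => ae2; last first.
    by apply: (@ok_blk _ 0) => //; apply: nop => //; rewrite andbC; case: (e.2 \in U) ae2.
  have e1U : e.1 \in U by case: (e.1 \in U) ae1.
  have e2U : e.2 \in U by case: (e.2 \in U) ae2.
  apply: (@ok_blk _ 26) => //; rewrite run_block_cat.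
  have m4_5 : m4 5 = vptr e.1 by rewrite (regs_frame fr4).
  have m4_6 : m4 6 = vptr e.2 by rewrite (regs_frame fr4).
  have mk4 : mates m4 (fun v => if v \in U then alive_adjacents s1 U v else [::]).
    by move=> v; rewrite !(field_frame _ fr4) //; apply: mk2.
  have := @run_add_mate 5 6 m4 _ _ _ isT isT isT isT m4_5 m4_6 mk4.
  set m5' := run_block _ m4; case=> fr5 mk5.
  have m5_5 : m5' 5 = vptr e.1 by rewrite (regs_frame fr5).
  have m5_6 : m5' 6 = vptr e.2 by rewrite (regs_frame fr5).
  have := @run_add_mate 6 5 m5' _ _ _ isT isT isT isT m5_6 m5_5 mk5.
  set m6' := run_block _ m5'; case=> fr6 mk6.
  have fr26 : frame n L [:: 2; 3] m2 m6'.
    apply: frame_trans (frame_sub _ _ fr4) (frame_trans (frame_sub _ _ fr5) (frame_sub _ _ fr6))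
      => //.
  have r34 r : r \in [:: 3; 4] -> m6' r = m2 r.
    rewrite !inE => /orP[]/eqP->;
    by rewrite (regs_frame fr6) // (regs_frame fr5) // (regs_frame fr4).
  split; [split; first exact: frame_trans fr2 fr26|exact: r34|exact: r34].
  move=> v; have := mk6 v; rewrite /alive_adjacents adjacents_rcons filter_cat /incident filter_cat.
  rewrite ![v == _]eq_sym; have [<-|_] := eqVneq e.2 v; have [e12|e12] := eqVneq e.1 _.
  + by rewrite e12 e2U /= e2U.
  + by rewrite e2U /= e1U.
  + by rewrite -e12 e1U /= e2U.
  + by [].
- by rewrite (regs_frame fr1).
- by rewrite (regs_frame fr1).
- by split=> // v; case: ifP => _; apply: z1; apply: ltn_ord.
Qed.
End Mates.

(** * What the stored mates say as the board shrinks *)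

Section RedInformation.

Variables (n : nat) (eL eR : seq ('I_n * 'I_n)).
Implicit Types (s : seq ('I_n * 'I_n)) (U : {set 'I_n}) (v w x y : 'I_n) (m : regs).

Local Notation top := (30 + 6 * n).
Local Notation eL0 := (top + 4).
Local Notation eR0 := (top + 4 + 2 * size eL).
Local Notation statics := (statics eL eR).

(** What the two recorded pointers reveal about [A]. With two or more elements their identity is
    irrelevant; it only matters that neither pointer is null. *)
Inductive first_two (A : {set 'I_n}) : nat -> nat -> Prop :=
  | FirstTwoNone : A = set0 -> first_two A 0 0
  | FirstTwoOne x : A = [set x] -> first_two A (vptr x) 0
  | FirstTwoMore p q : 1 < #|A| -> p != 0 -> q != 0 -> first_two A p q.

Lemma first_twoP (l : seq 'I_n) (A : {set 'I_n}) : uniq l -> l =i A ->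
  first_two A (nth 0 [seq vptr z | z : 'I_n <- l] 0) (nth 0 [seq vptr z | z : 'I_n <- l] 1).
Proof.
move=> ul lA; have cA : #|A| = size l by rewrite -(card_uniqP ul); apply: eq_card => z; rewrite lA.
case: l ul lA cA => [|x [|y l]] ul lA cA /=.
- by apply: FirstTwoNone; apply/setP=> z; rewrite -lA inE.
- by apply: FirstTwoOne; apply/setP=> z; rewrite -lA !inE.
- by apply: FirstTwoMore; rewrite ?cA.
Qed.

Hypotheses (uL : uniq (edge_sets eL)) (uR : uniq (edge_sets eR)).
Local Notation EL := (edgeset eL).
Local Notation ER := (edgeset eR).

Lemma scan_nbr_ok F r m U v T :
  statics m -> alive m U -> m r = vptr v -> [set v] \notin EL ->
  10 * (size (adjacents eL v) + 1) <= T ->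
  ok F (scan r) m T (fun m' =>
    frame n [:: 1; 6; 7; 9; 10; 11] [::] m m' /\ first_two (nbr EL U v) (m' 10) (m' 11)).
Proof.
move=> st al mr vE le_T; apply: ok_weaken (scan_ok F st al mr) _ _; first by lia.
move=> m' [fr [-> ->]]; split=> //; apply: first_twoP.
  by rewrite rev_uniq uniq_alive_adjacents.
by move=> z; rewrite mem_rev mem_alive_adjacents.
Qed.

(* What the mate fields of alive vertices say about the red graph on U; the
   vertex pointed to by field 2 may have died since the fields were built. *)
Definition red_info m U := forall w, w \in U ->
  (m (field w 3) != 0 -> 1 < #|nbr ER U w|) /\
  (m (field w 3) = 0 -> (m (field w 2) = 0 /\ nbr ER U w = set0) \/
     exists x, m (field w 2) = vptr x /\ nbr ER U w = [set x] :&: U).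

Definition red_matching m U := red_info m U /\ forall w, w \in U -> m (field w 3) = 0.

Lemma mates_red_info m U : no_loop eR U ->
  mates m (fun v => if v \in U then alive_adjacents eR U v else [::]) -> red_info m U.
Proof.
move=> nl mk w wU; have [-> ->] := mk w; rewrite wU.
have wE := nl w wU.
case: (first_twoP (uniq_alive_adjacents U uR wE) (mem_alive_adjacents U wE)).
- by move=> ->; split=> // _; left.
- move=> x e; split=> // _; right; exists x; split=> //; rewrite e.
  by apply/esym/setIidPl; rewrite -e nbr_sub.
- by move=> p q c _ q0; split=> // q00; rewrite q00 in q0.
Qed.

Lemma red_info_frame l fs m m' U : 2 \notin fs -> 3 \notin fs ->
  frame n l fs m m' -> red_info m U -> red_info m' U.
Proof. by move=> f2 f3 fr ri w wU; rewrite !(field_frame _ fr) //; apply: ri. Qed.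

(** A vertex with at most one red neighbour can only lose it, so a stored mate stays correct up to
    liveness. With two red neighbours this would fail, as either of them might be the survivor. *)
Lemma red_matching_shrink l fs m m' U U' : 2 \notin fs -> 3 \notin fs ->
  frame n l fs m m' -> U' \subset U -> red_matching m U -> red_matching m' U'.
Proof.
move=> f2 f3 fr sU [ri r0]; split=> w wU'; have wU := subsetP sU w wU'; last first.
  by rewrite (field_frame _ fr) // r0.
rewrite !(field_frame _ fr) // r0 //; split=> // _.
have [_ /(_ (r0 w wU))] := ri w wU; rewrite (nbrS _ _ sU).
case=> [[-> ->]|[x [-> ->]]]; first by left; rewrite set0I.
by right; exists x; rewrite -setIA (setIidPr sU).
Qed.

Lemma red_matching_degree m U : red_matching m U -> degree_le1 ER U.
Proof.
move=> [ri r0]; apply/forall_inP=> w wU.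
have [_ /(_ (r0 w wU))] := ri w wU.
case=> [[_ ->]|[x [_ ->]]]; first by rewrite cards0.
by rewrite -(cards1 x) subset_leq_card ?subsetIl.
Qed.

(** The clause [m 0 = 0] serves twice: the null pointer, read as a record, is a dead vertex, and a
    plain [Halt] answers that Left does not win. *)
Definition ready m U := [/\ statics m, alive m U, stamped m (@nil 'I_n) & m 0 = 0].

Lemma ready_frame l fs m m' U : dynamic l fs -> 0 \notin l -> 0 \notin fs -> 1 \notin fs ->
  frame n l fs m m' -> ready m U -> ready m' U.
Proof.
move=> dy l0 f0 f1 fr [st al sm m0]; split.
- exact: statics_frame fr st.
- exact: alive_frame fr al.
- by move=> v; rewrite (field_frame _ fr) ?sm.
- by rewrite (regs_frame fr).
Qed.

Lemma ready_kill r m U v : r < 30 -> r \notin [:: 1; 7; 16] -> m r = vptr v -> ready m U ->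
  let m' := run_block (kill r) m in
  [/\ frame n [:: 1; 7; 16] [:: 0; 5] m m', ready m' (U :\ v)
    & forall l, v \notin l -> trail m (m 16) l -> trail m' (m' 16) (v :: l)].
Proof.
move=> r30 rl mr [st al sm m0] m'; have [fr al' tr] := run_kill r30 rl mr; split=> //.
split; first exact: statics_frame fr st.
- exact: al'.
- by move=> u; rewrite /m' (field_frame _ fr) ?sm.
- by rewrite /m' (regs_frame fr).
Qed.

Lemma trail_frame l fs m m' p (k : seq 'I_n) : 5 \notin fs -> frame n l fs m m' ->
  trail m p k -> trail m' p k.
Proof. by move=> f5 fr; apply: trail_ext => v _; rewrite (field_frame _ fr). Qed.
End RedInformation.

(** * One pick of Right with Left's forced reply *)

Section ForcedExchange.

Variables (n : nat) (eL eR : seq ('I_n * 'I_n)).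
Implicit Types (s : seq ('I_n * 'I_n)) (U : {set 'I_n}) (v w x y : 'I_n) (m : regs).

Local Notation top := (30 + 6 * n).
Local Notation eL0 := (top + 4).
Local Notation eR0 := (top + 4 + 2 * size eL).
Local Notation statics := (statics eL eR).

Hypotheses (uL : uniq (edge_sets eL)) (uR : uniq (edge_sets eR)).
Local Notation EL := (edgeset eL).
Local Notation ER := (edgeset eR).
Local Notation red_info := (red_info eR).
Local Notation ready := (ready eL eR).
(** A missing mate and a dead one are recognised by the same load, since address 0 holds 0. [Halt]
    is reached only where Right is known to hold: two red neighbours, or a blue matching with Left
    to move. *)
Definition exchange : cmd :=
  Blk (kill 13 ++ get 7 13 3) ;;
  If 7 Halt
    (Blk (get 14 13 2 ++ [:: LoadI 7 14]) ;;
     If 7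
       (Blk (kill 14) ;; scan 14 ;;
        If 11 (Blk [:: Clr 15; Clr 12])
          (If 10 (Blk [:: Mov 13 10]) (Blk [:: Clr 15; Inc 15; Clr 12])))
       (matching_test ;; If 17 (Blk [:: Clr 15; Clr 12]) Halt)).

Definition exchange_regs := [:: 1; 3; 4; 5; 6; 7; 9; 10; 11; 12; 13; 14; 15; 16; 17].

(** The time hypotheses separate the cases so that the caller pays for what happens: a matching test
    over all blue edges if [w] has no red mate, which ends the chain, and only the blue list of the
    mate otherwise. *)
Lemma exchange_ok F m U w (l : seq 'I_n) T :
  ready m U -> w \in U -> m 13 = vptr w -> red_info m U ->
  no_loop eL (U :\ w) -> (forall v, v \in l -> v \notin U) -> trail m (m 16) l ->
  (forall m', m' 0 = 0 -> right_holds_by EL ER U w -> F m') ->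
  (nbr ER U w = set0 -> 100 * (size eL + 2) <= T) ->
  (forall x, nbr ER U w = [set x] -> 10 * size (adjacents eL x) + 100 <= T) ->
  100 <= T ->
  ok F exchange m T (fun m' => frame n exchange_regs [:: 0; 5] m m' /\
    ([/\ right_holds_by EL ER U w = false, m' 12 = 0, m' 15 = 0 & exists U' ks,
        [/\ ready m' U', U' \subset U, trail m' (m' 16) (ks ++ l), ks =i U :\: U' & size ks <=
          2]] \/
     exists x, [/\ nbr ER U w = [set x], ready m' (U :\ w :\ x),
       trail m' (m' 16) [:: x, w & l] &
       [/\ nbr EL (U :\ w :\ x) x = set0, m' 12 = 0 & m' 15 = 1] \/
       exists y, [/\ nbr EL (U :\ w :\ x) x = [set y], m' 12 = m 12 & m' 13 = vptr y]])).
Proof.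
move=> rm wU m13 ri nl lU tl HF Tnone Tone T100.
have [st al sm m0] := rm.
have wl : w \notin l by apply/negP=> /lU; rewrite wU.
apply: (@ok_blk_seq _ 15) => //; first by lia.
rewrite run_block_cat.
have := ready_kill (r := 13) isT isT m13 rm; move: (run_block _ m) => m1.
case=> fr1 rm1 tr1; have {}tr1 := tr1 _ wl tl.
have m1_13 : m1 13 = vptr w by rewrite (regs_frame fr1).
have m1_3 : m1 (field w 3) = m (field w 3) by rewrite (field_frame _ fr1).
have m1_2 : m1 (field w 2) = m (field w 2) by rewrite (field_frame _ fr1).
rewrite (run_get _ _ m1_13) m1_3; set m2 := upd _ 7 _.
have fr12 : frame n [:: 1; 7] [::] m1 m2 by rewrite /m2; frame_tac.
have [ri_two ri_one] := ri w wU.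
have m2_7 : m2 7 = m (field w 3) by rewrite /m2; mem_reads.
have m2_0 : m2 0 = 0 by case: rm1 => _ _ _ m1_0; rewrite /m2; mem_reads.
apply: ok_if; last by lia.
  rewrite m2_7 => two; apply: ok_halt; first by lia.
  by apply: HF => //; apply: right_holds_by_two; apply: ri_two.
rewrite m2_7 => no_two.
apply: (@ok_blk_seq _ 5) => //; first by lia.
have m2_13 : m2 13 = vptr w by rewrite /m2; mem_reads.
have m2_2 : m2 (field w 2) = m (field w 2) by rewrite /m2; mem_reads.
run_get w; rewrite m2_2; run_tac; set m3 := upd _ 7 _.
have m3_14 : m3 14 = m (field w 2) by rewrite /m3; mem_reads.
have fr13 : frame n [:: 1; 7; 14] [::] m1 m3 by rewrite /m3; frame_tac.
have rm3 : ready m3 (U :\ w) by apply: ready_frame fr13 rm1.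
have [st3 al3 sm3 m3_0] := rm3.
have fr3 : frame n exchange_regs [:: 0; 5] m m3.
  by apply: frame_trans (frame_sub _ _ fr1) (frame_sub _ _ fr13).
have tr3 : trail m3 (m3 16) (w :: l).
  by rewrite (regs_frame fr13) //; apply: trail_frame fr13 tr1.
have m3_7 x : m (field w 2) = vptr x -> m3 7 = (x \in U :\ w).
  move=> e; rewrite -al3 -e /m3; mem_reads; rewrite e.
  by mem_reads.
have none : nbr ER U w = set0 -> ok F
   (matching_test ;; If 17 (Blk [:: Clr 15; Clr 12]) Halt) m3 (T - 15 - 2 - 5 - 2)
   (fun m' => frame n exchange_regs [:: 0; 5] m m' /\
    ([/\ right_holds_by EL ER U w = false, m' 12 = 0, m' 15 = 0 & exists U' ks,
        [/\ ready m' U', U' \subset U, trail m' (m' 16) (ks ++ l), ks =i U :\: U' & size ks <=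
          2]] \/
     exists x, [/\ nbr ER U w = [set x], ready m' (U :\ w :\ x),
       trail m' (m' 16) [:: x, w & l] &
       [/\ nbr EL (U :\ w :\ x) x = set0, m' 12 = 0 & m' 15 = 1] \/
       exists y, [/\ nbr EL (U :\ w :\ x) x = [set y], m' 12 = m 12 & m' 13 = vptr y]])).
  move=> N0; have {}Tnone := Tnone N0.
  apply: (@ok_seq _ _ _ _ _ (100 * (size eL + 1)) 10); last by lia.
  apply: ok_weaken (matching_test_ok F st3 al3 sm3 (leqnn _)) (leqnn _) _.
  move=> m4 [fr34 m4_17].
  have rm4 : ready m4 (U :\ w) by apply: ready_frame fr34 rm3.
  have sU : U :\ w \subset U by apply: subD1set.
  rewrite (uniq_alive_ends uL nl) in m4_17.
  apply: ok_if => // m4_17'; last first.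
    apply: ok_halt => //; apply: HF; first by case: rm4.
    by rewrite right_holds_by_none //; move: m4_17; rewrite m4_17' eqxx => /esym/negbFE.
  apply: (@ok_blk _ 2) => //; run_tac; set m5 := upd _ 12 _.
  have fr45 : frame n [:: 12; 15] [::] m4 m5 by rewrite /m5; frame_tac.
  split.
    by apply: frame_trans fr3 (frame_trans (frame_sub _ _ fr34) (frame_sub _ _ fr45)).
  left; split; rewrite ?/m5; mem_reads => //.
    by rewrite right_holds_by_none //; move: m4_17; rewrite m4_17' => /esym/negbTE.
  exists (U :\ w), [:: w]; split=> //.
  - exact: ready_frame fr45 rm4.
  - rewrite cat1s; apply: trail_frame fr45 _ => //.
    rewrite /m5; mem_reads; rewrite (regs_frame fr34) //; exact: trail_frame fr34 tr3.
  - by move=> z; rewrite !inE; case: eqP => [->|]; rewrite ?wU //= andNb.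
have m3_null : m (field w 2) = 0 -> m3 7 = 0.
  move=> e; rewrite /m3; mem_reads; rewrite e; mem_reads.
  by rewrite m2_0.
apply: ok_if; last by lia.
  move=> m37; have [[e2 _]|[x [e2 Nx]]] := ri_one no_two.
    by rewrite m3_null in m37.
  have xUw : x \in U :\ w by move: m37; rewrite (m3_7 x) //; case: (_ \in _).
  have /setD1P[xw xU] := xUw.
  have {}Nx : nbr ER U w = [set x] by rewrite Nx; apply/setIidPl; rewrite sub1set.
  have {}Tone := Tone x Nx.
  apply: (@ok_blk_seq _ 10) => //; first by lia.
  have m3x : m3 14 = vptr x by rewrite m3_14.
  have := ready_kill (r := 14) isT isT m3x rm3; move: (run_block _ m3) => m4.
  case=> fr34 rm4 tr4.
  have {}tr4 : trail m4 (m4 16) [:: x, w & l].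
    apply: tr4 tr3; rewrite inE negb_or xw /=.
    by apply/negP=> /lU; rewrite xU.
  have [st4 al4 sm4 m4_0] := rm4.
  have m4_14 : m4 14 = vptr x by rewrite (regs_frame fr34).
  apply: (@ok_seq _ _ _ _ _ (10 * (size (adjacents eL x) + 1)) 10); last by lia.
  apply: ok_weaken (scan_nbr_ok uL uR F st4 al4 m4_14 (nl x xUw) (leqnn _)) (leqnn _) _.
  move=> m5 [fr45 ft].
  have rm5 : ready m5 (U :\ w :\ x) by apply: ready_frame fr45 rm4.
  have fr5 : frame n exchange_regs [:: 0; 5] m m5.
    by apply: frame_trans fr3 (frame_trans (frame_sub _ _ fr34) (frame_sub _ _ fr45)).
  have tr5 : trail m5 (m5 16) [:: x, w & l].
    by rewrite (regs_frame fr45) //; apply: trail_frame fr45 tr4.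
  have m5_12 : m5 12 = m 12.
    rewrite (regs_frame fr45) // (regs_frame fr34) // (regs_frame fr13) //.
    by rewrite (regs_frame fr1).
  apply: ok_if => // m5_11.
    apply: (@ok_blk _ 2) => //; run_tac; set m6 := upd _ 12 _.
    have fr56 : frame n [:: 12; 15] [::] m5 m6 by rewrite /m6; frame_tac.
    split; first exact: frame_trans fr5 (frame_sub _ _ fr56).
    left; split; rewrite ?/m6; mem_reads => //.
      by case: ft m5_11 => // p q two _ _ _; apply: right_holds_by_double Nx _.
    exists (U :\ w :\ x), [:: x; w]; split=> //.
    - exact: ready_frame fr56 rm5.
    - exact: setD2S.
    - by apply: trail_frame fr56 _ => //; rewrite /m6; mem_reads.
    - move=> z; rewrite !inE; have [->|zx] := eqVneq z x; first by rewrite xU.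
      by have [->|zw] := eqVneq z w; rewrite ?wU //= andNb.
  have [N0|[y Ny]] : nbr EL (U :\ w :\ x) x = set0 /\ m5 10 = 0 \/
      exists y, nbr EL (U :\ w :\ x) x = [set y] /\ m5 10 = vptr y.
    case: ft m5_11 => [N0|y Ny|p q _ _ q0 q00]; first by left.
      by right; exists y.
    by rewrite q00 in q0.
  - apply: ok_if => //; first by rewrite N0.2.
    move=> _; apply: (@ok_blk _ 3) => //; run_tac; set m6 := upd _ 12 _.
    have fr56 : frame n [:: 12; 15] [::] m5 m6 by rewrite /m6; frame_tac.
    split; first exact: frame_trans fr5 (frame_sub _ _ fr56).
    right; exists x; split=> //.
    + exact: ready_frame fr56 rm5.
    + by apply: trail_frame fr56 _ => //; rewrite /m6; mem_reads.
    + by left; rewrite N0.1 /m6; mem_reads.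
  - apply: ok_if => //; last by rewrite Ny.2.
    move=> _; apply: (@ok_blk _ 1) => //; run_tac; rewrite Ny.2; set m6 := upd _ 13 _.
    have fr56 : frame n [:: 13] [::] m5 m6 by rewrite /m6; frame_tac.
    split; first exact: frame_trans fr5 (frame_sub _ _ fr56).
    right; exists x; split=> //.
    + exact: ready_frame fr56 rm5.
    + by apply: trail_frame fr56 _ => //; rewrite /m6; mem_reads.
    + by right; exists y; rewrite Ny.1 /m6; mem_reads.
move=> m37; apply: none; have [[_ //]|[x [e2 Nx]]] := ri_one no_two.
(* The stored mate is dead. A red neighbour of [w] in [U] would have to be that mate, hence [w]
   itself, which [nbr] excludes. *)
have xNU : x \notin U :\ w.
  by move: m37; rewrite (m3_7 x) //; case: (_ \in _).
apply/eqP; rewrite -subset0; apply/subsetP=> z zN; exfalso.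
move: (zN); rewrite Nx !inE => /andP[/eqP zx zU].
move: xNU; rewrite -zx !inE zU andbT negbK => /eqP zw.
by move: zN; rewrite zw in_nbr eqxx andbF.
Qed.
End ForcedExchange.

(** * Chains of exchanges and their cost *)

Section ForcedChain.

Variables (n : nat) (eL eR : seq ('I_n * 'I_n)).
Implicit Types (s : seq ('I_n * 'I_n)) (U : {set 'I_n}) (v w x y : 'I_n) (m : regs).

Local Notation top := (30 + 6 * n).
Local Notation eL0 := (top + 4).
Local Notation eR0 := (top + 4 + 2 * size eL).
Local Notation statics := (statics eL eR).

Hypotheses (uL : uniq (edge_sets eL)) (uR : uniq (edge_sets eR)).
Local Notation EL := (edgeset eL).
Local Notation ER := (edgeset eR).
Local Notation red_info := (red_info eR).
Local Notation ready := (ready eL eR).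
(** Potential of a chain: the total length of the blue lists that are still open to scanning. *)
Definition weight U := \sum_(v in U) size (adjacents eL v).

Lemma weight_forced U w x : w \in U -> x \in U :\ w ->
  weight (U :\ w :\ x) + size (adjacents eL x) <= weight U.
Proof.
move=> wU xU; rewrite /weight (big_setD1 w wU) (big_setD1 x xU) /=.
by rewrite [X in X <= _]addnC leq_addl.
Qed.

Lemma weight_le U : weight U <= 2 * size eL.
Proof.
rewrite -sum_size_adjacents [X in _ <= X](bigID (mem U)) /=; exact: leq_addr.
Qed.

(** The command [rb] refreshes the red mates before each exchange. It is empty in the free search
    and [build_mates] in the chain forced by the opening. *)
Definition chain rb : cmd :=
  Blk [:: Clr 16; Clr 12; Inc 12] ;; While 12 (rb ;; exchange).

Section Chain.

Variables (F : regs -> Prop) (rb : cmd) (Trb : nat) (fs : seq nat).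
Variable inv : regs -> {set 'I_n} -> Prop.
Hypothesis fs_mates : all (mem [:: 2; 3]) fs.
Hypothesis rb_ok : forall m U, ready m U -> inv m U -> no_loop eR U ->
  ok F rb m Trb (fun m' =>
    [/\ frame n [:: 1; 3; 4; 5; 6; 7] fs m m', inv m' U & red_info m' U]).
Hypothesis inv_frame : forall m m' U U',
  frame n exchange_regs [:: 0; 5] m m' -> U' \subset U -> inv m U -> inv m' U'.

Let not_fs f : f \notin [:: 2; 3] -> f \notin fs.
Proof. by apply: contra => /(allP fs_mates). Qed.

Definition chain_outcome U0 w0 U m' : Prop :=
  (m' 15 = 0 /\ right_holds_by EL ER U0 w0 = false) \/
  [/\ m' 15 = 1, right_holds_by EL ER U0 w0 = right_holds EL ER U, U \subset U0 :\ w0 &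
    degree_le1 ER U0 -> exists R L, released EL ER U0 R L /\ U = U0 :\: (R :|: L)].

Definition chain_result U0 w0 m m' : Prop := exists U (l : seq 'I_n),
  [/\ [/\ ready m' U, U \subset U0, frame n exchange_regs ([:: 0; 5] ++ fs) m m' & inv m' U],
      trail m' (m' 16) l, l =i U0 :\: U, size l <= 2 * weight U0 + 2
    & chain_outcome U0 w0 U m'].

(** An exchange that prolongs the chain spends at least one unit of [weight], so there are at most
    [2 * size eL + 1] of them; the additional term pays for a single matching test at the end. *)
Lemma chain_ok m U0 w0 T :
  ready m U0 -> w0 \in U0 -> m 13 = vptr w0 -> no_loop eL (U0 :\ w0) -> no_loop eR U0 ->
  inv m U0 ->
  (forall m', m' 0 = 0 -> right_holds_by EL ER U0 w0 -> F m') ->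
  (2 * size eL + 1) * (Trb + 120) + 100 * (size eL + 3) <= T ->
  ok F (chain rb) m T (chain_result U0 w0 m).
Proof.
move=> rm0 wU0 m13 nlL nlR inv0 HF le_T.
have T3 : 3 <= T by move: le_T; clear; lia.
apply: (@ok_blk_seq _ 3) => //.
run_tac; set m1 := upd _ 12 _.
have fr01 : frame n exchange_regs [::] m m1 by rewrite /m1; frame_tac.
(* [C] is the price of one unit of [weight]; [D] covers the last exchange. Both are kept opaque to
   spare [lia] the products. *)
have [C CE] : exists C, C = Trb + 120 by exists (Trb + 120).
have [D DE] : exists D, D = 100 * (size eL + 2) + C by exists (100 * (size eL + 2) + C).
have {le_T} le0 : weight U0 * C + D <= T - 3.
  have : weight U0 * C <= 2 * size eL * C by rewrite leq_mul2r weight_le orbT.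
  by rewrite -CE mulnDl in le_T; lia.
apply: (@ok_while _ (fun B m2 => [/\ m2 12 = 0, 0 < B & chain_result U0 w0 m m2] \/
  exists U w (l : seq 'I_n), weight U * C + D <= B /\
  [/\ [/\ ready m2 U, U \subset U0, frame n exchange_regs ([:: 0; 5] ++ fs) m m2 & inv m2 U],
      [/\ w \in U, U :\ w \subset U0 :\ w0, m2 13 = vptr w, m2 12 = 1 & right_holds_by EL ER U0
        w0 = right_holds_by EL ER U w],
      [/\ trail m2 (m2 16) l, l =i U0 :\: U & size l + 2 * weight U <= 2 * weight U0]
    & degree_le1 ER U0 ->
      exists R L, pending EL ER U0 R L w /\ U = U0 :\: (R :|: L)])).
- move=> B m2 [[-> //]|[U [w [l [le_B [[rm2 sU fr2 inv2] [wU sUw m2_13 m2_12 rh] [tr2 lU sl]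
    pd]]]]]] _.
  have nlLU := no_loopS sUw nlL; have nlRU := no_loopS sU nlR.
  (* The time granted to the exchange depends on the red neighbours of [w]. The last clause says
     that, if the chain goes on, the weight lost has paid for this turn. *)
  have [Te [T0 T1 T100 TB Tcont]] : exists Te, [/\
      nbr ER U w = set0 -> 100 * (size eL + 2) <= Te,
      forall x, nbr ER U w = [set x] -> 10 * size (adjacents eL x) + 100 <= Te,
      100 <= Te, Trb + Te + 3 <= B &
      forall x y, nbr ER U w = [set x] -> nbr EL (U :\ w :\ x) x = [set y] ->
        weight (U :\ w :\ x) * C + D <= B - (Trb + Te + 2)].
    case: (leqP #|nbr ER U w| 1) => [/cards_le1_cases[N0|[x Nx]]|two].
    + exists (100 * (size eL + 2)); split=> //; rewrite ?N0.
      * by move=> x /setP/(_ x); rewrite !inE eqxx.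
      * by clear; lia.
      * by move: (weight U * C) le_B CE DE; clear; lia.
      * by move=> x y /setP/(_ x); rewrite !inE eqxx.
    + have xU := forced_reply_in Nx; have wt := weight_forced wU xU.
      have : (weight (U :\ w :\ x) + size (adjacents eL x)) * C <= weight U * C.
        by rewrite leq_mul2r wt orbT.
      rewrite mulnDl => wtC.
      have sC : 120 * size (adjacents eL x) <= size (adjacents eL x) * C.
        by rewrite mulnC leq_mul2l CE leq_addl orbT.
      exists (10 * size (adjacents eL x) + 100); split.
      * by rewrite Nx => /setP/(_ x); rewrite !inE eqxx.
      * by move=> x'; rewrite Nx => /set1_inj <-.
      * by clear; lia.
      * by move: (weight U * C) (weight _ * C) (_ * C) wtC sC le_B CE DE; clear; lia.
      * move=> x' y; rewrite Nx => /set1_inj <- Ny.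
        (* The chain goes on only through a blue neighbour [y] of [x], so the weight really
           drops. *)
        have : 0 < size (adjacents eL x).
          have : y \in adjacents eL x.
            rewrite mem_adjacents; have : y \in nbr EL (U :\ w :\ x) x by rewrite Ny inE.
            by rewrite in_nbr => /and3P[].
          by case: (adjacents eL x).
        case: (size (adjacents eL x)) wtC => // k; rewrite mulSn => wtC _.
        have : 120 * k <= k * C by rewrite mulnC leq_mul2l CE leq_addl orbT.
        by move: (weight _ * C) (weight U * C) (k * C) wtC le_B CE; clear; lia.
    + exists 100; split=> //.
      * by move=> N0; rewrite N0 cards0 in two.
      * by move=> x Nx; rewrite Nx cards1 in two.
      * by move: (weight U * C) le_B CE DE; clear; lia.
      * by move=> x y Nx; rewrite Nx cards1 in two.
  exists (Trb + Te), (B - (Trb + Te + 2)); split; first by move: TB; clear; lia.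
  apply: (@ok_seq _ _ _ _ _ Trb Te); last by [].
  apply: ok_weaken (rb_ok rm2 inv2 nlRU) (leqnn _) _ => m3 [fr23 inv3 ri3].
  have rm3 : ready m3 U.
    by apply: ready_frame fr23 rm2 => //; [rewrite /dynamic /= | |]; apply: not_fs.
  have m3_13 : m3 13 = vptr w by rewrite (regs_frame fr23).
  have fr3 : frame n exchange_regs ([:: 0; 5] ++ fs) m m3.
    apply: frame_trans fr2 (frame_sub _ _ fr23) => //.
    by apply/allP=> f ffs /=; rewrite !inE ffs !orbT.
  have tr3 : trail m3 (m3 16) l.
    by rewrite (regs_frame fr23) //; apply: trail_frame fr23 tr2; apply: not_fs.
  have lnU v : v \in l -> v \notin U by rewrite lU inE => /andP[].
  have HF' m' : m' 0 = 0 -> right_holds_by EL ER U w -> F m'.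
    by rewrite -rh; apply: HF.
  apply: ok_weaken (exchange_ok uL uR rm3 wU m3_13 ri3 nlLU lnU tr3 HF' T0 T1 T100) (leqnn _) _.
  move=> m4 [fr34 res].
  have fr4 : frame n exchange_regs ([:: 0; 5] ++ fs) m m4.
    by apply: frame_trans fr3 (frame_sub _ _ fr34).
  case: res => [[rhw m4_12 m4_15 [U' [ks [rm4 sU' tr4 ksU size_ks]]]]|[x [Nx rm4 tr4 cont]]].
    left; split=> //; first by move: TB; clear; lia.
    exists U', (ks ++ l); split=> //.
    + split=> //; [exact: subset_trans sU' sU | exact: inv_frame fr34 sU' inv3].
    + move=> v; rewrite mem_cat ksU lU !inE; case vU: (v \in U); rewrite ?andbT ?andbF ?orbF //=.
        by rewrite (subsetP sU _ vU) ?andbT ?orbF.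
      by case vU': (v \in U') => //; rewrite (subsetP sU' _ vU') in vU.
    + by rewrite size_cat; move: size_ks sl; clear; lia.
    + by left; rewrite rh.
  have xU := forced_reply_in Nx; have wt := weight_forced wU xU.
  have sV : U :\ w :\ x \subset U by apply: setD2S.
  have lV : [:: x, w & l] =i U0 :\: (U :\ w :\ x).
    move=> v; rewrite !inE lU !inE; have [->|vx] := eqVneq v x.
      by move: xU => /setD1P[_ xU]; rewrite (subsetP sU _ xU).
    have [->|vw] := eqVneq v w; first by rewrite (subsetP sU _ wU).
    by [].
  have cV : U :\ w :\ x \subset U0 :\ w0.
    exact: subset_trans (subD1set _ _) sUw.
  case: cont => [[N0 m4_12 m4_15]|[y [Ny m4_12 m4_13]]].
    left; split=> //; first by move: TB; clear; lia.
    exists (U :\ w :\ x), [:: x, w & l]; split=> //.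
    + split=> //; [exact: subset_trans sV sU | exact: inv_frame fr34 sV inv3].
    + by move: sl; clear; rewrite /=; lia.
    + right; split=> //; first by rewrite rh; apply: right_holds_by_release.
      move=> dU; have [R [L [pdw eU]]] := pd dU; rewrite eU in Nx N0 *.
      exists (w |: R), (x |: L); split; first exact: pending_released dU pdw Nx N0.
      by rewrite exchange_rest.
  right; exists (U :\ w :\ x), y, [:: x, w & l]; split; first exact: Tcont Nx Ny.
  have yV : y \in U :\ w :\ x by apply: (subsetP (nbr_sub EL _ x)); rewrite Ny inE.
  split.
  + split=> //; [exact: subset_trans sV sU | exact: inv_frame fr34 sV inv3].
  + split=> //; first exact: subset_trans (subD1set _ _) cV.
      by rewrite m4_12 (regs_frame fr23).
    by rewrite rh; apply: right_holds_by_continue.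
  + split=> //=; have : 0 < size (adjacents eL x).
      have : y \in adjacents eL x.
        rewrite mem_adjacents; have : y \in nbr EL (U :\ w :\ x) x by rewrite Ny inE.
        by rewrite in_nbr => /and3P[].
      by case: (adjacents eL x).
    by move: sl wt; clear; lia.
  + move=> dU; have [R [L [pdw eU]]] := pd dU; rewrite eU in Nx Ny *.
    exists (w |: R), (x |: L); split; first exact: pending_step dU pdw Nx _ Ny.
    by rewrite exchange_rest.
- move=> B m2 [[_ B0 res] _ //|[U [w [l [_ [_ [_ _ _ e _] _ _]]]]]].
  by rewrite e.
- right; exists U0, w0, [::]; split; first by [].
  split.
  + split=> //; first by apply: ready_frame fr01 rm0.
    * by apply: frame_sub fr01.
    * by apply: inv_frame inv0 => //; apply: frame_sub fr01.
  + by split=> //; rewrite /m1; mem_reads.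
  + by split=> // z; rewrite setDv !inE.
  + move=> dU; exists set0, set0; split; first exact: pending_start.
    by rewrite setU0 setD0.
Qed.

End Chain.
End ForcedChain.

(** * Trying one opening vertex, with undoing *)

Section TryVertex.

Variables (n : nat) (eL eR : seq ('I_n * 'I_n)).
Implicit Types (s : seq ('I_n * 'I_n)) (U : {set 'I_n}) (v w x y : 'I_n) (m : regs).

Local Notation top := (30 + 6 * n).
Local Notation eL0 := (top + 4).
Local Notation eR0 := (top + 4 + 2 * size eL).
Local Notation statics := (statics eL eR).

Hypotheses (uL : uniq (edge_sets eL)) (uR : uniq (edge_sets eR)).
Local Notation EL := (edgeset eL).
Local Notation ER := (edgeset eR).
Local Notation red_info := (red_info eR).
Local Notation ready := (ready eL eR).
Local Notation red_matching := (red_matching eR).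

Definition undo : cmd :=
  While 16 (Blk [:: Clr 7, Inc 7, StoreI 16 7 & get 16 16 5]).

Lemma undo_ok F m U (l : seq 'I_n) T :
  ready m U -> trail m (m 16) l -> 12 * size l + 1 <= T ->
  ok F undo m T (fun m' =>
    frame n [:: 1; 7; 16] [:: 0] m m' /\ ready m' (U :|: [set v in l])).
Proof.
move=> rm0 tr0 le_T; apply: (@ok_weaken _ _ _ (12 * size l + 1)); [|exact: le_T|by move=> m' H;
  exact: H].
apply: (@ok_while _ (fun B m1 => exists l1 l2 : seq 'I_n, [/\ B = 12 * size l2 + 1,
   l = l1 ++ l2, frame n [:: 1; 7; 16] [:: 0] m m1, ready m1 (U :|: [set v in l1])
   & trail m1 (m1 16) l2])).
- move=> B m1 [l1 [[|v l2] [-> el fr rm1 tr1]]] m1_16; first by rewrite tr1 in m1_16.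
  have [e16 tr2] := tr1.
  exists 10, (12 * size l2 + 1); split; first by rewrite /=; clear; lia.
  apply: (@ok_blk _ 10) => //; run_tac; rewrite e16.
  rewrite (@run_get _ _ _ _ v); last by mem_reads.
  mem_reads; set m2 := upd _ 16 _.
  have fr12 : frame n [:: 1; 7; 16] [:: 0] m1 m2 by rewrite /m2; frame_tac.
  exists (rcons l1 v), l2; split=> //.
  + by rewrite cat_rcons.
  + exact: frame_trans fr fr12.
  + have [st al sm z] := rm1; split.
    * exact: statics_frame fr12 st.
    * move=> u; rewrite /m2; have [->|/negbTE uv] := eqVneq u v; mem_reads.
        by rewrite !inE mem_rcons inE eqxx orbT.
      by rewrite al !inE mem_rcons inE uv.
    * by move=> u; rewrite (field_frame _ fr12).
    * by rewrite (regs_frame fr12).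
  + by apply: trail_frame fr12 _ => //; rewrite /m2; mem_reads.
- move=> B m1 [l1 [[|v l2] [-> -> fr rm1 tr1]]] m1_16; first by rewrite cats0.
  by case: tr1 => e _; rewrite e in m1_16.
- exists [::], l; split=> //.
  by rewrite (_ : [set v in [::]] = set0) ?setU0 //; apply/setP=> v; rewrite !inE.
Qed.

Definition try_vertex : cmd :=
  Blk [:: LoadI 7 21] ;;
  If 7
    (Blk [:: Clr 19; Inc 19; Mov 13 21] ;; chain (Blk [::]) ;;
     If 15 (Blk [:: Clr 18; Inc 18]) undo)
    (Blk [::]).

Lemma try_vertex_ok F m U v T :
  ready m U -> m 21 = vptr v -> no_loop eL U -> no_loop eR U -> red_matching m U ->
  (forall m', m' 0 = 0 -> right_holds EL ER U -> F m') ->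
  480 * (size eL + 1) <= T ->
  ok F try_vertex m T (fun m' => exists U',
    [/\ ready m' U', red_matching m' U', U' \subset U,
        m' 20 = m 20 /\ m' 21 = m 21 &
     if v \in U then m' 19 = 1 /\
       ([/\ m' 18 = m 18, U' = U & right_holds_by EL ER U v = false] \/
        [/\ m' 18 = 1, #|U'| < #|U| & right_holds EL ER U = right_holds EL ER U'])
     else [/\ m' 18 = m 18, m' 19 = m 19 & U' = U]]).
Proof.
move=> rm m21 nlL nlR rdm HF le_T.
have T6 : 300 <= T by move: le_T; clear; lia.
have [st al sm z] := rm.
apply: (@ok_blk_seq _ 1) => //; first by move: T6; clear; lia.
run_tac; rewrite m21 al; set m1 := upd _ 7 _.
have fr1 : frame n [:: 7] [::] m m1 by rewrite /m1; frame_tac.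
have m1_7 : m1 7 = (v \in U) by rewrite /m1; mem_reads.
have m1_21 : m1 21 = vptr v by rewrite (regs_frame fr1).
have rm1 : ready m1 U by apply: ready_frame fr1 rm.
have rdm1 : red_matching m1 U by apply: red_matching_shrink fr1 _ rdm.
apply: ok_if; last by move: T6; clear; lia.
  rewrite m1_7 => vU7; have vU : v \in U by case: (v \in U) vU7.
  apply: (@ok_blk_seq _ 3) => //; first by move: T6; clear; lia.
  run_tac; rewrite m1_21; set m2 := upd _ 13 _.
  have fr12 : frame n [:: 13; 19] [::] m1 m2 by rewrite /m2; frame_tac.
  have rm2 : ready m2 U by apply: ready_frame fr12 rm1.
  have rdm2 : red_matching m2 U by apply: red_matching_shrink fr12 _ rdm1.
  have m2_13 : m2 13 = vptr v by rewrite /m2; mem_reads.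
  have nop_ok m' U' : ready m' U' -> red_matching m' U' -> no_loop eR U' ->
      ok F (Blk [::]) m' 0 (fun m'' =>
        [/\ frame n [:: 1; 3; 4; 5; 6; 7] [::] m' m'', red_matching m'' U' & red_info m'' U']).
    by move=> _ r _; apply: (@ok_blk _ 0) => //; split=> //; case: r.
  have inv_ok m' m'' U' U'' : frame n exchange_regs [:: 0; 5] m' m'' -> U'' \subset U' ->
      red_matching m' U' -> red_matching m'' U''.
    by move=> fr sU; apply: red_matching_shrink fr sU.
  have HF' m' : m' 0 = 0 -> right_holds_by EL ER U v -> F m'.
    by move=> m'0 h; apply: HF => //; apply: right_holds_by_sub h.
  (* The trail has at most [2 * weight U + 2] vertices, the weight is at most [2 * size eL], and
     undoing takes 12 steps per vertex. *)
  apply: (@ok_seq _ _ _ _ _ ((2 * size eL + 1) * (0 + 120) + 100 * (size eL + 3))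
     (2 + 12 * (2 * (2 * size eL) + 2) + 1)); last first.
    by move: le_T; clear; lia.
  apply: ok_weaken (chain_ok (inv := red_matching) (fs := [::]) uL uR isT nop_ok inv_ok rm2 vU
    m2_13 (no_loopS (subD1set _ _) nlL) nlR rdm2 HF' (leqnn _)) (leqnn _) _.
  move=> m3 [U' [l [[rm3 sU' fr23 rdm3] tr3 lU' sl out]]].
  have same r : r \in [:: 18; 20; 21] -> m3 r = m r.
    by rewrite !inE => /or3P[]/eqP->; rewrite (regs_frame fr23) // (regs_frame fr12) //
      (regs_frame fr1).
  have m3_19 : m3 19 = 1 by rewrite (regs_frame fr23) // /m2; mem_reads.
  case: out => [[m3_15 nh]|[m3_15 h sUv rel]].
    apply: ok_if; first by rewrite m3_15.
      move=> _; have U'U : U' :|: [set u in l] = U.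
        apply/setP=> u; rewrite !inE lU' inE; case uU': (u \in U') => //=.
        by rewrite (subsetP sU' _ uU').
      have le_u : 12 * size l + 1 <= 2 + 12 * (2 * (2 * size eL) + 2) + 1 - 2.
        by move: sl (weight_le eL U); clear; lia.
      apply: ok_weaken (undo_ok F rm3 tr3 le_u) (leqnn _) _ => m4 [fr34].
      rewrite U'U => rm4; exists U; rewrite vU; split=> //.
      (* The mates need no restoring: neither the chain nor [undo] writes fields 2 and 3. *)
      + apply: (red_matching_shrink (l := exchange_regs) (fs := [:: 0; 5]) (m := m2) (U := U))
        => //.
        by apply: frame_trans fr23 (frame_sub _ _ fr34).
      + by rewrite !(regs_frame fr34) // !same.
      + by rewrite !(regs_frame fr34) // m3_19 same //; split=> //; left.
    by clear; lia.
  apply: ok_if; last by clear; lia.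
    move=> _; apply: (@ok_blk _ 2) => //; first by clear; lia.
    run_tac; set m4 := upd _ 18 _.
    have fr34 : frame n [:: 18] [::] m3 m4 by rewrite /m4; frame_tac.
    exists U'; rewrite vU; split=> //.
    + exact: ready_frame fr34 rm3.
    + by rewrite !same.
    + split=> //; right; split=> //.
        by rewrite (cardsD1 v U) vU ltnS subset_leq_card.
      (* Committing loses nothing: one direction is [right_holds_released], and for the other the
         chain from [v] is itself available to Right. *)
      have dU := red_matching_degree rdm; have [R [L [relU eU]]] := rel dU.
      apply/idP/idP => hU.
        by have [H _ _] := right_holds_released dU relU; rewrite eU; apply: H.
      by apply: right_holds_by_sub vU _; rewrite h.
  by rewrite m3_15.
rewrite m1_7 => vU; have {}vU : (v \in U) = false by case: (v \in U) vU.
apply: (@ok_blk _ 0) => //; run_tac; by exists U; rewrite vU; split.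
Qed.
End TryVertex.

(** * The greedy search from a free move of Right *)

Section FreeMove.

Variables (n : nat) (eL eR : seq ('I_n * 'I_n)).
Implicit Types (s : seq ('I_n * 'I_n)) (U : {set 'I_n}) (v w x y : 'I_n) (m : regs).

Local Notation top := (30 + 6 * n).
Local Notation eL0 := (top + 4).
Local Notation eR0 := (top + 4 + 2 * size eL).
Local Notation statics := (statics eL eR).

Hypotheses (uL : uniq (edge_sets eL)) (uR : uniq (edge_sets eR)).
Local Notation EL := (edgeset eL).
Local Notation ER := (edgeset eR).
Local Notation red_info := (red_info eR).
Local Notation ready := (ready eL eR).
Local Notation red_matching := (red_matching eR).

Definition pass : cmd := Blk [:: Clr 18; Clr 19] ;; vertex_loop 20 21 try_vertex.

(** A pass without commitment has tried all alive vertices on the same board in vain, so Right holds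
    only if that board is empty, which register 19 tells. After a commitment the earlier failures
    say nothing about the smaller board, hence the repeated passes. *)
Lemma pass_ok F m U T :
  ready m U -> no_loop eL U -> no_loop eR U -> red_matching m U ->
  (forall m', m' 0 = 0 -> right_holds EL ER U -> F m') ->
  n * (500 * (size eL + 1)) + 5 <= T ->
  ok F pass m T (fun m' => exists U',
    [/\ ready m' U', red_matching m' U', U' \subset U &
      [/\ m' 18 = 0, U' = U & m' 19 = ~~ right_holds EL ER U] \/
      [/\ m' 18 = 1, #|U'| < #|U| & right_holds EL ER U = right_holds EL ER U']]).
Proof.
move=> rm nlL nlR rdm HF le_T.
apply: (@ok_blk_seq _ 2) => //; first by move: le_T; clear; lia.
run_tac; set m1 := upd _ 19 _.
have fr1 : frame n [:: 18; 19] [::] m m1 by rewrite /m1; frame_tac.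
have rm1 : ready m1 U by apply: ready_frame fr1 rm.
have rdm1 : red_matching m1 U by apply: red_matching_shrink fr1 _ rdm.
have [[[_ _ _ _ m28] [m29 _]] _ _ _] := rm1.
apply: (@vertex_loop_ok n _ (fun i m2 => exists U',
    [/\ ready m2 U', red_matching m2 U', U' \subset U &
      [/\ m2 18 = 0, U' = U, m2 19 = [exists v in U, v < i] :> nat &
          forall v, v \in U -> v < i -> right_holds_by EL ER U v = false] \/
      [/\ m2 18 = 1, #|U'| < #|U| & right_holds EL ER U = right_holds EL ER U']])
    (480 * (size eL + 1))) => //.
- move=> i m2 m3 fr23 [U' [rm2 rdm2 sU' res]]; exists U'; rewrite !(regs_frame fr23) //; split=> //.
    exact: ready_frame fr23 rm2.
  by apply: red_matching_shrink fr23 _ rdm2.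
- move=> v m2 [U' [rm2 rdm2 sU' res]] m2_21.
  have hUU' : right_holds EL ER U = right_holds EL ER U' by case: res => [[_ -> _ _]|[_ _ ->]].
  have HF' m' : m' 0 = 0 -> right_holds EL ER U' -> F m' by rewrite -hUU'; apply: HF.
  apply: ok_weaken (try_vertex_ok uL uR rm2 m2_21 (no_loopS sU' nlL) (no_loopS sU' nlR) rdm2 HF'
    (leqnn _)) (leqnn _) _.
  move=> m3 [U'' [rm3 rdm3 sU'' [m3_20 m3_21] res3]]; split=> //.
  exists U''; split=> //; first exact: subset_trans sU'' sU'.
  case: res => [[m2_18 eU m2_19 nh]|[m2_18 cU h]].
    rewrite eU in res3; case: ifP res3 => [vU|vU] res3.
      have [m3_19 [[m3_18 eU'' nhv]|[m3_18 cU'' h'']]] := res3; last by right.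
      left; split=> //; first by rewrite m3_18.
        rewrite m3_19; case: existsP => // -[]; exists v; by rewrite vU ltnS leqnn.
      move=> u uU; rewrite ltnS leq_eqVlt => /orP[/eqP/val_inj->//|].
      exact: nh.
    have [m3_18 m3_19 eU''] := res3; left; split=> //; first by rewrite m3_18.
      rewrite m3_19 m2_19; congr nat_of_bool; apply: eq_existsb => u.
      case uU: (u \in U) => //=; rewrite ltnS [u <= v]leq_eqVlt.
      by rewrite val_eqE; have [e|_] := eqVneq u v; first by rewrite e vU in uU.
    move=> u uU; rewrite ltnS leq_eqVlt => /orP[/eqP/val_inj e|]; first by rewrite e vU in uU.
    exact: nh.
  right; case: ifP res3 => _ res3.
    have [_ [[-> -> _]|[-> cU'' <-]]] := res3; first by [].
    by split=> //; apply: ltn_trans cU.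
  by have [-> _ ->] := res3.
- exists U; split=> //; left; split=> //.
  by rewrite /m1; mem_reads; case: existsP => // -[v]; rewrite andbF.
- move=> m2 [U' [rm2 rdm2 sU' res]]; exists U'; split=> //.
  case: res => [[m2_18 eU m2_19 nh]|]; last by right.
  left; split=> //; rewrite m2_19 right_holdsE negb_or -[U != set0]/(~~ (U == set0)).
  congr nat_of_bool; apply/existsP/andP => [[v /andP[vU _]]|[/set0Pn[v vU] _]]; last first.
    by exists v; rewrite vU ltn_ord.
  split; first by apply/set0Pn; exists v.
  by apply/exists_inPn=> u uU; rewrite nh.
- have : n * (480 * (size eL + 1) + 9) <= n * (500 * (size eL + 1)).
    by rewrite leq_mul2l; apply/orP; right; clear; lia.
  by move: le_T; move: (n * _) (n * (480 * _ + 9)); clear; lia.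
Qed.

(** A second red neighbour anywhere settles the game for Right. The search therefore starts only
    from a red matching, with mates built once. *)
Definition free_move : cmd :=
  build_mates ;;
  vertex_loop 3 4 (Blk (get 7 4 3) ;; If 7 Halt (Blk [::])) ;;
  Blk [:: Clr 18; Inc 18] ;; While 18 pass ;; Blk [:: Mov 0 19].

Lemma free_move_ok F m U T :
  ready m U -> no_loop eL U -> no_loop eR U ->
  (forall m', m' 0 = 0 -> right_holds EL ER U -> F m') ->
  (forall m', m' 0 = ~~ right_holds EL ER U -> F m') ->
  (n + 1) * (n * (500 * (size eL + 1)) + 10) + 100 * (n + size eR + 1) + n * 20 + 20 <= T ->
  ok F free_move m T F.
Proof.
move=> rm nlL nlR HF0 HF le_T; have [st al sm z] := rm.
set P := n * (500 * (size eL + 1)) + 5.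
apply: (@ok_seq _ _ _ _ _ (100 * (n + size eR + 1)) ((n + 1) * (P + 5) + n * 20 + 20)); last first.
  move: le_T; rewrite /P -addnA; clear; lia.
apply: ok_weaken (build_mates_ok F st al (leqnn _)) (leqnn _) _ => m1 [fr1 mk1].
have ri1 := mates_red_info uR nlR mk1.
have rm1 : ready m1 U by apply: ready_frame fr1 rm.
have [[[_ _ _ _ m28] [m29 _]] _ _ m1_0] := rm1.
apply: (@ok_seq _ _ _ _ _ (n * 20 + 3) ((n + 1) * (P + 5) + 17)); last first.
  by clear; lia.
apply: (@vertex_loop_ok n _ (fun i m2 => frame n [:: 1; 3; 4; 7] [::] m1 m2 /\
   forall v, v < i -> m1 (field v 3) = 0) 11) => //.
- move=> i m2 m3 fr23 [fr2 z2]; split=> //.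
  by apply: frame_trans fr2 _; apply: frame_sub fr23.
- move=> v m2 [fr2 z2] m2_4.
  apply: (@ok_blk_seq _ 5) => //; rewrite (run_get _ _ m2_4) (field_frame _ fr2) //.
  set m3 := upd _ 7 _.
  have fr23 : frame n [:: 1; 7] [::] m2 m3 by rewrite /m3; frame_tac.
  have m3_7 : m3 7 = m1 (field v 3) by rewrite /m3; mem_reads.
  apply: ok_if => //; rewrite m3_7 => v3.
    apply: ok_halt => //; apply: HF0.
      by rewrite (regs_frame fr23) // (regs_frame fr2).
    have vU : v \in U by apply: contraR v3 => vU; have [_ ->] := mk1 v; rewrite (negbTE vU).
    by have [H _] := ri1 v vU; apply: (right_holds_by_sub vU); apply/right_holds_by_two/H.
  apply: (@ok_blk _ 0) => //; run_tac; rewrite !(regs_frame fr23) //; split=> //.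
  split; first by apply: frame_trans fr2 _; apply: frame_sub fr23.
  by move=> u; rewrite ltnS leq_eqVlt => /orP[/eqP/val_inj->//|]; apply: z2.
move=> m2 [fr2 z2].
have rm2 : ready m2 U by apply: ready_frame fr2 rm1.
have rdm2 : red_matching m2 U.
  split; first by apply: red_info_frame fr2 ri1.
  by move=> w wU; rewrite (field_frame _ fr2) // z2.
apply: (@ok_blk_seq _ 2) => //; first by clear; lia.
run_tac; set m3 := upd m2 18 1.
have -> : upd (upd m2 18 0) 18 1 = m3 by rewrite upd_upd.
have fr23 : frame n [:: 18] [::] m2 m3 by rewrite /m3; frame_tac.
apply: (@ok_seq _ _ _ _ _ ((n + 1) * (P + 5) + 1) 1); last by clear; lia.
have cU : #|U| <= n by rewrite -[X in _ <= X]card_ord max_card.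
apply: (@ok_weaken _ _ _ ((#|U| + 1) * (P + 5) + 1) _
  (fun m' => m' 19 = ~~ right_holds EL ER U)); last first.
- by move=> m4 m4_19; apply: (@ok_blk _ 1) => //; run_tac; apply: HF; mem_reads; rewrite m4_19.
- by rewrite leq_add2r leq_mul2r leq_add2r cU orbT.
apply: (@ok_while _ (fun B m4 => (m4 18 = 0 /\ 0 < B /\ m4 19 = ~~ right_holds EL ER U) \/
   exists U', [/\ ready m4 U', red_matching m4 U', U' \subset U, m4 18 = 1 &
     right_holds EL ER U = right_holds EL ER U' /\ (#|U'| + 1) * (P + 5) + 1 <= B])).
- move=> B m4 [[-> //]|[U' [rm4 rdm4 sU' m4_18 [hU le_B]]]] _.
  have le_B' : #|U'| * (P + 5) + 1 <= B - (P + 2).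
    by move: le_B; rewrite mulnDl; move: (#|U'| * _); clear; lia.
  exists P, (B - (P + 2)); split; first by move: le_B; rewrite mulnDl; clear; lia.
  have HF' m' : m' 0 = 0 -> right_holds EL ER U' -> F m' by rewrite -hU; apply: HF0.
  apply: ok_weaken (pass_ok rm4 (no_loopS sU' nlL) (no_loopS sU' nlR) rdm4 HF' (leqnn _)) (leqnn
    _) _.
  move=> m5 [U'' [rm5 rdm5 sU'' res]].
  case: res => [[m5_18 _ m5_19]|[m5_18 cU'' h]].
    by left; rewrite hU; split=> //; split=> //; apply: leq_trans le_B'; rewrite addn1.
  right; exists U''; split=> //; first exact: subset_trans sU'' sU'.
  split; first by rewrite hU.
  by apply: leq_trans le_B'; rewrite leq_add2r leq_mul2r addn1 cU'' orbT.
- move=> B m4 [[_ [B0 h]] _|[U' [_ _ _ -> _]]] //; by split.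
- right; exists U; split=> //.
  + exact: ready_frame fr23 rm2.
Qed.
End FreeMove.

(** * Detecting singleton edges *)

Section FindSingletons.

Variables (n : nat) (eL eR : seq ('I_n * 'I_n)).
Implicit Types (s : seq ('I_n * 'I_n)) (U : {set 'I_n}) (v w x y : 'I_n) (m : regs).

Local Notation top := (30 + 6 * n).
Local Notation eL0 := (top + 4).
Local Notation eR0 := (top + 4 + 2 * size eL).
Local Notation statics := (statics eL eR).

Hypotheses (uL : uniq (edge_sets eL)) (uR : uniq (edge_sets eR)).
Local Notation EL := (edgeset eL).
Local Notation ER := (edgeset eR).
Local Notation red_info := (red_info eR).
Local Notation ready := (ready eL eR).
(** The machine has no equality test: the ends of an edge are compared by stamping one, reading the
    stamp of the other, and wiping. *)
Definition find_singletons cr pr : cmd :=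
  Blk [:: Clr 10; Clr 11] ;;
  edge_loop cr pr
    (Blk [:: Clr 7, Inc 7 & put 5 1 7 ++ get 7 6 1 ++ Clr 8 :: put 5 1 8] ;;
     If 7 (Blk [:: Mov 11 10; Mov 10 5]) (Blk [::])).

Lemma find_singletons_ok F m U s p cr pr T :
  ready m U -> 10 < cr -> 10 < pr -> m cr = size s -> m pr = p ->
  cr < 30 -> pr < 30 -> (cr == 11) = false -> (pr == 11) = false ->
  edges_at m p s -> top <= p -> uniq (edge_sets s) ->
  60 * (size s + 1) <= T ->
  ok F (find_singletons cr pr) m T (fun m' =>
    frame n [:: 1; 3; 4; 5; 6; 7; 8; 10; 11] [::] m m' /\
    first_two (singletons (edgeset s)) (m' 10) (m' 11)).
Proof.
move=> rm cr10 pr10 mcr mpr cr30 pr30 cr11 pr11 es p_top us le_T.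
have [st al sm z] := rm; set L := [:: 1; 3; 4; 5; 6; 7; 8; 10; 11].
apply: (@ok_blk_seq _ 2) => //; first by move: le_T; clear; lia.
run_tac; set m1 := upd _ 11 _.
have fr1 : frame n L [::] m m1 by rewrite /m1; frame_tac.
have m1_cr : m1 cr = m cr.
  by rewrite /m1 !upd_ne //; apply/negbTE; move: cr10; clear; lia.
have m1_pr : m1 pr = m pr.
  by rewrite /m1 !upd_ne //; apply/negbTE; move: pr10; clear; lia.
pose loops s1 : seq 'I_n := rev [seq e.1 | e <- s1 & e.1 == e.2].
apply: (@edge_loop_ok n _ (fun s1 m2 => [/\ frame n L [::] m m2,
   m2 10 = nth 0 [seq vptr v | v : 'I_n <- loops s1] 0 &
   m2 11 = nth 0 [seq vptr v | v : 'I_n <- loops s1] 1]) s p 24) => //.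
- by move=> s1 m2 [fr2 _ _]; apply: edges_at_frame fr2 _.
- move=> s1 m2 m3 fr23 [fr2 e10 e11]; split; rewrite ?(regs_frame fr23) //.
  by apply: frame_trans fr2 _; apply: frame_sub fr23.
- move=> s1 e m2 [fr2 e10 e11] m5 m6.
  have sm2 v : m2 (field v 1) = 0 by rewrite (field_frame _ fr2) // sm.
  apply: (@ok_blk_seq _ 12) => //.
  run_tac; run_put e.1; run_get e.2; run_tac.
  rewrite (@run_put _ _ _ _ e.1) //; mem_reads; set m3 := upd _ (field e.1 1) 0.
  have m3_7 : m3 7 = (e.1 == e.2).
    by rewrite /m3; mem_reads; have [<-|/negbTE e12] := eqVneq e.1 e.2; mem_reads; rewrite ?sm2.
  have fr23 : frame n L [::] m2 m3.
    apply: (@frame_restore _ _ 1); first by rewrite /m3; frame_tac.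
    move=> v; rewrite /m3; have [->|/negbTE ve] := eqVneq v e.1; mem_reads; rewrite ?sm2 //.
  have keep r : r \in [:: 3; 4; 5; 10; 11] -> m3 r = m2 r.
    by rewrite !inE => /or4P[|||/orP[]] /eqP->; rewrite /m3; mem_reads.
  have fr3 : frame n L [::] m m3 by apply: frame_trans fr2 fr23.
  have loopsE : loops (rcons s1 e) = if e.1 == e.2 then e.1 :: loops s1 else loops s1.
    by rewrite /loops filter_rcons; case: ifP => // _; rewrite map_rcons rev_rcons.
  apply: ok_if => //; rewrite m3_7 => e12.
    apply: (@ok_blk _ 2) => //; run_tac; rewrite !keep // loopsE.
    have -> : e.1 == e.2 by case: (e.1 == e.2) e12.
    split=> //; split.
    + by apply: frame_trans fr3 _; frame_tac.
    + by mem_reads.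
    + by mem_reads; rewrite e10.
  apply: (@ok_blk _ 0) => //; run_tac; rewrite !keep // loopsE.
  by have -> : (e.1 == e.2) = false by case: (e.1 == e.2) e12.
- by rewrite m1_cr.
- by rewrite m1_pr.
- by move: pr10; clear; lia.
- by move: p_top; clear; lia.
- move=> m2 [fr2 e10 e11]; split=> //; rewrite e10 e11; apply: first_twoP.
    rewrite rev_uniq map_inj_in_uniq.
      by rewrite filter_uniq //; apply: map_uniq us.
    move=> [a b] [a' b']; rewrite !mem_filter /= => /andP[/eqP-> _] /andP[/eqP-> _].
    by move=> ->.
  move=> v; rewrite mem_rev inE edgesetE; apply/mapP/mapP => [[[a b]]|[[a b] es' /= vab]].
    rewrite mem_filter /= => /andP[/eqP-> bs] ->.
    by exists (b, b); rewrite //= setUid.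
  exists (a, b); rewrite //= ?mem_filter /=.
    have av : a = v by apply/set1P; rewrite vab set21.
    have bv : b = v by apply/set1P; rewrite vab set22.
    by rewrite es' andbT av bv.
  by apply/esym/set1P; rewrite vab set21.
- by move: le_T; clear; lia.
Qed.
End FindSingletons.

(** * The decision procedures for both starting players *)

Section Decision.

Variables (n : nat) (eL eR : seq ('I_n * 'I_n)).
Implicit Types (s : seq ('I_n * 'I_n)) (U : {set 'I_n}) (v w x y : 'I_n) (m : regs).

Local Notation top := (30 + 6 * n).
Local Notation eL0 := (top + 4).
Local Notation eR0 := (top + 4 + 2 * size eL).
Local Notation statics := (statics eL eR).

Hypotheses (uL : uniq (edge_sets eL)) (uR : uniq (edge_sets eR)).
Local Notation EL := (edgeset eL).
Local Notation ER := (edgeset eR).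
Local Notation red_info := (red_info eR).
Local Notation ready := (ready eL eR).
Definition answer_left : cmd := Blk [:: Clr 0; Inc 0].

Definition forced_move : cmd :=
  Blk [:: Mov 13 10] ;; chain build_mates ;; If 15 free_move answer_left.

Definition chain_time := (2 * size eL + 1) * (100 * (n + size eR + 1) + 120) + 100 * (size eL + 3).

Definition free_time :=
  (n + 1) * (n * (500 * (size eL + 1)) + 10) + 100 * (n + size eR + 1) + n * 20 + 20.

Lemma forced_move_ok F m U w T :
  ready m U -> w \in U -> m 10 = vptr w -> no_loop eL (U :\ w) -> no_loop eR U ->
  (forall m', m' 0 = ~~ right_holds_by EL ER U w -> F m') ->
  chain_time + free_time + 10 <= T ->
  ok F forced_move m T F.
Proof.
move=> rm wU m10 nlL nlR HF le_T.
apply: (@ok_blk_seq _ 1) => //; first by move: le_T; clear; lia.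
run_tac; rewrite m10; set m1 := upd _ 13 _.
have fr1 : frame n [:: 13] [::] m m1 by rewrite /m1; frame_tac.
have rm1 : ready m1 U by apply: ready_frame fr1 rm.
have m1_13 : m1 13 = vptr w by rewrite /m1; mem_reads.
(* Nothing about red mates is carried from turn to turn, since they are rebuilt before every
   exchange. *)
pose inv (m : regs) (U : {set 'I_n}) := True.
have bm_ok m' U' : ready m' U' -> inv m' U' -> no_loop eR U' ->
    ok F build_mates m' (100 * (n + size eR + 1)) (fun m'' =>
      [/\ frame n [:: 1; 3; 4; 5; 6; 7] [:: 2; 3] m' m'', inv m'' U' & red_info m'' U']).
  move=> [st' al' _ _] _ nl'; apply: ok_weaken (build_mates_ok F st' al' (leqnn _)) (leqnn _) _.
  by move=> m'' [fr mk]; split=> //; apply: mates_red_info.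
have HF0 m' : m' 0 = 0 -> right_holds_by EL ER U w -> F m'.
  by move=> m'0 h; apply: HF; rewrite h.
apply: (@ok_seq _ _ _ _ _ chain_time (free_time + 9)); last by move: le_T; clear; lia.
apply: ok_weaken (chain_ok (inv := inv) (fs := [:: 2; 3]) uL uR isT bm_ok _ rm1 wU m1_13 nlL nlR
  I HF0 (leqnn _)) (leqnn _) _ => //.
move=> m2 [U' [l [[rm2 sU' fr12 _] _ _ _ out]]].
case: out => [[m2_15 nh]|[m2_15 h sUw _]].
  apply: ok_if; first by rewrite m2_15.
    move=> _; apply: (@ok_blk _ 2) => //; first by clear; lia.
    by run_tac; apply: HF; mem_reads; rewrite nh.
  by clear; lia.
apply: ok_if; last by clear; lia.
  move=> _; apply: (@free_move_ok _ _ _ uL uR _ _ U') => //.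
  - exact: no_loopS sUw nlL.
  - exact: no_loopS sU' nlR.
  - by move=> m'; rewrite -h; apply: HF0.
  - by move=> m'; rewrite -h; apply: HF.
  - by rewrite -/free_time; clear; lia.
by rewrite m2_15.
Qed.

(** The mover's own singletons are looked for first, since completing one wins before any opposing
    threat counts; [decide_right] swaps the two searches accordingly. *)
Definition decide_left : cmd :=
  find_singletons 24 26 ;; If 10 (answer_left ;; Halt) (Blk [::]) ;;
  find_singletons 25 27 ;; If 11 Halt (Blk [::]) ;;
  If 10
    (Blk (Mov 14 10 :: kill 14) ;; scan 14 ;;
     If 11 (answer_left ;; Halt) (Blk [::]) ;;
     If 10 forced_move free_move)
    (matching_test ;; If 17 answer_left (Blk [::])).

Definition decide_right : cmd :=
  find_singletons 25 27 ;; If 10 Halt (Blk [::]) ;;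
  find_singletons 24 26 ;; If 11 (answer_left ;; Halt) (Blk [::]) ;;
  If 10 forced_move free_move.

Definition decide_time :=
  200 * (size eL + size eR + 2) + chain_time + free_time + 100.

Lemma no_loop_singletons s U : singletons (edgeset s) :&: U = set0 -> no_loop s U.
Proof.
move=> e v vU; apply/negP=> ve.
have : v \in singletons (edgeset s) :&: U by rewrite inE vU andbT inE.
by rewrite e inE.
Qed.

Lemma first_two_gt0 (A : {set 'I_n}) p q : first_two A p q -> (p != 0 -> exists v, v \in A).
Proof.
case=> [->//|x ->|p' q' c _ _] _; first by exists x; rewrite inE.
by apply/set0Pn; rewrite -card_gt0; apply: ltnW.
Qed.

Lemma ok_exit_left F r m T (Q : regs -> Prop) :
  (m r != 0 -> forall m', m' 0 = 1 -> F m') -> (m r = 0 -> Q m) -> 5 <= T ->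
  ok F (If r (answer_left ;; Halt) (Blk [::])) m T Q.
Proof.
move=> HF HQ le_T; apply: ok_if => [mr|mr|]; last by move: le_T; clear; lia.
  apply: (@ok_blk_seq _ 2) => //; first by move: le_T; clear; lia.
  run_tac; apply: ok_halt; first by move: le_T; clear; lia.
  by apply: HF => //; mem_reads.
by apply: (@ok_blk _ 0) => //; run_tac; apply: HQ.
Qed.

Lemma ok_exit F r m T (Q : regs -> Prop) :
  (m r != 0 -> F m) -> (m r = 0 -> Q m) -> 3 <= T -> ok F (If r Halt (Blk [::])) m T Q.
Proof.
move=> HF HQ le_T; apply: ok_if => [mr|mr|]; last by move: le_T; clear; lia.
  by apply: ok_halt; [move: le_T; clear; lia | apply: HF].
by apply: (@ok_blk _ 0) => //; run_tac; apply: HQ.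
Qed.

Lemma decide_left_ok m T :
  ready m setT -> decide_time <= T ->
  let F m' := m' 0 = left_wins EL ER true in ok F decide_left m T F.
Proof.
move=> rm le_T F; have [st al sm m0] := rm.
have [[m24 m25 m26 m27 m28] [m29 [eoL eoR ad]]] := st.
have FE m' b : m' 0 = nat_of_bool b ->
    threat_game EL ER #|[set: 'I_n]| setT (singletons EL) (singletons ER) true = b -> F m'.
  by move=> e1 e2; rewrite /F left_wins_play ?e2 //; apply: edgeset_small.
have topL : top <= eL0 by clear; lia.
have topR : top <= eR0 by clear; lia.
set R := 10 * (2 * size eL + 1) + 100 * (size eL + 1) + chain_time + free_time + 50.
apply: (@ok_seq _ _ _ _ _ (60 * (size eL + 1)) (60 * (size eR + 1) + R + 10)); last first.
  by move: le_T; rewrite /decide_time /R; clear; lia.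
apply: ok_weaken (find_singletons_ok (cr := 24) (pr := 26) F rm isT isT m24 m26 isT isT erefl
  erefl eoL topL uL (leqnn _)) (leqnn _) _.
move=> m1 [fr1 ft1].
have rm1 : ready m1 setT by apply: ready_frame fr1 rm.
apply: (@ok_seq _ _ _ _ _ 5 (60 * (size eR + 1) + R + 5)); last by clear; lia.
apply: ok_exit_left => // m1_10.
  move=> m' e; apply: (FE m' true) => //.
  by have [v vL] := first_two_gt0 ft1 m1_10; apply: play_left_threat (in_setT v) vL.
have SL0 : singletons EL = set0 by case: ft1 m1_10 => [//|x _ //|p q _ /eqP].
rewrite SL0 in FE.
have nlL U : no_loop eL U by apply: no_loop_singletons; rewrite SL0 set0I.
apply: (@ok_seq _ _ _ _ _ (60 * (size eR + 1)) (R + 5)); last by clear; lia.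
have m1_25 : m1 25 = size eR by rewrite (regs_frame fr1).
have m1_27 : m1 27 = eR0 by rewrite (regs_frame fr1).
have eoR1 : edges_at m1 eR0 eR by case: rm1 => [[_ [_ []]]].
apply: ok_weaken (find_singletons_ok (cr := 25) (pr := 27) F rm1 isT isT m1_25 m1_27 isT isT
  erefl erefl eoR1 topR uR (leqnn _)) (leqnn _) _.
move=> m2 [fr2 ft2].
have rm2 : ready m2 setT by apply: ready_frame fr2 rm1.
have [st2 al2 sm2 m2_0] := rm2.
apply: (@ok_seq _ _ _ _ _ 3 (R + 2)); last by clear; lia.
apply: ok_exit => // m2_11.
  apply: (FE m2 false); first by rewrite m2_0.
  by apply: play_left_two_threats => //; case: ft2 m2_11.
apply: ok_if => [m2_10|m2_10|]; last by rewrite /R; clear; lia.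
  have [u [uE m2_10u]] : exists u, singletons ER = [set u] /\ m2 10 = vptr u.
    by case: ft2 m2_10 m2_11 => [//|u e|p q _ _ /eqP q0 _ //]; exists u.
  have nlR : no_loop eR (setT :\ u).
    by apply: no_loop_singletons; rewrite uE; apply/setP=> z; rewrite !inE andbT andbN.
  rewrite uE in FE.
  apply: (@ok_blk_seq _ 11) => //; first by rewrite /R; clear; lia.
  run_tac; rewrite m2_10u; set m3 := upd m2 14 _.
  have fr23 : frame n [:: 14] [::] m2 m3 by rewrite /m3; frame_tac.
  have rm3 : ready m3 setT by apply: ready_frame fr23 rm2.
  have m3_14 : m3 14 = vptr u by rewrite /m3; mem_reads.
  have := ready_kill (r := 14) isT isT m3_14 rm3; move: (run_block _ m3) => m4.
  case=> fr34 rm4 _.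
  have [st4 al4 sm4 m4_0] := rm4.
  have m4_14 : m4 14 = vptr u by rewrite (regs_frame fr34).
  have wu : size (adjacents eL u) <= 2 * size eL := size_adjacents eL u.
  apply: (@ok_seq _ _ _ _ _ (10 * (size (adjacents eL u) + 1)) (chain_time + free_time + 20));
    last first.
    by move: wu; rewrite /R; clear; lia.
  apply: ok_weaken (scan_nbr_ok uL uR F st4 al4 m4_14 (nlL setT u (in_setT u)) (leqnn _)) (leqnn
    _) _.
  move=> m5 [fr45 ft5].
  have rm5 : ready m5 (setT :\ u) by apply: ready_frame fr45 rm4.
  set V := setT :\ u in rm5 ft5 nlR rm4 al4.
  (* After the forced block at [u] it is Right's turn and Left threatens the blue neighbours of [u]:
     several win, one forces Right, none leaves Right a free move. *)
  have gameE b : threat_game EL ER #|V| V (nbr EL V u) set0 false = b ->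
     threat_game EL ER #|[set: 'I_n]| setT set0 [set u] true = b.
    by move=> <-; rewrite play_left_forced ?inE // nbr_D1.
  apply: (@ok_seq _ _ _ _ _ 5 (chain_time + free_time + 15)); last by clear; lia.
  apply: ok_exit_left => // m5_11.
    move=> m' e; apply: (FE m' true) => //; apply: gameE.
    by apply: play_right_two_threats => //; [apply: nbr_sub | case: ft5 m5_11].
  apply: ok_if => [m5_10|m5_10|]; last by clear; lia.
    have [x [xE m5_10x]] : exists x, nbr EL V u = [set x] /\ m5 10 = vptr x.
      by case: ft5 m5_10 m5_11 => [//|x e|p q _ _ /eqP q0 _ //]; exists x.
    have xV : x \in V by apply: (subsetP (nbr_sub EL V u)); rewrite xE inE.
    apply: (forced_move_ok rm5 xV m5_10x (nlL _) nlR); last by clear; lia.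
    move=> m' e; apply: (FE m' (~~ right_holds_by EL ER V x)) => //; apply: gameE.
    by rewrite xE play_right_forced // negbK.
  have N0 : nbr EL V u = set0.
    by case: ft5 m5_10 m5_11 => [//|x e|p q _ /eqP p0 _ //].
  apply: (free_move_ok uL uR rm5 (nlL _) nlR).
  - move=> m' e h; apply: (FE m' false) => //; apply: gameE; rewrite N0.
    by apply/negbTE.
  - move=> m' e; apply: (FE m' (~~ right_holds EL ER V)) => //; apply: gameE.
    by rewrite N0 negbK.
  - by rewrite -/free_time; clear; lia.
have SR0 : singletons ER = set0.
  by case: ft2 m2_10 m2_11 => [//|x e|p q _ /eqP p0 _ //].
rewrite SR0 in FE.
apply: (@ok_seq _ _ _ _ _ (100 * (size eL + 1)) 8); last by rewrite /R; clear; lia.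
apply: ok_weaken (matching_test_ok F st2 al2 sm2 (leqnn _)) (leqnn _) _ => m3 [fr3].
rewrite (uniq_alive_ends uL (nlL _)) -(play_left_quiet _ ER) => m3_17.
apply: ok_if => [m317|m317|] //; rewrite ?m317 in m3_17.
  apply: (@ok_blk _ 2) => //; run_tac.
  by apply: (FE _ true) => //; mem_reads.
apply: (@ok_blk _ 0) => //; run_tac; apply: (FE _ false) => //.
by rewrite (regs_frame fr3).
Qed.

Lemma decide_right_ok m T :
  ready m setT -> decide_time <= T ->
  let F m' := m' 0 = left_wins EL ER false in ok F decide_right m T F.
Proof.
move=> rm le_T F; have [st al sm m0] := rm.
have [[m24 m25 m26 m27 m28] [m29 [eoL eoR ad]]] := st.
have FE m' b : m' 0 = nat_of_bool b ->
    threat_game EL ER #|[set: 'I_n]| setT (singletons EL) (singletons ER) false = b -> F m'.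
  by move=> e1 e2; rewrite /F left_wins_play ?e2 //; apply: edgeset_small.
have topL : top <= eL0 by clear; lia.
have topR : top <= eR0 by clear; lia.
set R := chain_time + free_time + 50.
apply: (@ok_seq _ _ _ _ _ (60 * (size eR + 1)) (60 * (size eL + 1) + R + 10)); last first.
  by move: le_T; rewrite /decide_time /R; clear; lia.
apply: ok_weaken (find_singletons_ok (cr := 25) (pr := 27) F rm isT isT m25 m27 isT isT erefl
  erefl eoR topR uR (leqnn _)) (leqnn _) _.
move=> m1 [fr1 ft1].
have rm1 : ready m1 setT by apply: ready_frame fr1 rm.
apply: (@ok_seq _ _ _ _ _ 5 (60 * (size eL + 1) + R + 5)); last by clear; lia.
apply: ok_exit => // m1_10.
  apply: (FE m1 false); first by case: rm1.
  by have [v vR] := first_two_gt0 ft1 m1_10; apply: play_right_threat (in_setT v) vR.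
have SR0 : singletons ER = set0 by case: ft1 m1_10 => [//|x _ //|p q _ /eqP].
rewrite SR0 in FE.
have nlR U : no_loop eR U by apply: no_loop_singletons; rewrite SR0 set0I.
apply: (@ok_seq _ _ _ _ _ (60 * (size eL + 1)) (R + 5)); last by clear; lia.
have m1_24 : m1 24 = size eL by rewrite (regs_frame fr1).
have m1_26 : m1 26 = eL0 by rewrite (regs_frame fr1).
have eoL1 : edges_at m1 eL0 eL by case: rm1 => [[_ [_ []]]].
apply: ok_weaken (find_singletons_ok (cr := 24) (pr := 26) F rm1 isT isT m1_24 m1_26 isT isT
  erefl erefl eoL1 topL uL (leqnn _)) (leqnn _) _.
move=> m2 [fr2 ft2].
have rm2 : ready m2 setT by apply: ready_frame fr2 rm1.
apply: (@ok_seq _ _ _ _ _ 5 R); last by clear; lia.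
apply: ok_exit_left => // m2_11.
  move=> m' e; apply: (FE m' true) => //.
  by apply: play_right_two_threats => //; case: ft2 m2_11.
apply: ok_if => [m2_10|m2_10|]; last by rewrite /R; clear; lia.
  have [u [uE m2_10u]] : exists u, singletons EL = [set u] /\ m2 10 = vptr u.
    by case: ft2 m2_10 m2_11 => [//|u e|p q _ _ /eqP q0 _ //]; exists u.
  (* The singleton edge at [u] is still in [eL], but harmless once Right has picked [u]. Hence
     [forced_move_ok] excludes blue singletons only off the first pick. *)
  have nlL : no_loop eL (setT :\ u).
    by apply: no_loop_singletons; rewrite uE; apply/setP=> z; rewrite !inE andbT andbN.
  rewrite uE in FE.
  apply: (forced_move_ok rm2 (in_setT u) m2_10u nlL (nlR _)); last by rewrite /R; clear; lia.
  move=> m' e; apply: (FE m' (~~ right_holds_by EL ER setT u)) => //.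
  by rewrite play_right_forced ?inE // negbK.
have SL0 : singletons EL = set0.
  by case: ft2 m2_10 m2_11 => [//|x e|p q _ /eqP p0 _ //].
rewrite SL0 in FE.
have nlL U : no_loop eL U by apply: no_loop_singletons; rewrite SL0 set0I.
apply: (free_move_ok uL uR rm2 (nlL _) (nlR _)).
- by move=> m' e h; apply: (FE m' false) => //; apply/negbTE.
- by move=> m' e; apply: (FE m' (~~ right_holds EL ER setT)) => //; rewrite negbK.
- by rewrite -/free_time /R; clear; lia.
Qed.
End Decision.

(** * Moving the input upwards *)

Section Relocation.

Variables n a b : nat.
Implicit Types m : regs.

Local Notation top := (30 + 6 * n).

(** With the four header registers as the only work space, finding the end of the input destroys
    [a]; just [n], [b] and the end address survive. *)
Definition locate_end : cmd :=
  Blk (Clr 3 :: incs 3 4) ;;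
  While 1 (Blk [:: Dec 1; Inc 3; Inc 3]) ;;
  While 2 (Blk [:: Dec 2; Inc 1; Inc 3; Inc 3]).

Lemma locate_end_ok F m T : m 0 = n -> m 1 = a -> m 2 = b -> 10 * (a + b + 1) <= T ->
  ok F locate_end m T (fun m' =>
    [/\ m' 0 = n, m' 1 = b, m' 2 = 0, m' 3 = 4 + 2 * (a + b) & forall j, 4 <= j -> m' j = m j]).
Proof.
move=> m0 m1 m2 le_T.
apply: (@ok_blk_seq _ 5) => //; first by lia.
rewrite run_block_cons effectE run_incs upd_upd; mem_reads; set p0 := upd _ 3 _.
apply: (@ok_seq _ _ _ _ _ (a * 5 + 1) (b * 6 + 1)); last by lia.
apply: (@ok_for _ (fun i p => [/\ p 0 = n, p 2 = b, p 3 = 4 + 2 * i &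
    forall j, 4 <= j -> p j = m j]) a 3) => //.
- move=> i p _ [p0' p2 p3 pj] p1; apply: (@ok_blk _ 3) => //; run_tac.
  rewrite p1; split; last by lia.
  by split=> //; [lia | move=> j j4; mem_reads; apply: pj].
- by split; rewrite /p0; mem_reads => // j j4; mem_reads.
move=> p1 [p1_0 p1_2 p1_3 pj] p1_1.
apply: (@ok_for _ (fun i p => [/\ p 0 = n, p 1 = i, p 3 = 4 + 2 * a + 2 * i &
    forall j, 4 <= j -> p j = m j]) b 4) => //.
- move=> i p _ [q0 q1 q3 qj] q2; apply: (@ok_blk _ 4) => //; run_tac.
  rewrite q2 q1; split; last by lia.
  by split=> //; [lia | move=> j j4; mem_reads; apply: qj].
- by split=> //; rewrite p1_3 muln0 addn0.
- by move=> q [q0 q1 q3 qj] q2; split=> //; lia.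
Qed.

(** The surviving header is parked behind the input and moves along with it. The copy runs from the
    last cell downwards, because source and target may overlap. Cells 0 to 3 are copied too, as
    garbage, so that the loop can stop at zero. *)
Definition move_input : cmd :=
  Blk [:: StoreI 3 0, Mov 2 3, Inc 3, StoreI 3 1, Inc 3, StoreI 3 2, Inc 3, Mov 2 3
        & incs 2 30] ;;
  While 0 (Blk (Dec 0 :: incs 2 6)) ;;
  Blk [:: Mov 1 2] ;;
  While 3 (Blk [:: Dec 3; Dec 2; LoadI 0 3; StoreI 2 0]).

Lemma move_input_ok F m T e : m 0 = n -> m 1 = b -> m 3 = e -> 4 <= e ->
  10 * (n + e + 10) <= T ->
  ok F move_input m T (fun m' =>
    [/\ m' 1 = top + e + 3, m' 2 = top, m' (top + e) = n, m' (top + e + 1) = b &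
        m' (top + e + 2) = e] /\
    forall j, 4 <= j < e -> m' (top + j) = m j).
Proof.
move=> m0 m1 m3 e4 le_T.
apply: (@ok_blk_seq _ 38) => //; first by lia.
run_tac; rewrite m3; mem_reads; rewrite m0 m1 run_incs; mem_reads.
set q0 := upd _ 2 _.
have q0w j : 4 <= j < e -> q0 j = m j by move=> je; rewrite /q0; mem_reads.
have q0e0 : q0 e = n by rewrite /q0; mem_reads.
have q0e1 : q0 e.+1 = b by rewrite /q0; mem_reads.
have q0e2 : q0 e.+2 = e by rewrite /q0; mem_reads.
have q0_0 : q0 0 = n by rewrite /q0; mem_reads.
have q0_2 : q0 2 = e.+3 + 30 by rewrite /q0; mem_reads.
have q0_3 : q0 3 = e.+3 by rewrite /q0; mem_reads.
move: q0 q0w q0e0 q0e1 q0e2 q0_0 q0_2 q0_3 => q0 q0w q0e0 q0e1 q0e2 q0_0 q0_2 q0_3.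
apply: (@ok_seq _ _ _ _ _ (n * 9 + 1) ((e + 3) * 6 + 2)); last by lia.
apply: (@ok_for _ (fun i p => [/\ p 2 = e.+3 + 30 + 6 * i, p 3 = e.+3 &
    forall j, 4 <= j -> p j = q0 j]) n 7) => //.
- move=> i p _ [p2 p3 pj] p0; apply: (@ok_blk _ 7) => //.
  rewrite run_block_cons effectE run_incs; mem_reads; rewrite p2 p0; split; last by lia.
  by split=> //; [lia | move=> j j4; mem_reads; apply: pj].
- by split=> //; rewrite q0_2 muln0 addn0.
move=> p1 [p1_2 p1_3 p1j] p1_0.
apply: (@ok_blk_seq _ 1) => //; first by lia.
run_tac; rewrite p1_2; set p2 := upd _ 1 _.
apply: (@ok_for _ (fun i p => [/\ p 1 = e.+3 + 30 + 6 * n, p 2 = e.+3 - i + top,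
    forall j, 4 <= j < e.+3 - i -> p j = q0 j &
    forall j, 4 <= j -> e.+3 - i <= j < e.+3 -> p (top + j) = q0 j]) e.+3 4) => //.
- move=> i p lt_i [p_1 p_2 plow phigh] p_3; apply: (@ok_blk _ 4) => //.
  run_tac; rewrite p_2 p_3; mem_reads.
  set k := (e.+3 - i).-1.
  rewrite (_ : (e.+3 - i + top).-1 = top + k); last by rewrite /k; lia.
  rewrite (_ : e.+3 - i.+1 = k); last by rewrite /k; lia.
  have kE : e.+3 - i = k.+1 by rewrite /k; lia.
  rewrite kE in plow phigh; set x := upd _ _ _ k.
  split; last by mem_reads.
  split; mem_reads => //; first by lia.
  + move=> j jk; rewrite upd_ne; last by move: jk; clear; lia.
    by mem_reads; apply: plow; lia.
  + move=> j j4 jk; case: (eqVneq j k) => [ejk|jnk].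
      by rewrite ejk in j4 *; rewrite upd_eq // /x; mem_reads; apply: plow; lia.
    rewrite upd_ne; last by move: jnk; clear; lia.
    by mem_reads; apply: phigh => //; lia.
- split; rewrite /p2; mem_reads => //; first by rewrite p1_2; lia.
  + by move=> j jk; mem_reads; apply: p1j; lia.
  + by move=> j j4 jk; lia.
- move=> p [p_1 p_2 _ phigh] _; rewrite subnn in p_2 phigh.
  split; last by move=> j je; rewrite phigh ?q0w //; lia.
  split=> //; first by rewrite p_1; lia.
  + by rewrite phigh ?q0e0 //; lia.
  + by rewrite -addnA phigh ?addn1 ?q0e1 //; lia.
  + by rewrite -addnA phigh ?addn2 ?q0e2 //; lia.
- by lia.
Qed.

(** Walks back over the parked header. The lost [a] is recovered by subtracting 2 from the input
    length [b] times and counting the pairs that remain. *)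
Definition read_header : cmd :=
  Blk ([:: Dec 1; LoadI 3 1; Dec 1; LoadI 25 1; Dec 1; LoadI 28 1; Mov 22 1; Mov 26 2] ++
       incs 26 4) ;;
  Blk [:: Dec 3; Dec 3; Dec 3; Dec 3; Mov 7 3; Mov 5 25; Mov 27 26; Clr 24] ;;
  Blk (Clr 29 :: incs 29 30) ;;
  While 5 (Blk [:: Dec 5; Dec 7; Dec 7]) ;;
  While 7 (Blk [:: Dec 7; Dec 7; Inc 24; Inc 27; Inc 27]).

Definition header_read m e p : Prop :=
  [/\ [/\ p 25 = b, p 26 = top + 4 & p 28 = n],
      p 29 = 30, p 3 = 2 * (a + b), p 22 = top + e & forall j, 30 <= j -> p j = m j].

Lemma read_header_ok F m T e : e = 4 + 2 * (a + b) ->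
  m 1 = top + e + 3 -> m 2 = top -> m (top + e) = n -> m (top + e + 1) = b ->
  m (top + e + 2) = e -> 10 * (a + b + 10) <= T ->
  ok F read_header m T (fun m' =>
    [/\ [/\ m' 24 = a, m' 25 = b, m' 26 = top + 4, m' 27 = top + 4 + 2 * a & m' 28 = n],
        m' 29 = 30, m' 3 = 2 * (a + b), m' 22 = top + e
      & forall j, 30 <= j -> m' j = m j]).
Proof.
move=> eE m1 m2 me0 me1 me2 le_T.
apply: (@ok_blk_seq _ 12) => //; first by lia.
rewrite run_block_cat; run_tac; rewrite m1.
rewrite (_ : (top + e + 3).-1 = top + e + 2); last by lia.
rewrite (_ : (top + e + 2).-1 = top + e + 1); last by lia.
rewrite (_ : (top + e + 1).-1 = top + e); last by lia.
mem_reads; rewrite me0 me1 me2 m2 run_incs; mem_reads; set q := upd _ 26 _.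
have q3 : q 3 = e by rewrite /q; mem_reads.
have q25 : q 25 = b by rewrite /q; mem_reads.
have q28 : q 28 = n by rewrite /q; mem_reads.
have q22 : q 22 = top + e by rewrite /q; mem_reads.
have q26 : q 26 = top + 4 by rewrite /q; mem_reads.
have qj j : 30 <= j -> q j = m j by move=> j30; rewrite /q; mem_reads.
move: q q3 q25 q28 q22 q26 qj => q q3 q25 q28 q22 q26 qj.
apply: (@ok_blk_seq _ 8) => //; first by lia.
run_tac; rewrite q3 q25 q26.
rewrite (_ : e.-1.-1.-1.-1 = 2 * (a + b)); last by lia.
set p := upd _ 24 0.
have p3 : p 3 = 2 * (a + b) by rewrite /p; mem_reads.
have p7 : p 7 = 2 * (a + b) by rewrite /p; mem_reads.
have p5 : p 5 = b by rewrite /p; mem_reads.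
have p24 : p 24 = 0 by rewrite /p; mem_reads.
have p25 : p 25 = b by rewrite /p; mem_reads.
have p26 : p 26 = top + 4 by rewrite /p; mem_reads.
have p27 : p 27 = top + 4 by rewrite /p; mem_reads.
have p28 : p 28 = n by rewrite /p; mem_reads.
have p22 : p 22 = top + e by rewrite /p; mem_reads.
have pj j : 30 <= j -> p j = m j by move=> j30; rewrite /p; mem_reads; apply: qj.
move: p p3 p7 p5 p24 p25 p26 p27 p28 p22 pj => p p3 p7 p5 p24 p25 p26 p27 p28 p22 pj.
apply: (@ok_blk_seq _ 31) => //; first by lia.
rewrite run_block_cons effectE run_incs upd_upd; mem_reads; set p0 := upd _ 29 _.
apply: (@ok_seq _ _ _ _ _ (b * 5 + 1) (a * 7 + 1)); last by lia.
apply: (@ok_for _ (fun i p' => [/\ header_read m e p', p' 24 = 0, p' 27 = top + 4 &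
    p' 7 = 2 * (a + b - i)]) b 3) => //.
- move=> i p' lt_i [[[k25 k26 k28] k29 k3 k22 kj] q24 q27 q7] q5; apply: (@ok_blk _ 3) => //;
    run_tac.
  rewrite q7 q5; split; last by lia.
  split=> //; last by lia.
  by split; [split|..|move=> j j30]; mem_reads => //; apply: kj.
- split; rewrite /p0; mem_reads => //; last by rewrite subn0.
  by split; [split|..|move=> j j30]; mem_reads => //; apply: pj.
move=> p1 [hp1 q24 q27 q7] _.
(* The loop register drops by two per turn, so [ok_for] does not fit. *)
apply: (@ok_count _ (fun i p' => [/\ header_read m e p', p' 24 = i, p' 27 = top + 4 + 2 * i &
    p' 7 = 2 * (a - i)]) a 5) => //.
- by move=> i p' le_i [_ _ _ ->]; lia.
- move=> i p' lt_i [[[k25 k26 k28] k29 k3 k22 kj] r24 r27 r7]; apply: (@ok_blk _ 5) => //; run_tac.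
  rewrite r7 r24 r27; split; mem_reads => //; try by lia.
  by split; [split|..|move=> j j30]; mem_reads => //; apply: kj.
- by split=> //; [rewrite q27 muln0 addn0 | rewrite q7; lia].
- by move=> p' [[[k25 k26 k28] k29 k3 k22 kj] r24 r27 _]; split.
Qed.

Definition relocate : cmd := locate_end ;; move_input ;; read_header.

Lemma relocate_ok F m T : m 0 = n -> m 1 = a -> m 2 = b -> 50 * (n + a + b + 10) <= T ->
  ok F relocate m T (fun m' =>
    [/\ [/\ m' 24 = a, m' 25 = b, m' 26 = top + 4, m' 27 = top + 4 + 2 * a & m' 28 = n],
        m' 29 = 30, m' 3 = 2 * (a + b), m' 22 = top + 4 + 2 * (a + b)
      & forall j, j < 2 * (a + b) -> m' (top + 4 + j) = m (4 + j)]).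
Proof.
move=> m0 m1 m2 le_T.
apply: (@ok_seq _ _ _ _ _ (10 * (a + b + 1)) (10 * (n + (4 + 2 * (a + b)) + 10) + 10 * (a + b +
  10))).
  2: by move: le_T; clear; lia.
apply: ok_weaken (locate_end_ok F m0 m1 m2 (leqnn _)) (leqnn _) _ => p [p0 p1 p2 p3 pj].
apply: (@ok_seq _ _ _ _ _ _ _ _ _ (leqnn _)).
have e4 : 4 <= 4 + 2 * (a + b) by clear; lia.
apply: ok_weaken (move_input_ok F p0 p1 p3 e4 (leqnn _)) (leqnn _) _ => q [[q1 q2 q3 q4 q5] qj].
apply: ok_weaken (read_header_ok F erefl q1 q2 q3 q4 q5 (leqnn _)) (leqnn _) _.
move=> r [hr r29 r3 r22 rj]; split=> //; first by rewrite r22 addnA.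
move=> j jl; have -> : top + 4 + j = top + (4 + j) by rewrite addnA.
by rewrite rj ?qj ?pj //; move: jl; clear; lia.
Qed.

End Relocation.

(** * Vertex records and adjacency lists *)

Section Initialization.

Variables (n : nat) (eL eR : seq ('I_n * 'I_n)).
Implicit Types (s : seq ('I_n * 'I_n)) (U : {set 'I_n}) (v w x y : 'I_n) (m : regs).

Local Notation top := (30 + 6 * n).
Local Notation eL0 := (top + 4).
Local Notation eR0 := (top + 4 + 2 * size eL).
Local Notation statics := (statics eL eR).

Local Notation heap := (top + 4 + 2 * (size eL + size eR)).

(** Turning a vertex number into a record address by increments costs O(n) per entry, hence O(n
    (|E_L| + |E_R|)) in all, which the bound allows. *)
Definition convert : cmd :=
  Blk [:: Mov 4 26] ;;
  While 3
    (Blk [:: Dec 3; LoadI 5 4; Mov 6 29] ;;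
     While 5 (Blk (Dec 5 :: incs 6 6)) ;;
     Blk [:: StoreI 4 6; Inc 4]).

Lemma convert_ok F m N (f : nat -> nat) T :
  m 3 = N -> m 26 = top + 4 -> m 29 = 30 -> (forall j, j < N -> f j <= n) ->
  (forall j, j < N -> m (top + 4 + j) = f j) -> N * (n * 9 + 8) + 2 <= T ->
  ok F convert m T (fun m' =>
    (forall r, r < 30 -> r \notin [:: 3; 4; 5; 6] -> m' r = m r) /\
    forall j, j < N -> m' (top + 4 + j) = vptr (f j)).
Proof.
move=> m3 m26 m29 fn mf le_T.
apply: (@ok_blk_seq _ 1) => //; first by move: le_T; clear; lia.
run_tac; rewrite m26; set m0 := upd _ 4 _.
apply: (@ok_for _ (fun i p => [/\ p 4 = top + 4 + i,
   forall r, r < 30 -> r \notin [:: 3; 4; 5; 6] -> p r = m r,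
   forall j, j < i -> p (top + 4 + j) = vptr (f j) &
   forall j, i <= j < N -> p (top + 4 + j) = f j]) N (n * 9 + 6)).
- move=> i p lt_i [p4 pr plow phigh] p3.
  apply: (@ok_blk_seq _ 3) => //; first by clear; lia.
  have p29 : p 29 = 30 by rewrite pr.
  have pi : p (top + 4 + i) = f i by rewrite phigh // leqnn lt_i.
  run_tac; rewrite p3 p4; mem_reads; rewrite pi p29; set q := upd _ 6 30.
  apply: (@ok_seq _ _ _ _ _ (f i * 9 + 1) 2); last by move: (fn i lt_i); clear; lia.
  apply: (@ok_for _ (fun k q' => q' 6 = 30 + 6 * k /\
     forall r, (r == 5) = false -> (r == 6) = false -> q' r = q r) (f i) 7) => //.
  + move=> k q' _ [q6 qr] q5; apply: (@ok_blk _ 7) => //.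
    rewrite run_block_cons effectE run_incs; mem_reads; rewrite q5 q6; split; last by clear; lia.
    by split=> [|r r5 r6]; [clear; lia | mem_reads; apply: qr].
  + move=> q' [q6 qr] _; apply: (@ok_blk _ 2) => //; run_tac.
    have q4 : q' 4 = top + 4 + i by rewrite qr // /q; mem_reads.
    have q3 : q' 3 = (N - i).-1 by rewrite qr // /q; mem_reads.
    rewrite q4 q6; mem_reads; rewrite q3 q4; split; last by move: lt_i; clear; lia.
    split; first by clear; lia.
    * move=> r r30; rewrite !inE !negb_or => /and4P[/negbTE r3 /negbTE r4 /negbTE r5 /negbTE r6].
      by mem_reads; rewrite qr // /q; mem_reads; apply: pr; rewrite // !inE r3 r4 r5 r6.
    * move=> j; rewrite ltnS leq_eqVlt => /orP[/eqP->|ji]; first by mem_reads.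
      by mem_reads; rewrite qr /q; mem_reads => //; apply: plow.
    * move=> j /andP[ij jN]; mem_reads; rewrite qr /q; mem_reads => //.
      by apply: phigh; rewrite ltnW.
- split; rewrite /m0; mem_reads => //; first by rewrite addn0.
    by move=> r r30; rewrite !inE !negb_or => /and4P[_ /negbTE r4 _ _]; mem_reads.
- by rewrite /m0; mem_reads.
- by move=> p [_ pr plow _] _.
- by move: le_T; clear; rewrite (_ : n * 9 + 6 + 2 = n * 9 + 8); lia.
Qed.

Definition init_vertices : cmd :=
  Blk [:: Clr 0; Clr 7; Clr 8; Inc 8] ;;
  vertex_loop 3 4 (Blk (StoreI 4 8 :: put 4 1 7 ++ put 4 4 7)).

Lemma init_vertices_ok F m T : m 28 = n -> m 29 = 30 -> n * 20 + 10 <= T ->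
  ok F init_vertices m T (fun m' =>
    [/\ frame n [:: 0; 1; 3; 4; 7; 8] [:: 0; 1; 4] m m', m' 0 = 0 &
      forall v, [/\ m' (field v 0) = 1, m' (field v 1) = 0 & m' (field v 4) = 0]]).
Proof.
move=> m28 m29 le_T; set L := [:: 0; 1; 3; 4; 7; 8].
apply: (@ok_blk_seq _ 4) => //; first by move: le_T; clear; lia.
run_tac; set m0 := upd _ 8 1.
have fr0 : frame n L [:: 0; 1; 4] m m0 by rewrite /m0; frame_tac.
apply: (@vertex_loop_ok n _ (fun i p => [/\ frame n L [:: 0; 1; 4] m p,
   p 0 = 0, p 7 = 0, p 8 = 1 & forall v, v < i ->
   [/\ p (field v 0) = 1, p (field v 1) = 0 & p (field v 4) = 0]]) 10) => //.
- move=> i p q fr [frp p0 p7 p8 pv]; rewrite !(regs_frame fr) //; split=> //.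
    by apply: frame_trans frp _; apply: frame_sub fr.
  by move=> v vi; rewrite !(field_frame _ fr) //; apply: pv.
- move=> v p [frp p0 p7 p8 pv] p4; apply: (@ok_blk _ 10) => //.
  run_tac; rewrite p4 p8; run_put v; rewrite (@run_put _ _ _ _ v) //; mem_reads; rewrite p7.
  split=> //; split=> //; first by apply: frame_trans frp _; frame_tac.
  move=> u; rewrite ltnS leq_eqVlt => /orP[/eqP/ord_inj->|uv]; first by mem_reads.
  have nuv : (u == v) = false by rewrite -val_eqE ltn_eqF.
  by mem_reads; apply: pv.
- by move=> p [frp p0 _ _ pv]; split=> // v; apply: pv.
- by move: le_T; clear; lia.
Qed.

(** Form of [list_at] used during construction: all cells lie below the allocation pointer, so fresh
    cells spoil no list. *)
Fixpoint list_below m lim p (l : seq 'I_n) : Prop :=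
  match l with
  | [::] => p = 0
  | x :: l' => [/\ top <= p, p.+1 < lim, m p = vptr x & list_below m lim (m p.+1) l']
  end.

Lemma list_below_ext m m' lim lim' p l :
  (forall i, top <= i < lim -> m' i = m i) -> lim <= lim' ->
  list_below m lim p l -> list_below m' lim' p l.
Proof.
move=> ext le_lim; elim: l p => //= x l IH p [hp hl mp lk].
rewrite !ext; try by move: hp hl; clear; lia.
by split=> //; [apply: leq_trans le_lim | apply: IH].
Qed.

Lemma list_below_at m lim p l : list_below m lim p l -> list_at m p l.
Proof. by elim: l p => //= x l IH p [hp hl mp lk]; split=> //; apply: IH. Qed.

Definition link (x y : nat) : seq instr :=
  [:: StoreI 22 y, Mov 8 22, Inc 22
    & get 7 x 4 ++ [:: StoreI 22 7, Inc 22 & put x 4 8]].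

Lemma run_link (x y : nat) m (a b : 'I_n) al (k : 'I_n -> seq 'I_n) :
  x < 30 -> y < 30 -> x \notin [:: 1; 7; 8; 22] -> y \notin [:: 1; 7; 8; 22] ->
  m x = vptr a -> m y = vptr b -> m 22 = al -> top <= al ->
  (forall v, list_below m al (m (field v 4)) (k v)) ->
  let m' := run_block (link x y) m in
  [/\ m' 22 = al + 2,
      forall v, list_below m' (al + 2) (m' (field v 4)) (if v == a then b :: k v else k v),
      forall r, r < 30 -> r \notin [:: 1; 7; 8; 22] -> m' r = m r,
      forall (v : 'I_n) f, f < 4 -> m' (field v f) = m (field v f)
    & forall i, top <= i < al -> m' i = m i].
Proof.
move=> x30 y30; rewrite !inE !negb_or.
move=> /and4P[/negbTE x1 /negbTE x7 /negbTE x8 /negbTE x22].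
move=> /and4P[/negbTE y1 /negbTE y7 /negbTE y8 /negbTE y22] mx my mal hal lk.
have an := ltn_ord a.
rewrite /link; run_tac; rewrite mal my.
have xal : (x == al) = false by move: x30 hal; clear; lia.
have xal1 : (x == al.+1) = false by move: x30 hal; clear; lia.
rewrite (@run_get_cat _ _ _ _ _ a); last by mem_reads.
mem_reads; run_tac; rewrite (@run_put _ _ _ _ a) //; last by mem_reads.
mem_reads; set m' := upd _ (field a 4) al.
have m'al : m' al = vptr b by rewrite /m'; mem_reads.
have m'al1 : m' al.+1 = m (field a 4) by rewrite /m'; mem_reads.
have low i : top <= i < al -> m' i = m i by move=> hi; rewrite /m'; mem_reads.
split=> //.
- by rewrite /m'; mem_reads; rewrite addn2.
- move=> v; have vn := ltn_ord v; have [->|/negbTE va] := eqVneq v a.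
    have -> : m' (field a 4) = al by rewrite /m'; mem_reads.
    rewrite /= m'al m'al1; split=> //; first by rewrite addn2.
    by apply: list_below_ext (lk a); rewrite ?leq_addr.
  have -> : m' (field v 4) = m (field v 4) by rewrite /m'; mem_reads.
  by apply: list_below_ext (lk v); rewrite ?leq_addr.
- move=> r r30; rewrite !inE !negb_or => /and4P[/negbTE r1 /negbTE r7 /negbTE r8 /negbTE r22].
  by rewrite /m'; mem_reads.
- move=> v f f4; have vn := ltn_ord v.
  have f6 : f < 6 by move: f4; clear; lia.
  rewrite /m' upd_ne; first by mem_reads.
  by rewrite field_eq // andbC; move: f4; clear; lia.
Qed.

Definition build_adjacency : cmd := edge_loop 24 26 (Blk (link 5 6 ++ link 6 5)).

Lemma build_adjacency_ok F m T :
  [/\ m 24 = size eL, m 25 = size eR, m 26 = eL0, m 27 = eR0 & m 28 = n] -> m 29 = 30 ->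
  edges_at m eL0 eL -> edges_at m eR0 eR -> m 22 = heap -> m 0 = 0 ->
  (forall v : 'I_n, [/\ m (field v 0) = 1, m (field v 1) = 0 & m (field v 4) = 0]) ->
  size eL * 50 + 3 <= T ->
  ok F build_adjacency m T (fun m' => ready eL eR m' setT).
Proof.
move=> [m24 m25 m26 m27 m28] m29 es1 es2 m22 m0 mv le_T.
(* Each edge allocates two cells of two words, whence [4 * size s1]. *)
pose I s1 p := [/\ forall r, r < 30 -> r \notin [:: 1; 3; 4; 5; 6; 7; 8; 22] -> p r = m r,
  forall (v : 'I_n) f, f < 4 -> p (field v f) = m (field v f),
  forall i, top <= i < heap -> p i = m i, p 22 = heap + 4 * size s1 &
  forall v, list_below p (p 22) (p (field v 4)) (adjacents s1 v)].
have edges s1 p : I s1 p -> edges_at p eL0 eL /\ edges_at p eR0 eR.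
  move=> [_ _ ph _ _]; split=> i e si; rewrite !ph ?es1 ?es2 //; try by move: si; clear; lia.
    exact: es1.
  exact: es2.
apply: (@edge_loop_ok n _ I eL eL0 40) => //.
- by move=> s1 p /edges[].
- move=> s1 p q fr [pr pf ph p22 pl]; split.
  + move=> r r30 rl; rewrite (regs_frame fr) ?pr //.
    by apply: contra rl; rewrite !inE => /or4P[] ->; rewrite ?orbT.
  + move=> v f f4; rewrite (field_frame _ fr) ?pf //; move: f4; clear; lia.
  + by move=> i hi; have [_ _ C] := fr; rewrite C ?ph //; move: hi; clear; lia.
  + by rewrite (regs_frame fr).
  + move=> v; rewrite (regs_frame fr) // (field_frame _ fr) //.
    apply: list_below_ext (pl v) => // i hi; have [_ _ C] := fr; rewrite C //.
    by move: hi; clear; lia.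
- move=> s1 e p [pr pf ph p22 pl] p5 p6; apply: (@ok_blk _ 34) => //; rewrite run_block_cat.
  rewrite p22 in pl.
  have hal : top <= heap + 4 * size s1 by clear; lia.
  have := @run_link 5 6 p _ _ _ _ isT isT isT isT p5 p6 p22 hal pl.
  move: (run_block (link 5 6) p) => q [q22 ql qr qf qh].
  have q5 : q 5 = vptr e.1 by rewrite qr.
  have q6 : q 6 = vptr e.2 by rewrite qr.
  have hal2 : top <= heap + 4 * size s1 + 2 by clear; lia.
  have := @run_link 6 5 q _ _ _ _ isT isT isT isT q6 q5 q22 hal2 ql.
  move: (run_block (link 6 5) q) => q' [q'22 q'l q'r q'f q'h].
  split; [split|by rewrite q'r ?qr|by rewrite q'r ?qr].
  + move=> r r30 rl; rewrite q'r ?qr ?pr //;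
    by apply: contra rl; rewrite !inE => /or4P[] ->; rewrite ?orbT.
  + by move=> v f f4; rewrite q'f ?qf ?pf.
  + by move=> i hi; rewrite q'h ?qh ?ph //; move: hi; clear; lia.
  + by rewrite q'22 size_rcons; clear; lia.
  + move=> v; rewrite q'22 adjacents_rcons /incident.
    by have := q'l v; rewrite ![v == _]eq_sym; case: (e.2 == v); case: (e.1 == v).
- split=> //; first by rewrite addn0.
  by move=> v; have [_ _ ->] := mv v.
- move=> p Ip; have [pr pf ph p22 pl] := Ip; have [ed1 ed2] := edges _ _ Ip.
  split; last by rewrite pr.
  + split; first by rewrite !pr.
    split; first by rewrite pr.
    by split=> // v; apply: list_below_at (pl v).
  + by move=> v; rewrite pf //; have [-> _ _] := mv v; rewrite inE.
  + by move=> v; rewrite pf //; have [_ -> _] := mv v.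
- by move: le_T; clear; lia.
Qed.
End Initialization.

(** * The main program and its running time *)

Section MainProgram.

Variables (n : nat) (eL eR : seq ('I_n * 'I_n)).
Implicit Types (s : seq ('I_n * 'I_n)) (U : {set 'I_n}) (v w x y : 'I_n) (m : regs).

Local Notation top := (30 + 6 * n).
Local Notation eL0 := (top + 4).
Local Notation eR0 := (top + 4 + 2 * size eL).
Local Notation statics := (statics eL eR).

Definition initialize : cmd := relocate ;; convert ;; init_vertices ;; build_adjacency.

Lemma size_encode_edges s : size (encode_edges s) = 2 * size s.
Proof. by elim: s => //= e s; rewrite /encode_edges /= => ->; rewrite mulnS. Qed.

Lemma nth_encode_edges s i e : i < size s ->
  nth 0 (encode_edges s) (2 * i) = (nth e s i).1 /\
  nth 0 (encode_edges s) (2 * i).+1 = (nth e s i).2.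
Proof.
elim: s i => //= d s IH [|i] // si.
by rewrite mulnS; apply: IH.
Qed.

Definition initialize_time :=
  50 * (n + size eL + size eR + 10) +
  2 * (size eL + size eR) * (n * 9 + 8) + n * 20 + size eL * 50 + 20.

Lemma initialize_ok F m T :
  m 0 = n -> m 1 = size eL -> m 2 = size eR ->
  (forall j, m (4 + j) = nth 0 (encode_edges eL ++ encode_edges eR) j) ->
  initialize_time <= T ->
  ok F initialize m T (fun m' => ready eL eR m' setT).
Proof.
set f := nth 0 _ => m0 m1 m2 mj le_T; set N := 2 * (size eL + size eR).
have fsize : size (encode_edges eL ++ encode_edges eR) = N.
  by rewrite size_cat !size_encode_edges /N mulnDr.
have fn j : j < N -> f j <= n.
  rewrite -fsize => jN; have : f j \in encode_edges eL ++ encode_edges eR by apply: mem_nth.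
  rewrite mem_cat /encode_edges.
  by case/orP=> /flattenP[k /mapP[e _ ->]]; rewrite !inE => /orP[]/eqP->; apply/ltnW/ltn_ord.
have fL i e : i < size eL -> f (2 * i) = (nth e eL i).1 /\ f (2 * i).+1 = (nth e eL i).2.
  move=> si; rewrite /f !nth_cat !size_encode_edges !ifT; try by move: si; clear; lia.
  exact: nth_encode_edges.
have fR i e : i < size eR -> f (2 * size eL + 2 * i) = (nth e eR i).1 /\
    f (2 * size eL + 2 * i).+1 = (nth e eR i).2.
  move=> si; rewrite /f -addnS !nth_cat !size_encode_edges !ifF ?addKn; try by clear; lia.
  exact: nth_encode_edges.
apply: (@ok_seq _ _ _ _ _ (50 * (n + size eL + size eR + 10))
  (N * (n * 9 + 8) + n * 20 + size eL * 50 + 20)); last by rewrite !addnA.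
apply: ok_weaken (relocate_ok F m0 m1 m2 (leqnn _)) (leqnn _) _.
move=> p [[p24 p25 p26 p27 p28] p29 p3 p22 pj].
apply: (@ok_seq _ _ _ _ _ (N * (n * 9 + 8) + 2) (n * 20 + size eL * 50 + 18)); last by clear; lia.
have pf j : j < N -> p (top + 4 + j) = f j by move=> jN; rewrite pj // mj.
apply: ok_weaken (convert_ok F p3 p26 p29 fn pf (leqnn _)) (leqnn _) _ => q [qr qf].
apply: (@ok_seq _ _ _ _ _ (n * 20 + 10) (size eL * 50 + 3)); last by clear; lia.
have q28 : q 28 = n by rewrite qr.
have q29 : q 29 = 30 by rewrite qr.
apply: ok_weaken (init_vertices_ok F q28 q29 (leqnn _)) (leqnn _) _ => r [fr r0 rv].
have rf j : j < N -> r (top + 4 + j) = vptr (f j).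
  by move=> jN; have [_ _ C] := fr; rewrite C ?qf //; clear; lia.
apply: build_adjacency_ok => //; try by rewrite (regs_frame fr) // qr.
- by split; rewrite (regs_frame fr) // qr.
- move=> i e si; have [e1 e2] := fL i e si.
  by rewrite -e1 -e2 -[(eL0 + _).+1]addnS !rf //; move: si; rewrite /N; clear; lia.
- move=> i e si; have [e1 e2] := fR i e si.
  rewrite (_ : eR0 + 2 * i = eL0 + (2 * size eL + 2 * i)); last by rewrite addnA.
  by rewrite -e1 -e2 -[(eL0 + _).+1]addnS !rf //; move: si; rewrite /N; clear; lia.
Qed.

(** The test on register 1 sets aside an empty blue list, where the allowed time need not even reach
    n. Otherwise there is a vertex, and n is at most [n ^ 2 * size eL]. *)
Definition main : cmd :=
  If 1 (If 3 (initialize ;; decide_left) (initialize ;; decide_right)) (Blk [:: Clr 0]).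

Lemma left_wins_no_blue lt : left_wins (edgeset ([::] : seq ('I_n * 'I_n))) (edgeset eR) lt = false.
Proof.
have e0 : edgeset ([::] : seq ('I_n * 'I_n)) = set0.
  by apply/setP=> A; rewrite edgesetE inE.
rewrite left_wins_play; [|exact: edgeset_small|exact: edgeset_small].
have dU U : degree_le1 (edgeset ([::] : seq ('I_n * 'I_n))) U.
  apply/forall_inP=> v _; rewrite (_ : nbr _ _ _ = set0) ?cards0 //.
  by apply/eqP; rewrite -subset0; apply/subsetP=> z; rewrite in_nbr e0 !inE !andbF.
have s0 : singletons (edgeset ([::] : seq ('I_n * 'I_n))) = set0.
  by apply/setP=> v; rewrite /singletons e0 !inE.
rewrite s0; case: lt; first exact: play_matching.
have [->|U0] := eqVneq [set: 'I_n] set0; first exact: play_right0.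
rewrite play_right //; have /set0Pn[v vU] := U0.
by apply/negbTE/forall_inPn; exists v => //; rewrite set0D play_matching ?andbF.
Qed.

(** The critical monomial is |E_L| |E_R|, from rebuilding the red mates in the opening chain; it is
    at most n^2 |E_L| because |E_R| is at most n^2. The 4 subtracted steps pay for the two tests in
    [main]. *)
Lemma total_time : 0 < n -> 0 < size eL -> size eR <= n ^ 2 ->
  initialize_time + decide_time eL eR <=
  100 * 100 * (n ^ 2 * size eL + n * size eR) + 100 * 100 - 4.
Proof.
rewrite /initialize_time /decide_time /chain_time /free_time.
move: (size eL) (size eR) => a b n0 a0 bn; rewrite -mulnn in bn *.
have l1 : n <= n * n * a by rewrite -mulnA leq_pmulr // muln_gt0 n0.
have l2 : a <= n * n * a by rewrite leq_pmull // muln_gt0 n0.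
have l3 : b <= n * b by rewrite leq_pmull.
have l4 : n * a <= n * n * a by rewrite leq_mul2r leq_pmull ?orbT.
have l5 : n * n <= n * n * a by rewrite leq_pmulr.
have l6 : a * b <= n * n * a by rewrite mulnC leq_mul2r bn orbT.
by move: l1 l2 l3 l4 l5 l6; clear; lia.
Qed.

Lemma main_ok lt (uL : uniq (edge_sets eL)) (uR : uniq (edge_sets eR)) :
  let F m' := m' 0 = left_wins (edgeset eL) (edgeset eR) lt in
  ok F main (input eL eR lt) (100 * 100 * (n ^ 2 * size eL + n * size eR) + 100 * 100) F.
Proof.
move=> F; set m := input eL eR lt; set T := _ + _.
have m0 : m 0 = n by [].
have m1 : m 1 = size eL by [].
have m2 : m 2 = size eR by [].
have m3 : m 3 = lt by [].
have mj j : m (4 + j) = nth 0 (encode_edges eL ++ encode_edges eR) j by [].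
apply: ok_if; last by rewrite /T; clear; lia.
  rewrite m1 => a0.
  have n0 : 0 < n by case: (eL) a0 => // -[x _] _ _; apply: leq_ltn_trans (ltn_ord x).
  have le_T : initialize_time + decide_time eL eR <= T - 4.
    move: a0; rewrite -lt0n => a0.
    by have := total_time n0 a0 (size_edges_le uR).
  apply: ok_if; last by rewrite /T; clear; lia.
    rewrite m3 => lt1; have ltE : lt = true by case: (lt) lt1.
    apply: (@ok_seq _ _ _ _ _ initialize_time (decide_time eL eR)).
      2: by move: le_T; clear; rewrite -subnDA.
    apply: ok_weaken (initialize_ok F m0 m1 m2 mj (leqnn _)) (leqnn _) _ => p rp.
    by have := decide_left_ok uL uR rp (leqnn _); rewrite /F ltE.
  rewrite m3 => lt0; have ltE : lt = false by case: (lt) lt0.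
  apply: (@ok_seq _ _ _ _ _ initialize_time (decide_time eL eR)).
    2: by move: le_T; clear; rewrite -subnDA.
  apply: ok_weaken (initialize_ok F m0 m1 m2 mj (leqnn _)) (leqnn _) _ => p rp.
  by have := decide_right_ok uL uR rp (leqnn _); rewrite /F ltE.
rewrite m1 => /size0nil a0; apply: (@ok_blk _ 1) => //; first by rewrite /T; clear; lia.
rewrite /F a0 left_wins_no_blue; run_tac; by mem_reads.
Qed.
End MainProgram.

Theorem theorem11 :
  exists (P : program) (c : nat),
    forall (n : nat) (eL eR : seq ('I_n * 'I_n)) (lfirst : bool),
      uniq [seq [set p.1; p.2] | p <- eL] ->
      uniq [seq [set p.1; p.2] | p <- eR] ->
      exists (t : nat) (m : regs),
        t <= c * (n ^ 2 * size eL + n * size eR) + c /\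
        exec P t 0 (input eL eR lfirst) = Some m /\
        m 0 = nat_of_bool (left_wins (edgeset eL) (edgeset eR) lfirst).
Proof.
exists (compile (code_size main) main 0), (100 * 100) => n eL eR lt uL uR.
have [t [h [m [bs le_t ans]]]] := main_ok lt uL uR.
exists t, m; split=> //; split; first exact: exec_program bs.
by case: h ans {bs}.
Qed.
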